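(* Let $\theta,\varphi\in\mathbb R$, $R>\hat R:=8\,e^{(2e)^{-1}}$ and $T>0$. Then there exists a number $\hat C>0$ such that for all functions $y^0,\widetilde y^0\in\mathcal R_{R,\hat C}$ which are even with respect to $0$, there exist $y\in G^{1,2}([0,1]\times[0,T])$ and $v\in G^2([0,T])$ satisfying $$\partial_ty=e^{i\theta}\partial_x^2y+e^{i\varphi}|y|^2y,\quad x\in[0,1],\ t\in[0,T],$$ $$\partial_xy(0,t)=0,\quad \partial_xy(1,t)=v(t),\quad t\in[0,T],$$ $$y(x,0)=y^0(x),\quad x\in[0,1],$$ together with $y(x,T)=\widetilde y^0(x)$ for all $x\in[0,1]$.
   Context: All functions are complex-valued. $\mathcal R_{R,C}$ ($R>1$, $C>0$): functions $z:[-1,1]\to\mathbb C$ for which there is a complex sequence $(\alpha_n)_{n\ge0}$ with $|\alpha_n|\le C\,n!/R^n$ for all $n$ and $z(x)=\sum_{n\ge0}\alpha_nx^n/n!$ for all $x\in[-1,1]$. Gevrey classes: $h\in G^s([t_1,t_2])$ if $h\in C^\infty$ and $|h^{(p)}(t)|\le C(p!)^s/R^p$ for some $C,R>0$ and all $p\in\mathbb N$, $t\in[t_1,t_2]$. $y\in G^{s_1,s_2}([x_1,x_2]\times[t_1,t_2])$ if $y\in C^\infty$ and $|\partial_x^{p_1}\partial_t^{p_2}y(x,t)|\le C(p_1!)^{s_1}(p_2!)^{s_2}/(R_1^{p_1}R_2^{p_2})$ for some $C,R_1,R_2>0$, all $(x,t)$ and all $p_1,p_2\in\mathbb N$. *)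

(* Defs.v *)
From Stdlib Require Import Reals Factorial Lra.
From Coquelicot Require Import Coquelicot.
Open Scope R_scope.

(** Functions on [[a,b]] are represented by total functions on [R]; nothing
    below depends on their values outside [[a,b]], provided [a < b].

    [is_derive_in a b f x l] is Coquelicot's [is_derive f x l] with [locally x]
    restricted to [[a,b]], so it is the one-sided derivative at [a] and [b]. *)
Definition is_derive_in (a b : R) (f : R -> C) (x : R) (l : C) : Prop :=
  @filterdiff R_AbsRing R_NormedModule C_R_NormedModule f
    (within (fun u => a <= u <= b) (locally x))
    (fun u : R => @scal R_AbsRing C_R_NormedModule u l).

Definition ex_derive_in (a b : R) (f : R -> C) (x : R) : Prop :=
  exists l : C, is_derive_in a b f x l.

Definition Derive_in (a b : R) (f : R -> C) (x : R) : C :=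
  @iota C_R_CompleteNormedModule (fun l => is_derive_in a b f x l).

Definition Derive_n_in (a b : R) (n : nat) (f : R -> C) : R -> C :=
  Nat.iter n (Derive_in a b) f.

Lemma norm_C_R (z : C) : @norm R_AbsRing C_R_NormedModule z = Cmod z.
Proof.
change (sqrt (Rabs (fst z) ^ 2 + Rabs (snd z) ^ 2) = Cmod z).
now rewrite !pow2_abs.
Qed.

Lemma scal_C_R (k : R) (z : C) :
  @scal R_AbsRing C_R_NormedModule k z = (RtoC k * z)%C.
Proof.
destruct z; apply injective_projections; cbv -[Rplus Rmult Ropp Rminus]; ring.
Qed.

Lemma is_derive_in_inj (a b : R) (f : R -> C) (x : R) (l m : C) :
  a < b -> a <= x <= b ->
  is_derive_in a b f x l -> is_derive_in a b f x m -> l = m.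
Proof.
intros Hab Hx [_ Hl] [_ Hm].
assert (HF : is_filter_lim (within (fun u => a <= u <= b) (locally x)) x).
{ intros P HP; unfold within; apply filter_imp with (2:=HP); auto. }
specialize (Hl x HF); specialize (Hm x HF).
assert (H : forall eps : posreal, @norm R_AbsRing C_R_NormedModule (minus l m) <= 2 * eps).
{ intros eps.
  destruct (filter_and _ _ (Hl eps) (Hm eps)) as [d Hd].
  assert (Hu : exists u, a <= u <= b /\ u <> x /\ Rabs (u - x) < d).
  { pose proof (cond_pos d). 
    destruct (Rlt_dec x b).
    - exists (x + Rmin (b - x) (d/2)).
      pose proof (Rmin_l (b-x) (d/2)); pose proof (Rmin_r (b-x) (d/2)).
      assert (0 < Rmin (b-x) (d/2)) by (apply Rmin_pos; lra).
      rewrite Rabs_pos_eq; lra.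
    - exists (x - Rmin (x-a) (d/2)).
      pose proof (Rmin_l (x-a) (d/2)); pose proof (Rmin_r (x-a) (d/2)).
      assert (0 < Rmin (x-a) (d/2)) by (apply Rmin_pos; lra).
      rewrite Rabs_left; lra. }
  destruct Hu as [u [Hu1 [Hu2 Hu3]]].
  destruct (Hd u Hu3 Hu1) as [H1 H2].
  set (A := minus (f u) (f x)) in *.
  assert (Hs : forall k : R, @scal R_AbsRing C_R_NormedModule k (minus l m) =
    @minus C_R_NormedModule (@minus C_R_NormedModule A (@scal R_AbsRing C_R_NormedModule k m)) (@minus C_R_NormedModule A (@scal R_AbsRing C_R_NormedModule k l))).
  { intros k; destruct A, l, m.
    apply injective_projections; cbv -[Rplus Rmult Ropp]; ring. }
  assert (Hn : Rabs (u - x) * @norm R_AbsRing C_R_NormedModule (minus l m) <= Rabs (u-x) * (2 * eps)).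
  { rewrite norm_C_R, <- (Cmod_R (u - x)), <- Cmod_mult, <- scal_C_R, <- norm_C_R, Hs.
    eapply Rle_trans; [apply (@norm_triangle R_AbsRing C_R_NormedModule)|].
    rewrite (@norm_opp R_AbsRing C_R_NormedModule).
    change (norm (minus u x)) with (Rabs (u - x)) in H1, H2.
    eapply Rle_trans; [apply Rplus_le_compat; [exact H2 | exact H1]|].
    rewrite Cmod_R; right; ring. }
  apply Rmult_le_reg_l in Hn; auto. apply Rabs_pos_lt; lra. }
assert (H0 : @norm R_AbsRing C_R_NormedModule (minus l m) = 0).
{ apply Rle_antisym; [|apply norm_ge_0].
  apply le_epsilon; intros e He.
  assert (He' : 0 < e / 2) by lra.
  specialize (H (mkposreal _ He')); simpl in H; lra. }
apply norm_eq_zero in H0.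
destruct l, m; injection H0; intros.
apply injective_projections; cbv -[Rplus Ropp] in *; lra.
Qed.

Lemma is_derive_in_unique (a b : R) (f : R -> C) (x : R) (l : C) :
  a < b -> a <= x <= b -> is_derive_in a b f x l -> Derive_in a b f x = l.
Proof.
intros Hab Hx Hl.
apply (@iota_unique R_AbsRing C_R_CompleteNormedModule); [ | exact Hl].
intros m Hm; exact (is_derive_in_inj a b f x m l Hab Hx Hm Hl).
Qed.

Definition smooth_in (a b : R) (h : R -> C) : Prop :=
  forall (n : nat) (t : R), a <= t <= b ->
    ex_derive_in a b (Derive_n_in a b n h) t.

(** [G^s([t1,t2])]; the power [(p!)^s] has a real exponent [s]. *)
Definition Gevrey (s t1 t2 : R) (h : R -> C) : Prop :=
  smooth_in t1 t2 h /\
  exists M r : R, 0 < M /\ 0 < r /\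
    forall (p : nat) (t : R), t1 <= t <= t2 ->
      Cmod (Derive_n_in t1 t2 p h t) <= M * Rpower (INR (fact p)) s / r ^ p.

Definition partial_x (x1 x2 : R) (y : R -> R -> C) : R -> R -> C :=
  fun x t => Derive_in x1 x2 (fun u => y u t) x.

Definition partial_t (t1 t2 : R) (y : R -> R -> C) : R -> R -> C :=
  fun x t => Derive_in t1 t2 (fun u => y x u) t.

(** [C^k] on the closed rectangle: continuous and, if [k > 0], with both first
    partial derivatives existing everywhere and of class [C^(k-1)]. *)
Fixpoint Ck_rect (k : nat) (x1 x2 t1 t2 : R) (y : R -> R -> C) : Prop :=
  continuous_on (fun p : R * R => x1 <= fst p <= x2 /\ t1 <= snd p <= t2)
    (fun p : R * R => y (fst p) (snd p)) /\
  match k with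
  | O => True
  | S k' =>
      (forall x t : R, x1 <= x <= x2 -> t1 <= t <= t2 ->
         ex_derive_in x1 x2 (fun u => y u t) x /\
         ex_derive_in t1 t2 (fun u => y x u) t) /\
      Ck_rect k' x1 x2 t1 t2 (partial_x x1 x2 y) /\
      Ck_rect k' x1 x2 t1 t2 (partial_t t1 t2 y)
  end.

Definition smooth_rect (x1 x2 t1 t2 : R) (y : R -> R -> C) : Prop :=
  forall k : nat, Ck_rect k x1 x2 t1 t2 y.

Definition Gevrey2 (s1 s2 x1 x2 t1 t2 : R) (y : R -> R -> C) : Prop :=
  smooth_rect x1 x2 t1 t2 y /\
  exists M r1 r2 : R, 0 < M /\ 0 < r1 /\ 0 < r2 /\
    forall (p1 p2 : nat) (x t : R), x1 <= x <= x2 -> t1 <= t <= t2 ->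
      Cmod (Nat.iter p1 (partial_x x1 x2) (Nat.iter p2 (partial_t t1 t2) y) x t)
      <= M * Rpower (INR (fact p1)) s1 * Rpower (INR (fact p2)) s2
         / (r1 ^ p1 * r2 ^ p2).

(** The class [R_{r,M}] of functions on [[-1,1]]. *)
Definition class_R (r M : R) (z : R -> C) : Prop :=
  exists alpha : nat -> C,
    (forall n : nat, Cmod (alpha n) <= M * INR (fact n) / r ^ n) /\
    (forall x : R, -1 <= x <= 1 ->
       @is_series R_AbsRing C_R_NormedModule
         (fun n => (alpha n * RtoC (x ^ n / INR (fact n)))%C) (z x)).

Definition even_on_unit (z : R -> C) : Prop :=
  forall x : R, -1 <= x <= 1 -> z (- x) = z x.

Definition Cexpi (theta : R) : C := (cos theta, sin theta).

(* Main.v *)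
Require Import Defs.
From Stdlib Require Import Reals Factorial Lra Lia Wf_nat FunctionalExtensionality.
From Coquelicot Require Import Coquelicot.
Open Scope R_scope.

(** The state is steered by choosing its trace [f(t) = y(0,t)] at the
    symmetric end (flatness).  An even solution is a power series
    [y(x,t) = sum_k c_k(t) x^(2k)], and on the array [c k n] of its Taylor
    coefficients (index [k] for [x^2], index [n] for [t]) the equation is a
    recursion, [array_equation], in which the linear part only exchanges the
    neighbours [c k (n+1)] and [c (k+1) n].  The array is therefore determined
    by its column [n = 0], the initial state, and also by its row [k = 0], the
    Taylor coefficients of [f].

    Measured against [weight k n = (2k+2n)! / ((2k)! n!)], which is
    supermultiplicative and for which a time derivative is worth two space
    derivatives, the linear exchange is free and the cubic term costs a factor
    [1 + O(e^2)] per step for data of size [e] ([majorant_step]).  Hence, for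
    small data, geometric bounds travel from the column to the row
    ([array_bound_from_column]) and from the row to the whole array
    ([array_bound_from_row]) with an arbitrarily small deterioration of the
    rate.

    Both states [y0] and [yT] yield a row of prescribed Taylor coefficients,
    one at [t = 0] and one at [t = T], of size [rho^n (2n)!/n!] with [rho]
    slightly above [1/r^2].  These coefficients do not define a convergent
    series, so a function with the prescribed expansion is built by truncated
    Laplace integrals ([borel_ritt]); the price is a factor just
    above [18] on [rho].  A cutoff that is flat at both ends ([flat_cutoff]) glues the two
    functions ([two_point_borel_ritt]).

    With [f] in hand, the recursion defines the functions [c_k], the bounds
    make the power series in [x] converge with all its derivatives as soon as
    the rate of [f] is below [4/9] ([series_term_bound]), and the hypothesis on
    [r] leaves room for the total loss.  At [t = 0] and [t = T] the array of
    [y] has the same row as the array computed from [y0], resp. [yT]; since the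
    row determines the array ([array_unique]), the states are attained. *)

(** * Binomial coefficients and the weights *)

(** The binomial coefficient of [a + b] over [a], in the form that makes
    Pascal's rule free of subtractions. *)
Definition binomial (a b : nat) : R :=
  INR (fact (a + b)) / (INR (fact a) * INR (fact b)).

Lemma fact_S (n : nat) : INR (fact (S n)) = (INR n + 1) * INR (fact n).
Proof. rewrite fact_simpl, mult_INR, S_INR; ring. Qed.

Lemma fact_pos (n : nat) : 0 < INR (fact n).
Proof. apply INR_fact_lt_0. Qed.

Lemma fact_le_mono (m n : nat) : (m <= n)%nat -> INR (fact m) <= INR (fact n).
Proof. intros H; apply le_INR, fact_le, H. Qed.

Lemma binomial_0_l (b : nat) : binomial 0 b = 1.
Proof.
unfold binomial; pose proof (fact_pos b); simpl (0 + b)%nat; simpl (fact 0).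
simpl INR; field; lra.
Qed.

Lemma binomial_sym (a b : nat) : binomial a b = binomial b a.
Proof. unfold binomial; rewrite (Nat.add_comm a b), (Rmult_comm (INR (fact a))); reflexivity. Qed.

Lemma binomial_pascal (a b : nat) :
  binomial (S a) (S b) = binomial a (S b) + binomial (S a) b.
Proof.
unfold binomial.
replace (S a + S b)%nat with (S (S (a + b))) by lia.
replace (a + S b)%nat with (S (a + b)) by lia.
replace (S a + b)%nat with (S (a + b)) by lia.
rewrite !fact_S, S_INR, plus_INR.
pose proof (fact_pos a); pose proof (fact_pos b).
pose proof (pos_INR a); pose proof (pos_INR b).
field; repeat split; lra.
Qed.

Lemma binomial_pos (a b : nat) : 0 < binomial a b.
Proof.
unfold binomial.
pose proof (fact_pos a); pose proof (fact_pos b); pose proof (fact_pos (a+b)).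
apply Rdiv_lt_0_compat; nra.
Qed.

Lemma fact_plus (a b : nat) :
  INR (fact (a + b)) = binomial a b * (INR (fact a) * INR (fact b)).
Proof.
unfold binomial; pose proof (fact_pos a); pose proof (fact_pos b); field; lra.
Qed.

(** Induction along Pascal's rule, which bounds such as powers of [1 + x] or
    other binomial coefficients obey as well. *)
Lemma pascal_ind (P : nat -> nat -> Prop) :
  (forall b, P 0%nat b) -> (forall a, P a 0%nat) ->
  (forall a b, P a (S b) -> P (S a) b -> P (S a) (S b)) ->
  forall a b, P a b.
Proof.
intros H0l H0r HS a; induction a as [|a IHa]; [exact H0l|].
intros b; induction b as [|b IHb]; [apply H0r|].
apply HS; auto.
Qed.

(** One term of the expansion of [(1 + x)^(a + b)]. *)
Lemma binomial_growth (x : R) (a b : nat) :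
  0 <= x -> binomial a b * x ^ b <= (1 + x) ^ (a + b).
Proof.
intros Hx; revert a b; apply pascal_ind.
- intros b; rewrite binomial_0_l, Rmult_1_l; apply pow_incr; lra.
- intros a; rewrite binomial_sym, binomial_0_l, Nat.add_0_r; simpl.
  rewrite Rmult_1_l; apply pow_R1_Rle; lra.
- intros a b H1 H2; rewrite binomial_pascal.
  replace (a + S b)%nat with (S (a + b)) in H1 by lia.
  replace (S a + b)%nat with (S (a + b)) in H2 by lia.
  replace (S a + S b)%nat with (S (S (a + b))) by lia.
  apply (Rmult_le_compat_l x) in H2; [|exact Hx].
  simpl in *; lra.
Qed.

Lemma binomial_mono (c d b : nat) : binomial c d <= binomial c (b + d).
Proof.
induction b as [|b IH]; [apply Rle_refl|].
eapply Rle_trans; [exact IH|simpl].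
destruct c; [rewrite !binomial_0_l; lra|].
rewrite (binomial_pascal c); pose proof (binomial_pos c (S (b + d))); lra.
Qed.

(** Choosing from two disjoint urns is one way of choosing from their union. *)
Lemma binomial_supermult (a b c d : nat) :
  binomial a b * binomial c d <= binomial (a + c) (b + d).
Proof.
revert a b; apply pascal_ind.
- intros b; rewrite binomial_0_l, Rmult_1_l; apply binomial_mono.
- intros a; rewrite binomial_sym, binomial_0_l, Rmult_1_l.
  rewrite (binomial_sym c), (binomial_sym (a + c)); apply binomial_mono.
- intros a b H1 H2; simpl in *; rewrite !binomial_pascal; lra.
Qed.

Lemma binomial_ge_1 (a b : nat) : 1 <= binomial a b.
Proof.
pose proof (binomial_mono a 0 b) as H.
rewrite Nat.add_0_r, (binomial_sym a 0), binomial_0_l in H; exact H.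
Qed.

Lemma fact_mult_le (a b : nat) : INR (fact a) * INR (fact b) <= INR (fact (a + b)).
Proof.
rewrite fact_plus; pose proof (binomial_ge_1 a b).
pose proof (fact_pos a); pose proof (fact_pos b).
assert (0 < INR (fact a) * INR (fact b)) by nra; nra.
Qed.

(** The growth allowed for the Taylor coefficient of [x^(2k) t^n]: one time
    derivative counts for two space derivatives, so that the derivative of order
    [(2k, n)] may reach [(2k+2n)!]. *)
Definition weight (k n : nat) : R :=
  INR (fact (2 * k + 2 * n)) / (INR (fact (2 * k)) * INR (fact n)).

Lemma weight_pos (k n : nat) : 0 < weight k n.
Proof.
unfold weight; pose proof (fact_pos (2*k)); pose proof (fact_pos n).
apply Rdiv_lt_0_compat; [apply fact_pos | nra].
Qed.

(** This lets products of arrays be majorized by convolutions of the remaining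
    factors; [binomial p q <= binomial (2p) (2q)] holds because
    the square of [binomial p q >= 1] is at most [binomial (2p) (2q)]. *)
Lemma weight_supermult (i p j q : nat) :
  weight i p * weight j q <= weight (i + j) (p + q).
Proof.
assert (E : forall k n, weight k n = binomial (2*k) (2*n) * (INR (fact (2*n)) / INR (fact n))).
{ intros k n; unfold weight, binomial.
  pose proof (fact_pos (2*k)); pose proof (fact_pos n); pose proof (fact_pos (2*n)).
  field; lra. }
assert (V : forall n, 0 < INR (fact (2*n)) / INR (fact n))
 by (intros n; apply Rdiv_lt_0_compat; apply fact_pos).
rewrite !E.
assert (HV : INR (fact (2*p)) / INR (fact p) * (INR (fact (2*q)) / INR (fact q))
   <= INR (fact (2*(p+q))) / INR (fact (p+q))).
{ assert (Hb : binomial p q <= binomial (2*p) (2*q)).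
  { pose proof (binomial_supermult p q p q).
    replace (p + p)%nat with (2*p)%nat in * by lia.
    replace (q + q)%nat with (2*q)%nat in * by lia.
    pose proof (binomial_ge_1 p q); nra. }
  replace (2*(p+q))%nat with (2*p+2*q)%nat by lia.
  rewrite (fact_plus p q), (fact_plus (2*p)).
  pose proof (V p); pose proof (V q).
  pose proof (fact_pos p); pose proof (fact_pos q).
  pose proof (fact_pos (2*p)); pose proof (fact_pos (2*q)).
  pose proof (binomial_pos p q).
  replace (binomial (2*p) (2*q) * (INR (fact (2*p)) * INR (fact (2*q))) /
    (binomial p q * (INR (fact p) * INR (fact q)))) with
    ((binomial (2*p) (2*q) / binomial p q) *
     (INR (fact (2*p)) / INR (fact p) * (INR (fact (2*q)) / INR (fact q)))) by (field; lra).
  assert (1 <= binomial (2*p) (2*q) / binomial p q).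
  { apply Rle_div_r; lra. }
  assert (0 < INR (fact (2*p)) / INR (fact p) * (INR (fact (2*q)) / INR (fact q))) by nra.
  nra. }
pose proof (binomial_supermult (2*i) (2*p) (2*j) (2*q)) as HB.
replace (2*i+2*j)%nat with (2*(i+j))%nat in HB by lia.
replace (2*p+2*q)%nat with (2*(p+q))%nat in HB by lia.
pose proof (V p); pose proof (V q).
pose proof (binomial_pos (2*i) (2*p)); pose proof (binomial_pos (2*j) (2*q)).
set (x := INR (fact (2*p)) / INR (fact p)) in *.
set (y := INR (fact (2*q)) / INR (fact q)) in *.
set (B1 := binomial (2*i) (2*p)) in *. set (B2 := binomial (2*j) (2*q)) in *.
replace (B1 * x * (B2 * y)) with ((B1 * B2) * (x * y)) by ring.
apply Rmult_le_compat; try exact HB; try exact HV; nra.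
Qed.

(** The coefficients of [y_xx] and of [y_t] are weighed alike: the linear part
    of the equation costs nothing. *)
Lemma weight_S_l (k n : nat) :
  (2 * INR k + 1) * (2 * INR k + 2) * weight (S k) n = (INR n + 1) * weight k (S n).
Proof.
unfold weight.
replace (2 * S k + 2 * n)%nat with (2 * k + 2 * S n)%nat by lia.
replace (2 * S k)%nat with (S (S (2 * k))) by lia.
rewrite !fact_S, S_INR, mult_INR.
pose proof (fact_pos (2*k)); pose proof (fact_pos n).
pose proof (pos_INR k); pose proof (pos_INR n); simpl (INR 2).
field; repeat split; lra.
Qed.

Lemma weight_S_r (k n : nat) :
  (INR n + 1) * weight k (S n) =
  (2 * INR (k + n) + 1) * (2 * INR (k + n) + 2) * weight k n.
Proof.
unfold weight.
replace (2 * k + 2 * S n)%nat with (S (S (2 * (k + n)))) by lia.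
replace (2 * k + 2 * n)%nat with (2 * (k + n))%nat by lia.
rewrite !fact_S, S_INR, !mult_INR.
pose proof (fact_pos (2*k)); pose proof (fact_pos n).
pose proof (pos_INR k); pose proof (pos_INR n); simpl (INR 2).
field; repeat split; lra.
Qed.

Lemma weight_0_l (n : nat) : weight 0 n = INR (fact (2 * n)) / INR (fact n).
Proof. unfold weight; simpl (fact (2*0)); simpl (2*0+_)%nat; simpl (INR 1); f_equal; ring. Qed.

Lemma weight_0_r (k : nat) : weight k 0 = 1.
Proof.
unfold weight; rewrite Nat.mul_0_r, Nat.add_0_r; simpl (fact 0); simpl (INR 1).
pose proof (fact_pos (2*k)); field; lra.
Qed.

(** Bernoulli's inequality: a polynomial factor costs an arbitrarily small
    increase of a geometric rate. *)
Lemma linear_le_geometric (x : R) (n : nat) :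
  0 < x <= 1 -> INR n + 1 <= / x * (1 + x) ^ n.
Proof.
intros Hx.
apply Rmult_le_reg_l with x; [lra|].
rewrite <- Rmult_assoc, Rinv_r, Rmult_1_l by lra.
pose proof (poly n x (proj1 Hx)).
pose proof (pos_INR n); nra.
Qed.

(** * One-sided calculus of complex-valued functions *)

Lemma is_derive_in_iff (a b : R) (f : R -> C) (x : R) (l : C) :
  a <= x <= b ->
  is_derive_in a b f x l <->
  (forall eps, 0 < eps -> exists d, 0 < d /\ forall u, a <= u <= b -> Rabs (u - x) < d ->
     Cmod (f u - f x - RtoC (u - x) * l) <= eps * Rabs (u - x)).
Proof.
intros Hx.
assert (E : forall u, @norm R_AbsRing C_R_NormedModule
    (minus (minus (f u) (f x)) (@scal R_AbsRing C_R_NormedModule (minus u x) l))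
    = Cmod (f u - f x - RtoC (u - x) * l)).
{ intros u; rewrite norm_C_R; f_equal.
  rewrite scal_C_R; unfold minus, plus, opp; simpl.
  unfold Cminus, Rminus; reflexivity. }
split.
- intros [_ H] eps Heps.
  assert (HF : is_filter_lim (within (fun u => a <= u <= b) (locally x)) x).
  { intros P HP; unfold within; apply filter_imp with (2:=HP); auto. }
  destruct (H x HF (mkposreal eps Heps)) as [d Hd].
  exists d; split; [apply cond_pos|]; intros u Hu Hux.
  specialize (Hd u Hux Hu); rewrite <- E; exact Hd.
- intros H; split; [apply @is_linear_scal_l|].
  intros x' Hx'.
  assert (x' = x) as ->.
  { apply (is_filter_lim_locally_unique (V:=R_NormedModule)).
    intros P HP; apply locally_locally in HP.
    assert (Hcl : forall e : posreal, ball x e x').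
    { intros e. pose proof (Hx' (ball x' e) (locally_ball x' e)) as H1.
      apply ball_sym; exact (locally_singleton _ _ H1 Hx). }
    apply locally_singleton in HP.
    destruct HP as [e He].
    exists (mkposreal _ (is_pos_div_2 e)); intros z Hz.
    apply He. apply ball_le with (e/2 + e/2); [lra|].
    apply ball_triangle with x'; [apply (Hcl (mkposreal _ (is_pos_div_2 e)))|exact Hz]. }
  intros eps; destruct (H eps (cond_pos eps)) as (d & Hd & Hu).
  exists (mkposreal d Hd); intros u Hux Hab.
  eapply Rle_trans; [right; exact (E u) | exact (Hu u Hab Hux)].
Qed.

Lemma is_derive_in_ext (a b : R) (f g : R -> C) (x : R) (l : C) :
  a <= x <= b -> (forall u, a <= u <= b -> f u = g u) ->
  is_derive_in a b f x l -> is_derive_in a b g x l.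
Proof.
intros Hx E; rewrite !is_derive_in_iff by exact Hx; intros H eps Heps.
destruct (H eps Heps) as (d & Hd & Hu); exists d; split; [exact Hd|].
intros u Hu1 Hu2; rewrite <- !E by assumption; auto.
Qed.

Lemma is_derive_in_sub (a b a' b' : R) (f : R -> C) (x : R) (l : C) :
  a <= a' -> b' <= b -> a' <= x <= b' -> is_derive_in a b f x l -> is_derive_in a' b' f x l.
Proof.
intros Ha Hb Hx; rewrite !is_derive_in_iff by lra; intros H eps Heps.
destruct (H eps Heps) as (d & Hd & Hu); exists d; split; [exact Hd|].
intros u Hu1 Hu2; apply Hu; lra.
Qed.

Lemma is_derive_in_plus (a b : R) (f g : R -> C) (x : R) (l m : C) :
  a <= x <= b -> is_derive_in a b f x l -> is_derive_in a b g x m ->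
  is_derive_in a b (fun u => (f u + g u)%C) x (l + m)%C.
Proof.
intros Hx; rewrite !is_derive_in_iff by exact Hx; intros Hf Hg eps Heps.
destruct (Hf (eps/2)) as (d1 & Hd1 & H1); [lra|].
destruct (Hg (eps/2)) as (d2 & Hd2 & H2); [lra|].
exists (Rmin d1 d2); split; [apply Rmin_pos; auto|]; intros u Hu Hux.
pose proof (Rmin_l d1 d2); pose proof (Rmin_r d1 d2).
replace (f u + g u - (f x + g x) - RtoC (u - x) * (l + m))%C with
  ((f u - f x - RtoC (u - x) * l) + (g u - g x - RtoC (u - x) * m))%C by ring.
eapply Rle_trans; [apply Cmod_triangle|].
specialize (H1 u Hu ltac:(lra)); specialize (H2 u Hu ltac:(lra)); lra.
Qed.

Lemma is_derive_in_scal (a b : R) (c : C) (f : R -> C) (x : R) (l : C) :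
  a <= x <= b -> is_derive_in a b f x l ->
  is_derive_in a b (fun u => (c * f u)%C) x (c * l)%C.
Proof.
intros Hx; rewrite !is_derive_in_iff by exact Hx; intros Hf eps Heps.
pose proof (Cmod_ge_0 c) as Hc.
destruct (Hf (eps/(Cmod c + 1))) as (d & Hd & H1); [apply Rdiv_lt_0_compat; lra|].
exists d; split; [exact Hd|]; intros u Hu Hux.
replace (c * f u - c * f x - RtoC (u - x) * (c * l))%C
  with (c * (f u - f x - RtoC (u - x) * l))%C by ring.
rewrite Cmod_mult; specialize (H1 u Hu Hux); pose proof (Rabs_pos (u - x)).
apply Rle_trans with (Cmod c * (eps / (Cmod c + 1) * Rabs (u - x))).
- apply Rmult_le_compat_l; auto.
- replace (Cmod c * (eps / (Cmod c + 1) * Rabs (u - x)))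
    with (eps * Rabs (u - x) * (Cmod c / (Cmod c + 1))) by (field; lra).
  rewrite <- (Rmult_1_r (eps * Rabs (u - x))) at 2.
  apply Rmult_le_compat_l; [nra|]. apply Rle_div_l; lra.
Qed.

Lemma is_derive_in_lipschitz_at (a b : R) (f : R -> C) (x : R) (l : C) :
  a <= x <= b -> is_derive_in a b f x l ->
  exists d, 0 < d /\ forall u, a <= u <= b -> Rabs (u - x) < d ->
    Cmod (f u - f x) <= (1 + Cmod l) * Rabs (u - x).
Proof.
intros Hx; rewrite !is_derive_in_iff by exact Hx; intros Hf.
destruct (Hf 1) as (d & Hd & H1); [lra|]; exists d; split; [exact Hd|].
intros u Hu Hux; specialize (H1 u Hu Hux).
replace (f u - f x)%C with ((f u - f x - RtoC (u - x) * l) + RtoC (u - x) * l)%C by ring.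
eapply Rle_trans; [apply Cmod_triangle|]; rewrite Cmod_mult, Cmod_R; lra.
Qed.

Lemma is_derive_in_mult (a b : R) (f g : R -> C) (x : R) (l m : C) :
  a <= x <= b -> is_derive_in a b f x l -> is_derive_in a b g x m ->
  is_derive_in a b (fun u => (f u * g u)%C) x (l * g x + f x * m)%C.
Proof.
intros Hx Hf Hg.
destruct (is_derive_in_lipschitz_at _ _ _ _ _ Hx Hf) as (d1 & Hd1 & H1).
destruct (is_derive_in_lipschitz_at _ _ _ _ _ Hx Hg) as (d2 & Hd2 & H2).
pose proof (is_derive_in_plus _ _ _ _ _ _ _ Hx
  (is_derive_in_scal _ _ (g x) _ _ _ Hx Hf) (is_derive_in_scal _ _ (f x) _ _ _ Hx Hg)) as Hs.
rewrite is_derive_in_iff in Hs |- * by exact Hx; intros eps Heps.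
destruct (Hs (eps/2)) as (d3 & Hd3 & H3); [lra|].
set (K := (1 + Cmod l) * (1 + Cmod m)).
assert (HK : 0 < K) by (unfold K; pose proof (Cmod_ge_0 l); pose proof (Cmod_ge_0 m); nra).
assert (Hd4 : 0 < eps / (2 * K)) by (apply Rdiv_lt_0_compat; lra).
exists (Rmin (Rmin d1 d2) (Rmin d3 (eps/(2*K)))); split; [repeat apply Rmin_pos; auto|].
intros u Hu Hux.
pose proof (Rmin_l (Rmin d1 d2) (Rmin d3 (eps/(2*K)))).
pose proof (Rmin_r (Rmin d1 d2) (Rmin d3 (eps/(2*K)))).
pose proof (Rmin_l d1 d2); pose proof (Rmin_r d1 d2).
pose proof (Rmin_l d3 (eps/(2*K))); pose proof (Rmin_r d3 (eps/(2*K))).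
specialize (H1 u Hu ltac:(lra)); specialize (H2 u Hu ltac:(lra)); specialize (H3 u Hu ltac:(lra)).
replace (f u * g u - f x * g x - RtoC (u - x) * (l * g x + f x * m))%C with
 ((g x * f u + f x * g u - (g x * f x + f x * g x) - RtoC (u - x) * (g x * l + f x * m))
  + (f u - f x) * (g u - g x))%C by ring.
eapply Rle_trans; [apply Cmod_triangle|]; rewrite Cmod_mult.
pose proof (Cmod_ge_0 (f u - f x)); pose proof (Cmod_ge_0 (g u - g x)).
pose proof (Rabs_pos (u - x)).
assert (Cmod (f u - f x) * Cmod (g u - g x) <= K * (Rabs (u-x) * Rabs (u-x))).
{ eapply Rle_trans; [apply Rmult_le_compat; [assumption|assumption|exact H1|exact H2]|].
  unfold K; right; ring. }
assert (K * (Rabs (u-x) * Rabs (u-x)) <= eps/2 * Rabs (u-x)).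
{ rewrite <- Rmult_assoc; apply Rmult_le_compat_r; [assumption|].
  replace (eps/2) with (K * (eps/(2*K))) by (field; lra).
  apply Rmult_le_compat_l; lra. }
lra.
Qed.

Lemma is_derive_in_conj (a b : R) (f : R -> C) (x : R) (l : C) :
  a <= x <= b -> is_derive_in a b f x l ->
  is_derive_in a b (fun u => Cconj (f u)) x (Cconj l).
Proof.
intros Hx; rewrite !is_derive_in_iff by exact Hx; intros Hf eps Heps.
destruct (Hf eps Heps) as (d & Hd & H1); exists d; split; [exact Hd|].
intros u Hu Hux.
replace (Cconj (f u) - Cconj (f x) - RtoC (u - x) * Cconj l)%C
  with (Cconj (f u - f x - RtoC (u - x) * l)).
- rewrite Cmod_conj; auto.
- rewrite !Cminus_conj, Cmult_conj; f_equal; f_equal.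
  unfold Cconj, RtoC; simpl; f_equal; ring.
Qed.

Lemma is_derive_in_reflect (a b : R) (f : R -> C) (x : R) (l : C) :
  a <= x <= b -> is_derive_in a b f (a + b - x) l ->
  is_derive_in a b (fun u => f (a + b - u)) x (- l)%C.
Proof.
intros Hx; rewrite !is_derive_in_iff by lra; intros Hf eps Heps.
destruct (Hf eps Heps) as (d & Hd & H1); exists d; split; [exact Hd|].
intros u Hu Hux; specialize (H1 (a + b - u) ltac:(lra)).
replace (a + b - u - (a + b - x)) with (-(u - x)) in H1 by ring.
rewrite Rabs_Ropp in H1; specialize (H1 Hux).
rewrite RtoC_opp in H1.
replace (RtoC (u - x) * - l)%C with (- RtoC (u - x) * l)%C by ring; exact H1.
Qed.

Lemma is_derive_in_real (a b : R) (f : R -> R) (x l : R) :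
  a <= x <= b -> is_derive f x l ->
  is_derive_in a b (fun u => RtoC (f u)) x (RtoC l).
Proof.
intros Hx [_ H]; apply is_derive_in_iff; [exact Hx|]; intros eps Heps.
assert (HF : is_filter_lim (locally x) x) by (intros P HP; exact HP).
destruct (H x HF (mkposreal eps Heps)) as [d Hd].
exists d; split; [apply cond_pos|]; intros u Hu Hux; specialize (Hd u Hux).
rewrite <- RtoC_mult, <- !RtoC_minus, Cmod_R; exact Hd.
Qed.

Lemma Derive_in_eq (a b : R) (f g g' : R -> C) (x : R) :
  a < b -> a <= x <= b -> (forall u, a <= u <= b -> f u = g u) ->
  is_derive_in a b g x (g' x) -> Derive_in a b f x = g' x.
Proof.
intros Hab Hx E H; apply is_derive_in_unique; auto.
apply is_derive_in_ext with g; auto; intros; symmetry; auto.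
Qed.

(** Projecting on the direction of the increment itself reduces the mean value
    inequality to the real mean value theorem without loss of a constant. *)
Lemma mean_value_in (a b : R) (f f' : R -> C) (K : R) :
  (forall x, a <= x <= b -> is_derive_in a b f x (f' x)) ->
  (forall x, a <= x <= b -> Cmod (f' x) <= K) ->
  forall u v, a <= u <= b -> a <= v <= b -> Cmod (f v - f u) <= K * Rabs (v - u).
Proof.
intros Hf HK.
assert (main : forall u v, a <= u -> u < v -> v <= b -> Cmod (f v - f u) <= K * (v - u)).
{ intros u v Hau Huv Hvb.
  set (w := (f v - f u)%C).
  destruct (Req_dec (Cmod w) 0) as [Hw|Hw].
  { rewrite Hw; apply Rmult_le_pos; [|lra].
    apply Rle_trans with (2 := HK u ltac:(lra)), Cmod_ge_0. }
  assert (Hw0 : 0 < Cmod w) by (pose proof (Cmod_ge_0 w); lra).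
  set (p := fun z : C => fst (Cconj w * z)%C).
  assert (pD : forall z z', p (z - z')%C = p z - p z').
  { intros [] []; unfold p; simpl; ring. }
  assert (pZ : forall r z, p (RtoC r * z)%C = r * p z).
  { intros r []; unfold p; simpl; ring. }
  assert (pN : forall z, Rabs (p z) <= Cmod w * Cmod z).
  { intros z; rewrite <- (Cmod_conj w), <- Cmod_mult; apply re_le_Cmod. }
  assert (pw : p w = Cmod w * Cmod w).
  { unfold p; transitivity (Cmod w ^ 2); [|ring].
    rewrite Cmod2_alt; destruct w; simpl; ring. }
  (* [f] is made constant outside [u, v], since the classical theorem asks for
   two-sided continuity at the end points. *)
  set (cl := fun s => Rmax u (Rmin v s)).
  assert (cl_id : forall s, u <= s <= v -> cl s = s).
  { intros s Hs; unfold cl; rewrite Rmin_right, Rmax_right; lra. }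
  assert (cl_in : forall s, u <= cl s <= v).
  { intros s; unfold cl, Rmax, Rmin.
    destruct (Rle_dec v s); destruct (Rle_dec u _); lra. }
  assert (cl_lip : forall s s', Rabs (cl s - cl s') <= Rabs (s - s')).
  { intros s s'; unfold cl, Rmax, Rmin.
    destruct (Rle_dec v s), (Rle_dec v s'); repeat destruct (Rle_dec u _);
    unfold Rabs; repeat destruct Rcase_abs; lra. }
  destruct (MVT_gen (fun s => p (f (cl s))) u v (fun s => p (f' s))) as (c & Hc & E).
  - rewrite Rmin_left, Rmax_right by lra; intros x Hx.
    assert (Hx' : a <= x <= b) by lra.
    pose proof (Hf x Hx') as H; rewrite is_derive_in_iff in H by exact Hx'.
    split; [apply @is_linear_scal_l|].
    intros x' Hlim.
    assert (x' = x) as -> by (symmetry; apply (is_filter_lim_locally_unique (V:=R_NormedModule)); exact Hlim).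
    intros eps.
    destruct (H (eps / Cmod w)) as (d & Hd & Hu); [apply Rdiv_lt_0_compat; [apply cond_pos|lra]|].
    assert (He : 0 < Rmin d (Rmin (x - u) (v - x))) by (repeat apply Rmin_pos; lra).
    exists (mkposreal _ He); intros s Hs.
    change (Rabs (s - x) < Rmin d (Rmin (x - u) (v - x))) in Hs.
    pose proof (Rmin_l d (Rmin (x - u) (v - x))); pose proof (Rmin_r d (Rmin (x - u) (v - x))).
    pose proof (Rmin_l (x - u) (v - x)); pose proof (Rmin_r (x - u) (v - x)).
    assert (Hs' : u <= s <= v) by (revert Hs; unfold Rabs; destruct Rcase_abs; lra).
    change (Rabs (p (f (cl s)) - p (f (cl x)) - (s - x) * p (f' x)) <= eps * Rabs (s - x)).
    rewrite !cl_id, <- pZ, <- !pD by lra.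
    eapply Rle_trans; [apply pN|].
    specialize (Hu s ltac:(lra) ltac:(lra)).
    apply Rle_trans with (Cmod w * (eps / Cmod w * Rabs (s - x))); [apply Rmult_le_compat_l; lra|].
    right; field; lra.
  - intros x _; apply continuity_pt_filterlim.
    apply filterlim_locally; intros eps.
    assert (Hcx : a <= cl x <= b) by (pose proof (cl_in x); lra).
    destruct (is_derive_in_lipschitz_at _ _ _ _ _ Hcx (Hf _ Hcx)) as (d & Hd & Hu).
    set (L := Cmod w * (1 + Cmod (f' (cl x)))).
    assert (HL : 0 < L) by (unfold L; pose proof (Cmod_ge_0 (f' (cl x))); nra).
    assert (He : 0 < Rmin d (eps / L))
      by (apply Rmin_pos; auto; apply Rdiv_lt_0_compat; [apply cond_pos|auto]).
    exists (mkposreal _ He); intros s Hs.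
    change (Rabs (s - x) < Rmin d (eps / L)) in Hs.
    pose proof (Rmin_l d (eps / L)); pose proof (Rmin_r d (eps / L)).
    change (Rabs (p (f (cl s)) - p (f (cl x))) < eps).
    rewrite <- pD; eapply Rle_lt_trans; [apply pN|].
    pose proof (cl_lip s x); pose proof (cl_in s).
    specialize (Hu (cl s) ltac:(lra) ltac:(lra)).
    apply Rle_lt_trans with (L * Rabs (s - x)).
    + unfold L; rewrite Rmult_assoc; apply Rmult_le_compat_l; [lra|].
      eapply Rle_trans; [exact Hu|]; apply Rmult_le_compat_l; auto.
      pose proof (Cmod_ge_0 (f' (cl x))); lra.
    + replace (pos eps) with (L * (eps / L)) by (field; lra).
      apply Rmult_lt_compat_l; lra.
  - rewrite Rmin_left, Rmax_right in Hc by lra.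
    rewrite !cl_id, <- pD in E by lra; fold w in E; rewrite pw in E.
    apply Rmult_le_reg_l with (Cmod w); [lra|]; rewrite E.
    apply Rle_trans with (Cmod w * Cmod (f' c) * (v - u)).
    + apply Rmult_le_compat_r; [lra|].
      eapply Rle_trans; [apply Rle_abs|apply pN].
    + rewrite Rmult_assoc; apply Rmult_le_compat_l; [lra|].
      apply Rmult_le_compat_r; [lra|]; apply HK; lra. }
intros u v Hu Hv; destruct (Rtotal_order u v) as [H|[H|H]].
- rewrite Rabs_pos_eq by lra; apply main; lra.
- subst v; replace (f u - f u)%C with (RtoC 0) by ring.
  rewrite Cmod_0, Rminus_diag, Rabs_R0; lra.
- rewrite Rabs_minus_sym, Rabs_pos_eq by lra.
  replace (f v - f u)%C with (- (f u - f v))%C by ring; rewrite Cmod_opp; apply main; lra.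
Qed.

(** The mean value inequality on the segment from [u] to [v], applied to
    [f(s) - s f'(u)]. *)
Lemma taylor_in (a b : R) (f f' f'' : R -> C) (K : R) :
  (forall x, a <= x <= b -> is_derive_in a b f x (f' x)) ->
  (forall x, a <= x <= b -> is_derive_in a b f' x (f'' x)) ->
  (forall x, a <= x <= b -> Cmod (f'' x) <= K) ->
  forall u v, a <= u <= b -> a <= v <= b ->
    Cmod (f v - f u - RtoC (v - u) * f' u) <= K * Rabs (v - u) ^ 2.
Proof.
intros Hf Hf' HK u v Hu Hv.
pose proof (mean_value_in a b f' f'' K Hf' HK) as HL.
assert (HK0 : 0 <= K) by (apply Rle_trans with (2 := HK u Hu), Cmod_ge_0).
set (lo := Rmin u v); set (hi := Rmax u v).
assert (Hlo : a <= lo) by (unfold lo, Rmin; destruct Rle_dec; lra).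
assert (Hhi : hi <= b) by (unfold hi, Rmax; destruct Rle_dec; lra).
assert (Hlh : forall s, lo <= s <= hi -> Rabs (s - u) <= Rabs (v - u)).
{ intros s; unfold lo, hi, Rmin, Rmax, Rabs.
  destruct Rle_dec; repeat destruct Rcase_abs; lra. }
assert (Hmv := mean_value_in lo hi (fun s => (f s + - f' u * RtoC s)%C)
  (fun s => (f' s + - f' u * 1)%C) (K * Rabs (v - u))).
replace (f v - f u - RtoC (v - u) * f' u)%C with
  (f v + - f' u * RtoC v - (f u + - f' u * RtoC u))%C by (rewrite RtoC_minus; ring).
replace (K * Rabs (v - u) ^ 2) with (K * Rabs (v - u) * Rabs (v - u)) by ring.
apply Hmv.
- intros s Hs; apply is_derive_in_plus; [exact Hs| |].
  + apply is_derive_in_sub with a b; try lra; apply Hf; lra.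
  + apply is_derive_in_scal; [exact Hs|].
    apply is_derive_in_real; [exact Hs|]; apply @is_derive_id.
- intros s Hs. replace (f' s + - f' u * 1)%C with (f' s - f' u)%C by ring.
  eapply Rle_trans; [apply HL; lra|].
  apply Rmult_le_compat_l; auto.
- unfold lo, hi, Rmin, Rmax; destruct Rle_dec; lra.
- unfold lo, hi, Rmin, Rmax; destruct Rle_dec; lra.
Qed.

(** * Finite sums, Taylor coefficients and series in the complex numbers *)

(** [sum_n] with its type folded to [C], so that [ring] applies. *)
Definition Csum (f : nat -> C) (n : nat) : C := sum_n f n.

Arguments Csum : simpl never.

Lemma Csum_O (f : nat -> C) : Csum f 0 = f 0%nat.
Proof. exact (sum_O (G:=C_AbelianMonoid) f). Qed.

Lemma Csum_S (f : nat -> C) (n : nat) : Csum f (S n) = (Csum f n + f (S n))%C.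
Proof. exact (sum_Sn (G:=C_AbelianMonoid) f n). Qed.

Lemma Csum_ext (f g : nat -> C) (n : nat) :
  (forall i, (i <= n)%nat -> f i = g i) -> Csum f n = Csum g n.
Proof. apply sum_n_ext_loc. Qed.

Lemma Csum_S_l (f : nat -> C) (n : nat) :
  Csum f (S n) = (f 0%nat + Csum (fun i => f (S i)) n)%C.
Proof.
induction n as [|n IH]; [rewrite Csum_S, !Csum_O; reflexivity|].
rewrite Csum_S, IH, Csum_S; ring.
Qed.

Lemma Csum_plus (f g : nat -> C) (n : nat) :
  Csum (fun i => (f i + g i)%C) n = (Csum f n + Csum g n)%C.
Proof.
induction n as [|n IH]; [rewrite !Csum_O; reflexivity|].
rewrite !Csum_S, IH; ring.
Qed.

Lemma Csum_scal (c : C) (f : nat -> C) (n : nat) :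
  Csum (fun i => (c * f i)%C) n = (c * Csum f n)%C.
Proof.
induction n as [|n IH]; [rewrite !Csum_O; reflexivity|].
rewrite !Csum_S, IH; ring.
Qed.

Lemma Cmod_sum (f : nat -> C) (g : nat -> R) (n : nat) :
  (forall i, (i <= n)%nat -> Cmod (f i) <= g i) -> Cmod (Csum f n) <= sum_f_R0 g n.
Proof.
induction n as [|n IH]; intros H; [rewrite Csum_O; apply H; lia|].
rewrite Csum_S; eapply Rle_trans; [apply Cmod_triangle|simpl].
apply Rplus_le_compat; [apply IH; intros|]; apply H; lia.
Qed.

Lemma is_derive_in_sum (a b : R) (f : nat -> R -> C) (l : nat -> C) (x : R) (n : nat) :
  a <= x <= b -> (forall i, (i <= n)%nat -> is_derive_in a b (f i) x (l i)) ->
  is_derive_in a b (fun u => Csum (fun i => f i u) n) x (Csum l n).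
Proof.
intros Hx; induction n as [|n IH]; intros H.
- rewrite Csum_O; apply is_derive_in_ext with (f 0%nat); auto.
  intros; rewrite Csum_O; reflexivity.
- rewrite Csum_S.
  apply is_derive_in_ext with (fun u => (Csum (fun i => f i u) n + f (S n) u)%C); auto.
  + intros; rewrite Csum_S; reflexivity.
  + apply is_derive_in_plus; auto.
Qed.

Definition conv (u v : nat -> C) (n : nat) : C :=
  Csum (fun i => (u i * v (n - i)%nat)%C) n.

Lemma conv_ext (u u' v v' : nat -> C) (n : nat) :
  (forall i, (i <= n)%nat -> u i = u' i) -> (forall i, (i <= n)%nat -> v i = v' i) ->
  conv u v n = conv u' v' n.
Proof.
intros Hu Hv; apply Csum_ext; intros i Hi; rewrite Hu, Hv by lia; reflexivity.
Qed.

(** In each term of the Cauchy product, [n + 1] splits as [i + (n + 1 - i)], one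
    summand for each factor being differentiated. *)
Lemma conv_leibniz (u v : nat -> C) (n : nat) :
  Csum (fun i => (RtoC (INR i + 1) * u (S i) * v (n - i)%nat
                   + u i * (RtoC (INR (n - i) + 1) * v (S (n - i))))%C) n
  = (RtoC (INR n + 1) * conv u v (S n))%C.
Proof.
unfold conv; rewrite Csum_plus, <- Csum_scal.
transitivity (Csum (fun i => (RtoC (INR i) * (u i * v (S n - i)%nat))%C) (S n) +
   Csum (fun i => (RtoC (INR (S n - i)) * (u i * v (S n - i)%nat))%C) (S n))%C.
- rewrite (Csum_S_l (fun i => (RtoC (INR i) * _)%C)).
  rewrite (Csum_S (fun i => (RtoC (INR (S n - i)) * _)%C)).
  rewrite Nat.sub_diag; simpl (INR 0).
  rewrite !Cmult_0_l, Cplus_0_l, Cplus_0_r; f_equal; apply Csum_ext; intros i Hi.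
  + rewrite S_INR; replace (S n - S i)%nat with (n - i)%nat by lia; ring.
  + replace (S n - i)%nat with (S (n - i)) by lia; rewrite S_INR; ring.
- rewrite <- Csum_plus; apply Csum_ext; intros i Hi.
  rewrite <- Cmult_plus_distr_r, <- RtoC_plus, <- plus_INR.
  replace (i + (S n - i))%nat with (S n) by lia; rewrite S_INR; reflexivity.
Qed.

(** The Taylor coefficients, rather than the derivatives, of a smooth function:
    with this normalization products are Cauchy products. *)
Definition jet (a b : R) (F : nat -> R -> C) : Prop :=
  forall (n : nat) (t : R), a <= t <= b ->
    is_derive_in a b (F n) t (RtoC (INR n + 1) * F (S n) t)%C.

Lemma jet_plus (a b : R) (F G : nat -> R -> C) :
  jet a b F -> jet a b G -> jet a b (fun n t => (F n t + G n t)%C).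
Proof.
intros HF HG n t Ht; rewrite Cmult_plus_distr_l.
apply is_derive_in_plus; auto.
Qed.

Lemma jet_scal (a b : R) (c : C) (F : nat -> R -> C) :
  jet a b F -> jet a b (fun n t => (c * F n t)%C).
Proof.
intros HF n t Ht; replace (RtoC (INR n + 1) * (c * F (S n) t))%C
  with (c * (RtoC (INR n + 1) * F (S n) t))%C by ring.
apply is_derive_in_scal; auto.
Qed.

Lemma jet_conj (a b : R) (F : nat -> R -> C) :
  jet a b F -> jet a b (fun n t => Cconj (F n t)).
Proof.
intros HF n t Ht.
replace (RtoC (INR n + 1) * Cconj (F (S n) t))%C
  with (Cconj (RtoC (INR n + 1) * F (S n) t)).
- apply is_derive_in_conj; auto.
- rewrite Cmult_conj; f_equal; unfold Cconj, RtoC; simpl; f_equal; ring.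
Qed.

Lemma jet_shift (a b : R) (F : nat -> R -> C) :
  jet a b F -> jet a b (fun n t => (RtoC (INR n + 1) * F (S n) t)%C).
Proof.
intros HF n t Ht; rewrite <- S_INR.
apply is_derive_in_scal; [exact Ht|]; apply HF; exact Ht.
Qed.

Lemma jet_conv (a b : R) (F G : nat -> R -> C) :
  jet a b F -> jet a b G ->
  jet a b (fun n t => conv (fun i => F i t) (fun i => G i t) n).
Proof.
intros HF HG n t Ht; rewrite <- conv_leibniz.
apply is_derive_in_sum; [exact Ht|]; intros i Hi.
apply is_derive_in_mult; auto.
Qed.

Lemma jet_sum (a b : R) (F : nat -> nat -> R -> C) (m : nat) :
  (forall i, (i <= m)%nat -> jet a b (F i)) ->
  jet a b (fun n t => Csum (fun i => F i n t) m).
Proof.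
intros HF n t Ht; rewrite <- Csum_scal.
apply is_derive_in_sum; [exact Ht|]; intros i Hi; apply HF; auto.
Qed.

Lemma jet_reflect (a b : R) (F : nat -> R -> C) :
  jet a b F -> jet a b (fun n t => (RtoC ((-1) ^ n) * F n (a + b - t)%R)%C).
Proof.
intros HF n t Ht.
replace (RtoC (INR n + 1) * (RtoC ((-1) ^ S n) * F (S n) (a + b - t)%R))%C
 with (RtoC ((-1) ^ n) * - (RtoC (INR n + 1) * F (S n) (a + b - t)%R))%C.
- apply is_derive_in_scal; [exact Ht|].
  apply is_derive_in_reflect; [exact Ht|]; apply HF; lra.
- simpl ((-1) ^ S n); rewrite RtoC_mult.
  change (RtoC (-1)) with (RtoC (- (1))); rewrite RtoC_opp; ring.
Qed.

Lemma Derive_n_in_jet (a b : R) (f : R -> C) (F : nat -> R -> C) :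
  a < b -> jet a b F -> (forall t, a <= t <= b -> f t = F 0%nat t) ->
  forall n t, a <= t <= b -> Derive_n_in a b n f t = (RtoC (INR (fact n)) * F n t)%C.
Proof.
intros Hab HF E; induction n as [|n IH]; intros t Ht.
- simpl; rewrite E by exact Ht; ring.
- change (Derive_in a b (Derive_n_in a b n f) t = (RtoC (INR (fact (S n))) * F (S n) t)%C).
  rewrite (Derive_in_eq a b _ (fun t => (RtoC (INR (fact n)) * F n t)%C)
    (fun t => (RtoC (INR (fact n)) * (RtoC (INR n + 1) * F (S n) t))%C) t Hab Ht IH).
  + rewrite fact_S, RtoC_mult; ring.
  + apply is_derive_in_scal; auto.
Qed.

Lemma smooth_in_jet (a b : R) (f : R -> C) (F : nat -> R -> C) :
  a < b -> jet a b F -> (forall t, a <= t <= b -> f t = F 0%nat t) -> smooth_in a b f.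
Proof.
intros Hab HF E n t Ht.
exists (RtoC (INR (fact n)) * (RtoC (INR n + 1) * F (S n) t))%C.
apply is_derive_in_ext with (fun t => (RtoC (INR (fact n)) * F n t)%C); [exact Ht| |].
- intros; symmetry; apply Derive_n_in_jet; assumption.
- apply is_derive_in_scal; auto.
Qed.

(** Componentwise, so that the total function [Series] on the reals applies. *)
Definition CSeries (u : nat -> C) : C :=
  (Series (fun k => fst (u k)), Series (fun k => snd (u k))).

Definition Csummable (u : nat -> C) : Prop := ex_series (fun k => Cmod (u k)).

Lemma ex_series_le_R (a b : nat -> R) :
  (forall n, Rabs (a n) <= b n) -> ex_series b -> ex_series a.
Proof. intros H; apply (ex_series_le (K:=R_AbsRing) (V:=R_CompleteNormedModule) a b H). Qed.

Lemma ex_series_scal_R (c : R) (a : nat -> R) : ex_series a -> ex_series (fun n => c * a n).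
Proof. exact (ex_series_scal (K:=R_AbsRing) (V:=R_NormedModule) c a). Qed.

Lemma Csummable_dom (u : nat -> C) (A : nat -> R) :
  (forall k, Cmod (u k) <= A k) -> ex_series A -> Csummable u.
Proof.
intros H; apply ex_series_le_R; intros k.
rewrite Rabs_pos_eq by apply Cmod_ge_0; apply H.
Qed.

Lemma im_le_Cmod (z : C) : Rabs (snd z) <= Cmod z.
Proof. eapply Rle_trans; [|apply Rmax_Cmod]; apply Rmax_r. Qed.

Lemma Csummable_fst (u : nat -> C) : Csummable u -> ex_series (fun k => Rabs (fst (u k))).
Proof.
apply ex_series_le_R; intros k; rewrite Rabs_Rabsolu; apply re_le_Cmod.
Qed.

Lemma Csummable_snd (u : nat -> C) : Csummable u -> ex_series (fun k => Rabs (snd (u k))).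
Proof.
apply ex_series_le_R; intros k; rewrite Rabs_Rabsolu; apply im_le_Cmod.
Qed.

Lemma CSeries_ext (u v : nat -> C) : (forall k, u k = v k) -> CSeries u = CSeries v.
Proof. intros H; unfold CSeries; f_equal; apply Series_ext; intros; rewrite H; reflexivity. Qed.

Lemma CSeries_plus (u v : nat -> C) : Csummable u -> Csummable v ->
  CSeries (fun k => (u k + v k)%C) = (CSeries u + CSeries v)%C.
Proof.
intros Hu Hv; unfold CSeries, Cplus; simpl; f_equal; apply Series_plus;
apply ex_series_Rabs; auto using Csummable_fst, Csummable_snd.
Qed.

Lemma CSeries_scal (c : C) (u : nat -> C) : Csummable u ->
  CSeries (fun k => (c * u k)%C) = (c * CSeries u)%C.
Proof.
intros Hu; pose proof (ex_series_Rabs _ (Csummable_fst u Hu)).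
pose proof (ex_series_Rabs _ (Csummable_snd u Hu)).
unfold CSeries, Cmult; simpl; f_equal;
 [rewrite Series_minus | rewrite Series_plus]; rewrite ?Series_scal_l; auto;
 apply ex_series_scal_R; auto.
Qed.

Lemma Csummable_scal (c : C) (u : nat -> C) : Csummable u -> Csummable (fun k => (c * u k)%C).
Proof.
intros Hu; apply Csummable_dom with (fun k => Cmod c * Cmod (u k)).
- intros k; rewrite Cmod_mult; apply Rle_refl.
- apply ex_series_scal_R; exact Hu.
Qed.

Lemma Csummable_plus (u v : nat -> C) : Csummable u -> Csummable v ->
  Csummable (fun k => (u k + v k)%C).
Proof.
intros Hu Hv; apply Csummable_dom with (fun k => Cmod (u k) + Cmod (v k)).
- intros k; apply Cmod_triangle.
- exact (ex_series_plus (K:=R_AbsRing) (V:=R_NormedModule) _ _ Hu Hv).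
Qed.

Lemma CSeries_conj (u : nat -> C) : CSeries (fun k => Cconj (u k)) = Cconj (CSeries u).
Proof. unfold CSeries, Cconj; simpl; f_equal; apply Series_opp. Qed.

Lemma Cmod_le_abs (z : C) : Cmod z <= Rabs (fst z) + Rabs (snd z).
Proof.
destruct z as [x y]; simpl.
replace (x, y) with (RtoC x + Ci * RtoC y)%C
  by (unfold RtoC, Ci, Cplus, Cmult; simpl; f_equal; ring).
eapply Rle_trans; [apply Cmod_triangle|].
rewrite Cmod_mult, Cmod_Ci, !Cmod_R; lra.
Qed.

(** The factor [2] pays for estimating the two components separately. *)
Lemma Cmod_CSeries_le (u : nat -> C) (A : nat -> R) :
  (forall k, Cmod (u k) <= A k) -> ex_series A -> Cmod (CSeries u) <= 2 * Series A.
Proof.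
intros H HA; pose proof (Csummable_dom u A H HA) as Hu.
eapply Rle_trans; [apply Cmod_le_abs|]; unfold CSeries; simpl fst; simpl snd.
assert (Rabs (Series (fun k => fst (u k))) <= Series A).
{ eapply Rle_trans; [apply Series_Rabs, Csummable_fst, Hu|]; apply Series_le; [|exact HA].
  intros k; split; [apply Rabs_pos|]; eapply Rle_trans; [apply re_le_Cmod|apply H]. }
assert (Rabs (Series (fun k => snd (u k))) <= Series A).
{ eapply Rle_trans; [apply Series_Rabs, Csummable_snd, Hu|]; apply Series_le; [|exact HA].
  intros k; split; [apply Rabs_pos|]; eapply Rle_trans; [apply im_le_Cmod|apply H]. }
lra.
Qed.

Lemma CSeries_incr (u : nat -> C) : Csummable u ->
  CSeries u = (u 0%nat + CSeries (fun k => u (S k)))%C.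
Proof.
intros Hu; unfold CSeries, Cplus; simpl.
rewrite (Series_incr_1 (fun k => fst (u k))), (Series_incr_1 (fun k => snd (u k)));
  auto using ex_series_Rabs, Csummable_fst, Csummable_snd.
Qed.

Lemma fst_sum (u : nat -> C) (n : nat) : fst (Csum u n) = sum_f_R0 (fun k => fst (u k)) n.
Proof.
induction n as [|n IH]; [rewrite Csum_O; reflexivity|].
rewrite Csum_S, tech5, <- IH; reflexivity.
Qed.

Lemma snd_sum (u : nat -> C) (n : nat) : snd (Csum u n) = sum_f_R0 (fun k => snd (u k)) n.
Proof.
induction n as [|n IH]; [rewrite Csum_O; reflexivity|].
rewrite Csum_S, tech5, <- IH; reflexivity.
Qed.

Lemma Series_cauchy_product (a b : nat -> R) :
  ex_series (fun n => Rabs (a n)) -> ex_series (fun n => Rabs (b n)) ->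
  is_series (fun n => sum_f_R0 (fun k => a k * b (n - k)%nat) n) (Series a * Series b).
Proof.
intros Ha Hb; apply is_series_mult; auto; apply Series_correct, ex_series_Rabs; auto.
Qed.

Lemma Csummable_conv (u v : nat -> C) : Csummable u -> Csummable v -> Csummable (conv u v).
Proof.
intros Hu Hv.
apply Csummable_dom with (fun n => sum_f_R0 (fun k => Cmod (u k) * Cmod (v (n - k)%nat)) n).
- intros n; apply Cmod_sum; intros i _; rewrite Cmod_mult; apply Rle_refl.
- eexists; apply (Series_cauchy_product (fun k => Cmod (u k)) (fun k => Cmod (v k))).
  + eapply ex_series_ext; [|exact Hu]; intros; rewrite Rabs_pos_eq; auto using Cmod_ge_0.
  + eapply ex_series_ext; [|exact Hv]; intros; rewrite Rabs_pos_eq; auto using Cmod_ge_0.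
Qed.

Lemma CSeries_conv (u v : nat -> C) : Csummable u -> Csummable v ->
  CSeries (conv u v) = (CSeries u * CSeries v)%C.
Proof.
intros Hu Hv.
pose proof (Csummable_fst u Hu) as H1; pose proof (Csummable_snd u Hu) as H2.
pose proof (Csummable_fst v Hv) as H3; pose proof (Csummable_snd v Hv) as H4.
apply injective_projections; apply is_series_unique.
- eapply is_series_ext; [|apply (is_series_minus (K:=R_AbsRing) (V:=R_NormedModule));
   [exact (Series_cauchy_product _ _ H1 H3)|exact (Series_cauchy_product _ _ H2 H4)]].
  intros n; unfold conv; rewrite fst_sum.
  change (sum_f_R0 (fun k => fst (u k) * fst (v (n - k)%nat)) n
    - sum_f_R0 (fun k => snd (u k) * snd (v (n - k)%nat)) n =
    sum_f_R0 (fun k => fst (u k * v (n - k)%nat)%C) n).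
  rewrite <- minus_sum; reflexivity.
- eapply is_series_ext; [|apply (is_series_plus (K:=R_AbsRing) (V:=R_NormedModule));
   [exact (Series_cauchy_product _ _ H1 H4)|exact (Series_cauchy_product _ _ H2 H3)]].
  intros n; unfold conv; rewrite snd_sum.
  change (sum_f_R0 (fun k => fst (u k) * snd (v (n - k)%nat)) n
    + sum_f_R0 (fun k => snd (u k) * fst (v (n - k)%nat)) n =
    sum_f_R0 (fun k => snd (u k * v (n - k)%nat)%C) n).
  rewrite <- plus_sum; reflexivity.
Qed.

Lemma is_series_CSeries (u : nat -> C) (z : C) :
  @is_series R_AbsRing C_R_NormedModule u z -> CSeries u = z.
Proof.
intros H; unfold is_series in H.
assert (E : forall n, @sum_n C_R_NormedModule u n = Csum u n) by reflexivity.
rewrite (surjective_pairing z); unfold CSeries; f_equal; apply is_series_unique.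
- apply filterlim_ext with (fun n => fst (@sum_n C_R_NormedModule u n)).
  + intros n; rewrite E, fst_sum, <- sum_n_Reals; reflexivity.
  + eapply filterlim_comp; [exact H|].
    intros P [e He]; exists e; intros w Hw; apply He; exact (proj1 Hw).
- apply filterlim_ext with (fun n => snd (@sum_n C_R_NormedModule u n)).
  + intros n; rewrite E, snd_sum, <- sum_n_Reals; reflexivity.
  + eapply filterlim_comp; [exact H|].
    intros P [e He]; exists e; intros w Hw; apply He; exact (proj2 Hw).
Qed.

(** A bound on the second derivatives controls the Taylor remainders of all
    terms at once, so no uniform convergence argument is needed. *)
Lemma is_derive_in_CSeries (a b : R) (u u' u'' : nat -> R -> C) (A B D : nat -> R) :
  (forall k x, a <= x <= b -> is_derive_in a b (u k) x (u' k x)) ->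
  (forall k x, a <= x <= b -> is_derive_in a b (u' k) x (u'' k x)) ->
  (forall k x, a <= x <= b -> Cmod (u k x) <= A k) ->
  (forall k x, a <= x <= b -> Cmod (u' k x) <= B k) ->
  (forall k x, a <= x <= b -> Cmod (u'' k x) <= D k) ->
  ex_series A -> ex_series B -> ex_series D ->
  forall x, a <= x <= b ->
  is_derive_in a b (fun x => CSeries (fun k => u k x)) x (CSeries (fun k => u' k x)).
Proof.
intros Hu Hu' HA HB HD EA EB ED x Hx.
assert (SA : forall s, a <= s <= b -> Csummable (fun k => u k s))
  by (intros s Hs; apply Csummable_dom with A; auto).
assert (SB : Csummable (fun k => u' k x)) by (apply Csummable_dom with B; auto).
assert (HS : 0 <= Series D).
{ pose proof (Cmod_CSeries_le _ D (fun k => HD k x Hx) ED).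
  pose proof (Cmod_ge_0 (CSeries (fun k => u'' k x))); lra. }
apply is_derive_in_iff; [exact Hx|]; intros eps Heps.
exists (eps / (2 * Series D + 1)); split; [apply Rdiv_lt_0_compat; lra|].
intros s Hs Hsx.
replace (CSeries (fun k => u k s) - CSeries (fun k => u k x)
  - RtoC (s - x) * CSeries (fun k => u' k x))%C
  with (CSeries (fun k => (u k s - u k x - RtoC (s - x) * u' k x)%C)).
- eapply Rle_trans; [apply Cmod_CSeries_le with (A := fun k => Rabs (s - x) ^ 2 * D k)|].
  + intros k; rewrite Rmult_comm; apply (taylor_in a b (u k) (u' k) (u'' k)); auto.
  + apply ex_series_scal_R; exact ED.
  + rewrite Series_scal_l.
    replace (2 * (Rabs (s - x) ^ 2 * Series D))
      with (2 * Series D * Rabs (s - x) * Rabs (s - x)) by ring.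
    pose proof (Rabs_pos (s - x)); apply Rmult_le_compat_r; [assumption|].
    apply Rlt_div_r in Hsx; [|lra]; nra.
- replace (CSeries (fun k => u k s) - CSeries (fun k => u k x)
    - RtoC (s - x) * CSeries (fun k => u' k x))%C with
   (CSeries (fun k => u k s) + (RtoC (-1) * CSeries (fun k => u k x)
    + RtoC (- (s - x)) * CSeries (fun k => u' k x)))%C
   by (rewrite RtoC_opp; ring).
  rewrite <- !CSeries_scal, <- !CSeries_plus by auto using Csummable_scal, Csummable_plus.
  apply CSeries_ext; intros k; rewrite RtoC_opp; ring.
Qed.

(** * The recursion on the Taylor coefficients *)

Definition conv2 (u v : nat -> nat -> C) (k n : nat) : C :=
  Csum (fun i => conv (u i) (v (k - i)%nat) n) k.

(** Taylor coefficients of [|y|^2 y], written as [y y conj(y)]. *)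
Definition cubic (u : nat -> nat -> C) : nat -> nat -> C :=
  conv2 (conv2 u u) (fun i p => Cconj (u i p)).

Lemma conv2_ext (u u' v v' : nat -> nat -> C) (k n : nat) :
  (forall i p, (i <= k)%nat -> (p <= n)%nat -> u i p = u' i p) ->
  (forall i p, (i <= k)%nat -> (p <= n)%nat -> v i p = v' i p) ->
  conv2 u v k n = conv2 u' v' k n.
Proof.
intros Hu Hv; apply Csum_ext; intros i Hi; apply conv_ext; intros p Hp.
- apply Hu; assumption.
- apply Hv; [lia|assumption].
Qed.

Lemma cubic_ext (u u' : nat -> nat -> C) (k n : nat) :
  (forall i p, (i <= k)%nat -> (p <= n)%nat -> u i p = u' i p) ->
  cubic u k n = cubic u' k n.
Proof.
intros H; unfold cubic.
apply (conv2_ext (conv2 u u) (conv2 u' u')); intros i p Hi Hp.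
- apply (conv2_ext u u' u u'); intros; apply H; lia.
- rewrite H by assumption; reflexivity.
Qed.

Lemma jet_conv2 (a b : R) (F G : nat -> nat -> R -> C) (k : nat) :
  (forall i, (i <= k)%nat -> jet a b (F i)) -> (forall i, (i <= k)%nat -> jet a b (G i)) ->
  jet a b (fun n t => conv2 (fun i p => F i p t) (fun i p => G i p t) k n).
Proof.
intros HF HG.
apply (jet_sum a b
  (fun i n t => conv (fun p => F i p t) (fun p => G (k - i)%nat p t) n)).
intros i Hi; apply jet_conv; [apply HF | apply HG]; lia.
Qed.

Lemma jet_cubic (a b : R) (F : nat -> nat -> R -> C) (k : nat) :
  (forall i, (i <= k)%nat -> jet a b (F i)) ->
  jet a b (fun n t => cubic (fun i p => F i p t) k n).
Proof.
intros HF.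
apply (jet_conv2 a b
  (fun i n t => conv2 (fun i p => F i p t) (fun i p => F i p t) i n)
  (fun i n t => Cconj (F i n t))).
- intros i Hi; apply jet_conv2; intros; apply HF; lia.
- intros i Hi; apply jet_conj; apply HF; exact Hi.
Qed.

(** * Majorants of the cubic term *)

Lemma pow_split (a : R) (i n : nat) : (i <= n)%nat -> a ^ n = a ^ i * a ^ (n - i).
Proof. intros Hi; rewrite <- pow_add; f_equal; lia. Qed.

Definition rconv (g h : nat -> R) (n : nat) : R :=
  sum_f_R0 (fun i => g i * h (n - i)%nat) n.

Lemma rconv_pos (g h : nat -> R) (n : nat) :
  (forall i, 0 <= g i) -> (forall i, 0 <= h i) -> 0 <= rconv g h n.
Proof. intros Hg Hh; apply cond_pos_sum; intros i; apply Rmult_le_pos; auto. Qed.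

Lemma rconv_le (g g' h h' : nat -> R) (n : nat) :
  (forall i, 0 <= g i <= g' i) -> (forall i, 0 <= h i <= h' i) -> rconv g h n <= rconv g' h' n.
Proof.
intros Hg Hh; apply sum_Rle; intros i _.
apply Rmult_le_compat; try apply Hg; apply Hh.
Qed.

(** Supermultiplicativity of [weight] separates the two indices: each is left
    with a scalar convolution. *)
Lemma conv2_bound (u v : nat -> nat -> C) (g g' h h' : nat -> R) (k n : nat) :
  (forall i p, (i <= k)%nat -> (p <= n)%nat -> Cmod (u i p) <= g i * h p * weight i p) ->
  (forall i p, (i <= k)%nat -> (p <= n)%nat -> Cmod (v i p) <= g' i * h' p * weight i p) ->
  (forall i, 0 <= g i) -> (forall i, 0 <= g' i) ->
  (forall i, 0 <= h i) -> (forall i, 0 <= h' i) ->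
  Cmod (conv2 u v k n) <= rconv g g' k * rconv h h' n * weight k n.
Proof.
intros Hu Hv Pg Pg' Ph Ph'.
replace (rconv g g' k * rconv h h' n * weight k n)
  with (rconv h h' n * weight k n * rconv g g' k) by ring.
unfold rconv at 2; rewrite scal_sum; apply Cmod_sum; intros i Hi.
replace (g i * g' (k - i)%nat * (rconv h h' n * weight k n))
  with (g i * g' (k - i)%nat * weight k n * rconv h h' n) by ring.
unfold rconv; rewrite scal_sum; apply Cmod_sum; intros p Hp.
rewrite Cmod_mult.
apply Rle_trans with ((g i * h p * weight i p) *
  (g' (k - i)%nat * h' (n - p)%nat * weight (k - i) (n - p))).
- apply Rmult_le_compat; try apply Cmod_ge_0; [apply Hu|apply Hv]; lia.
- pose proof (weight_supermult i p (k - i) (n - p)) as W.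
  replace (i + (k - i))%nat with k in W by lia.
  replace (p + (n - p))%nat with n in W by lia.
  replace (g i * h p * weight i p * (g' (k - i)%nat * h' (n - p)%nat * weight (k - i) (n - p)))
    with ((h p * h' (n - p)%nat * (g i * g' (k - i)%nat)) *
          (weight i p * weight (k - i) (n - p))) by ring.
  replace (h p * h' (n - p)%nat * (g i * g' (k - i)%nat * weight k n))
    with ((h p * h' (n - p)%nat * (g i * g' (k - i)%nat)) * weight k n) by ring.
  apply Rmult_le_compat_l; [|exact W].
  repeat apply Rmult_le_pos; auto.
Qed.

Lemma cubic_bound (u : nat -> nat -> C) (g h : nat -> R) (k n : nat) :
  (forall i p, (i <= k)%nat -> (p <= n)%nat -> Cmod (u i p) <= g i * h p * weight i p) ->
  (forall i, 0 <= g i) -> (forall i, 0 <= h i) ->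
  Cmod (cubic u k n) <= rconv (rconv g g) g k * rconv (rconv h h) h n * weight k n.
Proof.
intros Hu Pg Ph; unfold cubic.
apply (conv2_bound (conv2 u u) _ (rconv g g) g (rconv h h) h); auto using rconv_pos.
- intros i p Hi Hp; apply (conv2_bound u u); auto; intros; apply Hu; lia.
- intros i p Hi Hp; rewrite Cmod_conj; auto.
Qed.

Lemma rconv_geometric (g h : nat -> R) (e d a : R) (n : nat) :
  (forall i, (i <= n)%nat -> 0 <= g i <= (INR n + 1) * e * a ^ i) ->
  (forall i, (i <= n)%nat -> 0 <= h i <= d * a ^ i) ->
  0 <= a -> 0 <= e -> 0 <= d ->
  rconv g h n <= (INR n + 1) ^ 2 * e * d * a ^ n.
Proof.
intros Hg Hh Ha He Hd.
apply Rle_trans with (sum_f_R0 (fun _ => (INR n + 1) * e * d * a ^ n) n).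
- apply sum_Rle; intros i Hi.
  rewrite (pow_split a i n Hi).
  specialize (Hg i Hi); specialize (Hh (n - i)%nat ltac:(lia)).
  replace ((INR n + 1) * e * d * (a ^ i * a ^ (n - i)))
    with (((INR n + 1) * e * a ^ i) * (d * a ^ (n - i))) by ring.
  apply Rmult_le_compat; lra.
- rewrite sum_cte, S_INR; right; ring.
Qed.

(** The factor [1/(n+1)^2] keeps convolutions bounded, see
    [rconv_weighted]. *)
Definition weighted (a : R) (n : nat) : R := a ^ n / (INR n + 1) ^ 2.

Lemma sum_inverse_squares (n : nat) :
  sum_f_R0 (fun i => / (INR i + 1) ^ 2) n <= 2.
Proof.
enough (sum_f_R0 (fun i => / (INR i + 1) ^ 2) n <= 2 - / (INR n + 1)).
{ pose proof (pos_INR n); assert (0 < / (INR n + 1)) by (apply Rinv_0_lt_compat; lra); lra. }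
induction n as [|n IH]; [simpl; lra|].
rewrite tech5, S_INR; pose proof (pos_INR n).
assert (/ (INR n + 1 + 1) ^ 2 <= / (INR n + 1) - / (INR n + 1 + 1)); [|lra].
replace (/ (INR n + 1) - / (INR n + 1 + 1)) with (/ ((INR n + 1) * (INR n + 1 + 1)))
  by (field; lra).
apply Rinv_le_contravar; nra.
Qed.

(** Both factors cannot be small simultaneously: the weights [1/(n+1)^2] are
    stable under convolution. *)
Lemma rconv_inverse_squares (n : nat) :
  rconv (fun i => / (INR i + 1) ^ 2) (fun i => / (INR i + 1) ^ 2) n <= 8 * / (INR n + 1) ^ 2.
Proof.
set (s := fun i => / (INR i + 1) ^ 2).
pose proof (sum_f_R0_skip s n) as Hrev.
apply Rle_trans with (sum_f_R0 (fun i => (s i + s (n - i)%nat) * (2 * s n)) n).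
- apply sum_Rle; intros i Hi; unfold s.
  rewrite minus_INR by exact Hi.
  assert (INR i <= INR n) by (apply le_INR; exact Hi).
  pose proof (pos_INR i).
  set (x := INR i + 1); replace (INR n - INR i + 1) with (INR n + 1 - x + 1) by (unfold x; ring).
  set (y := INR n + 1 - x + 1).
  assert (Hx : 1 <= x) by (unfold x; lra); assert (Hy : 1 <= y) by (unfold y, x; lra).
  replace (INR n + 1) with (x + y - 1) by (unfold y; ring).
  apply Rle_trans with ((/ x ^ 2 + / y ^ 2) * (2 * / (x + y) ^ 2)).
  + replace (/ x ^ 2 * / y ^ 2) with ((x + y) ^ 2 * (/ x ^ 2 * / y ^ 2 * / (x + y) ^ 2))
      by (field; nra).
    replace ((/ x ^ 2 + / y ^ 2) * (2 * / (x + y) ^ 2))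
      with ((2 * x ^ 2 + 2 * y ^ 2) * (/ x ^ 2 * / y ^ 2 * / (x + y) ^ 2)) by (field; nra).
    apply Rmult_le_compat_r; [|pose proof (pow2_ge_0 (x - y)); clearbody x y; nra].
    repeat apply Rmult_le_pos; left; apply Rinv_0_lt_compat; nra.
  + apply Rmult_le_compat_l.
    * assert (0 < / x ^ 2) by (apply Rinv_0_lt_compat; nra).
      assert (0 < / y ^ 2) by (apply Rinv_0_lt_compat; nra); lra.
    * apply Rmult_le_compat_l; [lra|]; apply Rinv_le_contravar; nra.
- rewrite <- scal_sum, plus_sum, Hrev.
  pose proof (sum_inverse_squares n) as H; fold s in H.
  change (/ (INR n + 1) ^ 2) with (s n).
  assert (0 < s n) by (apply Rinv_0_lt_compat; pose proof (pos_INR n); nra); nra.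
Qed.

Lemma weighted_pos (a : R) (n : nat) : 0 <= a -> 0 <= weighted a n.
Proof.
intros Ha; unfold weighted; apply Rmult_le_pos; [apply pow_le; exact Ha|].
left; apply Rinv_0_lt_compat; pose proof (pos_INR n); nra.
Qed.

Lemma rconv_weighted (a : R) (n : nat) :
  0 <= a -> rconv (weighted a) (weighted a) n <= 8 * weighted a n.
Proof.
intros Ha; unfold weighted at 3, Rdiv.
replace (8 * (a ^ n * / (INR n + 1) ^ 2)) with (a ^ n * (8 * / (INR n + 1) ^ 2)) by ring.
eapply Rle_trans; [right|apply Rmult_le_compat_l; [apply pow_le; exact Ha|apply rconv_inverse_squares]].
unfold rconv; rewrite scal_sum; apply sum_eq; intros i Hi; unfold weighted, Rdiv.
rewrite (pow_split a i n Hi); ring.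
Qed.

Lemma rconv_weighted_cubic (a : R) (n : nat) :
  0 <= a -> rconv (rconv (weighted a) (weighted a)) (weighted a) n <= 64 * weighted a n.
Proof.
intros Ha; apply Rle_trans with (rconv (fun i => 8 * weighted a i) (weighted a) n).
- apply rconv_le; intros i; split; auto using rconv_pos, weighted_pos, rconv_weighted; lra.
- apply Rle_trans with (8 * rconv (weighted a) (weighted a) n).
  + unfold rconv; rewrite scal_sum; right; apply sum_eq; intros; ring.
  + pose proof (rconv_weighted a n Ha); lra.
Qed.

Lemma rconv_geometric_cubic (e a : R) (n : nat) : 0 <= a -> 0 <= e ->
  let p := fun i => e * a ^ i in
  rconv (rconv p p) p n <= (INR n + 1) ^ 2 * e ^ 3 * a ^ n.
Proof.
intros Ha He p.
assert (Hp : forall i, 0 <= p i) by (intros; apply Rmult_le_pos; auto using pow_le).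
replace ((INR n + 1) ^ 2 * e ^ 3 * a ^ n) with ((INR n + 1) ^ 2 * e ^ 2 * e * a ^ n) by ring.
apply rconv_geometric; auto.
- intros i Hi; split; [apply rconv_pos; exact Hp|].
  apply Rle_trans with ((INR i + 1) * e ^ 2 * a ^ i).
  + right; unfold rconv; rewrite <- S_INR.
    replace (INR (S i) * e ^ 2 * a ^ i) with (e ^ 2 * a ^ i * INR (S i)) by ring.
    rewrite <- sum_cte; apply sum_eq; intros j Hj; unfold p.
    rewrite (pow_split a j i Hj); ring.
  + apply Rmult_le_compat_r; [apply pow_le; exact Ha|].
    apply Rmult_le_compat_r; [apply pow2_ge_0|].
    apply le_INR in Hi; lra.
- intros i Hi; split; [apply Hp|apply Rle_refl].
- apply pow2_ge_0.
Qed.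

(** The cubic term counts two orders less than the linear ones, hence the
    divisor [(2i+2j+1)(2i+2j+2)]; it pays for the [(i+1)^2] terms of the
    convolution of the geometric sequence [p].  It would not pay for such a count
    in both indices, hence the weights in [j].  The constant [64] is [8^2] from
    [rconv_weighted], used twice. *)
Lemma majorant_step (e a a' : R) (i j : nat) :
  0 < a -> 0 <= e -> a + 64 * e ^ 2 <= a' ->
  let p := fun i => e * a' ^ i in
  p i * weighted a (S j) +
   rconv (rconv p p) p i * rconv (rconv (weighted a) (weighted a)) (weighted a) j
    / ((2 * INR (i + j) + 1) * (2 * INR (i + j) + 2))
  <= p (S i) * weighted a j.
Proof.
intros Ha He Haa p.
assert (Ha' : 0 <= a') by (pose proof (pow2_ge_0 e); lra).
pose proof (rconv_geometric_cubic e a' i Ha' He) as H1; cbv zeta in H1; fold p in H1.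
pose proof (rconv_weighted_cubic a j (Rlt_le _ _ Ha)) as H2.
pose proof (weighted_pos a j (Rlt_le _ _ Ha)) as HW.
pose proof (pow_le a' i Ha') as Hpow.
assert (Hp : forall i, 0 <= p i) by (intros; apply Rmult_le_pos; auto using pow_le).
pose proof (pos_INR i) as Hi; pose proof (pos_INR j) as Hj.
assert (H3 : weighted a (S j) <= a * weighted a j).
{ unfold weighted, Rdiv; rewrite S_INR; simpl (a ^ S j); rewrite Rmult_assoc.
  apply Rmult_le_compat_l; [lra|]; apply Rmult_le_compat_l; [apply pow_le; lra|].
  apply Rinv_le_contravar; nra. }
assert (H4 : rconv (rconv p p) p i * rconv (rconv (weighted a) (weighted a)) (weighted a) j
    / ((2 * INR (i + j) + 1) * (2 * INR (i + j) + 2)) <= e ^ 3 * a' ^ i * 64 * weighted a j).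
{ rewrite plus_INR; apply Rle_div_l; [nra|].
  apply Rle_trans with (((INR i + 1) ^ 2 * e ^ 3 * a' ^ i) * (64 * weighted a j)).
  - apply Rmult_le_compat; [| |exact H1|exact H2]; auto 6 using rconv_pos, weighted_pos, Rlt_le.
  - replace ((INR i + 1) ^ 2 * e ^ 3 * a' ^ i * (64 * weighted a j))
      with ((e ^ 3 * a' ^ i * 64 * weighted a j) * (INR i + 1) ^ 2) by ring.
    apply Rmult_le_compat_l; [|clear -Hi Hj; nra].
    assert (0 <= e ^ 3) by (apply pow_le; exact He).
    apply Rmult_le_pos; [|exact HW]; apply Rmult_le_pos; [|lra]; apply Rmult_le_pos; auto. }
apply Rle_trans with (p i * (a * weighted a j) + e ^ 3 * a' ^ i * 64 * weighted a j).
- apply Rplus_le_compat; [apply Rmult_le_compat_l; auto|exact H4].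
- unfold p; simpl (a' ^ S i).
  replace (e * a' ^ i * (a * weighted a j) + e ^ 3 * a' ^ i * 64 * weighted a j)
    with ((e * a' ^ i * weighted a j) * (a + 64 * e ^ 2)) by ring.
  replace (e * (a' * a' ^ i) * weighted a j) with ((e * a' ^ i * weighted a j) * a') by ring.
  apply Rmult_le_compat_l; [|exact Haa].
  apply Rmult_le_pos; [|exact HW]; apply Rmult_le_pos; auto.
Qed.

(** * Solving the recursion *)

(** Course-of-values recursion; the extensionality hypothesis says that [F k]
    reads its argument up to rank [k] only. *)
Lemma strong_recursion (X : Type) (x0 : X) (F : nat -> (nat -> X) -> X) :
  (forall k u v, (forall i, (i <= k)%nat -> u i = v i) -> F k u = F k v) ->
  exists u : nat -> X, u 0%nat = x0 /\ forall k, u (S k) = F k u.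
Proof.
intros HF.
(* Row [m] of the table holds the first [m + 1] values of the sequence. *)
set (tab := fix tab (m : nat) : nat -> X :=
  match m with
  | O => fun _ => x0
  | S m' => fun i => if Nat.leb i m' then tab m' i else F m' (tab m')
  end).
assert (Htab : forall m i, (i <= m)%nat -> tab m i = tab i i).
{ induction m as [|m IH]; intros i Hi; [replace i with 0%nat by lia; reflexivity|].
  destruct (Nat.eq_dec i (S m)) as [->|Hne]; [reflexivity|].
  simpl; replace (Nat.leb i m) with true by (symmetry; apply Nat.leb_le; lia).
  apply IH; lia. }
exists (fun k => tab k k); split; [reflexivity|]; intros k.
change ((if Nat.leb (S k) k then tab k (S k) else F k (tab k)) = F k (fun k => tab k k)).
replace (Nat.leb (S k) k) with false by (symmetry; apply Nat.leb_gt; lia).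
apply HF; intros i Hi; apply Htab; exact Hi.
Qed.

(** The equation [y_t = lam y_xx + mu |y|^2 y] for
    [y = sum c k n x^(2k) t^n]. *)
Definition array_equation (lam mu : C) (c : nat -> nat -> C) : Prop :=
  forall k n, (RtoC (INR n + 1) * c k (S n) =
    lam * RtoC ((2 * INR k + 1) * (2 * INR k + 2)) * c (S k) n + mu * cubic c k n)%C.

Lemma RtoC_neq_0 (x : R) : x <> 0 -> RtoC x <> 0.
Proof. intros H E; apply H; injection E; auto. Qed.

(** Formal solution of the initial value problem, by increasing [n]. *)
Lemma array_from_column (lam mu : C) (col : nat -> C) :
  exists A : nat -> nat -> C, (forall k, A k 0%nat = col k) /\ array_equation lam mu A.
Proof.
destruct (strong_recursion (nat -> C) col (fun n u k =>
  (/ RtoC (INR n + 1) * (lam * RtoC ((2 * INR k + 1) * (2 * INR k + 2)) * u n (S k)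
     + mu * cubic (fun i p => u p i) k n))%C)) as (u & Hu0 & HuS).
{ intros n u v H; apply functional_extensionality; intros k.
  rewrite (H n) by lia; do 3 f_equal; apply cubic_ext; intros i p Hi Hp.
  rewrite H by exact Hp; reflexivity. }
exists (fun k n => u n k); split; [intros; rewrite Hu0; reflexivity|].
intros k n; rewrite HuS, Cmult_assoc, Cinv_r, Cmult_1_l; [reflexivity|].
apply RtoC_neq_0; pose proof (pos_INR n); lra.
Qed.

(** Solution of the Cauchy problem in the [x] direction, by increasing [k]: the
    coefficients in [x] are smooth functions of [t]. *)
Lemma array_from_row (lam mu : C) (a b : R) (F : nat -> R -> C) :
  lam <> 0 -> jet a b F ->
  exists c : nat -> nat -> R -> C, c 0%nat = F /\
   (forall k, jet a b (c k)) /\ forall t, array_equation lam mu (fun k n => c k n t).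
Proof.
intros Hlam HF.
assert (Hk : forall k, (lam * RtoC ((2 * INR k + 1) * (2 * INR k + 2)))%C <> 0).
{ intros k; apply Cmult_neq_0; [exact Hlam|apply RtoC_neq_0].
  pose proof (pos_INR k); nra. }
destruct (strong_recursion (nat -> R -> C) F (fun k c n t =>
  (/ (lam * RtoC ((2 * INR k + 1) * (2 * INR k + 2))) *
    (RtoC (INR n + 1) * c k (S n) t + (- mu) * cubic (fun i p => c i p t) k n))%C))
  as (c & Hc0 & HcS).
{ intros k u v H; apply functional_extensionality; intros n.
  apply functional_extensionality; intros t.
  rewrite (H k) by lia; do 3 f_equal; apply cubic_ext; intros i p Hi Hp.
  rewrite H by exact Hi; reflexivity. }
exists c; split; [exact Hc0|split].
- intros k; induction k as [k IH] using lt_wf_ind; destruct k as [|k].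
  + rewrite Hc0; exact HF.
  + rewrite HcS; apply jet_scal, jet_plus.
    * apply jet_shift, IH; lia.
    * apply jet_scal, jet_cubic; intros; apply IH; lia.
- intros t k n; rewrite HcS, Cmult_assoc, Cinv_r, Cmult_1_l by apply Hk; ring.
Qed.

Lemma array_unique (lam mu : C) (c c' : nat -> nat -> C) :
  lam <> 0 -> array_equation lam mu c -> array_equation lam mu c' ->
  (forall n, c 0%nat n = c' 0%nat n) -> forall k n, c k n = c' k n.
Proof.
intros Hlam Hc Hc' H0 k; induction k as [k IH] using lt_wf_ind; destruct k as [|k]; [exact H0|].
intros n.
set (m := (lam * RtoC ((2 * INR k + 1) * (2 * INR k + 2)))%C).
assert (Hm : m <> 0).
{ apply Cmult_neq_0; [exact Hlam|apply RtoC_neq_0]; pose proof (pos_INR k); nra. }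
assert (E : (m * c (S k) n = m * c' (S k) n)%C).
{ unfold m; transitivity (RtoC (INR n + 1) * c k (S n) - mu * cubic c k n)%C;
   [rewrite Hc; ring|].
  rewrite (cubic_ext c c') by (intros; apply IH; lia).
  rewrite (IH k) by lia; rewrite Hc'; ring. }
rewrite <- (Cmult_1_l (c (S k) n)), <- (Cmult_1_l (c' (S k) n)), <- (Cinv_l m Hm).
rewrite <- !Cmult_assoc, E; reflexivity.
Qed.

(** The equation, solved for the coefficient of next order in [x], has the
    shape treated by [majorant_step], with [p] carried by [k] and the weights by
    [n]. *)
Lemma array_bound_from_row (lam mu : C) (c : nat -> nat -> C) (e a a' : R) :
  Cmod lam = 1 -> Cmod mu = 1 -> array_equation lam mu c ->
  0 < a -> 0 <= e -> a + 64 * e ^ 2 <= a' ->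
  (forall n, Cmod (c 0%nat n) <= e * weighted a n * weight 0 n) ->
  forall k n, Cmod (c k n) <= e * a' ^ k * weighted a n * weight k n.
Proof.
intros Hlam Hmu Hc Ha He Haa H0 k.
induction k as [k IH] using lt_wf_ind; destruct k as [|k]; intros n;
  [simpl; rewrite Rmult_1_r; apply H0|].
pose proof (majorant_step e a a' k n Ha He Haa) as Hstep; cbv zeta in Hstep.
set (p := fun i => e * a' ^ i) in *.
assert (Hp : forall i, 0 <= p i).
{ intros; apply Rmult_le_pos; [exact He|]; apply pow_le; pose proof (pow2_ge_0 e); lra. }
assert (HT : Cmod (cubic c k n) <= rconv (rconv p p) p k *
  rconv (rconv (weighted a) (weighted a)) (weighted a) n * weight k n).
{ apply cubic_bound; auto using weighted_pos, Rlt_le.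
  intros i q Hi Hq; apply IH; lia. }
assert (E : (RtoC ((2 * INR k + 1) * (2 * INR k + 2)) * (lam * c (S k) n) =
   RtoC (INR n + 1) * c k (S n) - mu * cubic c k n)%C) by (rewrite Hc; ring).
apply (f_equal Cmod) in E; rewrite !Cmod_mult, Hlam, Rmult_1_l, Cmod_R in E.
pose proof (pos_INR k); pose proof (pos_INR n).
rewrite Rabs_pos_eq in E by nra.
set (D := (2 * INR k + 1) * (2 * INR k + 2)) in *.
assert (HD : 0 < D) by (unfold D; nra).
apply Rmult_le_reg_l with D; [exact HD|]; rewrite E.
eapply Rle_trans; [apply Cmod_triangle|].
rewrite Cmod_opp, !Cmod_mult, Hmu, Rmult_1_l, Cmod_R, Rabs_pos_eq by lra.
pose proof (IH k ltac:(lia) (S n)) as IHk; fold (p k) in IHk.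
pose proof (weight_S_l k n) as WL; fold D in WL.
pose proof (weight_S_r k n) as WR.
set (D' := (2 * INR (k + n) + 1) * (2 * INR (k + n) + 2)) in *.
assert (HD' : 0 < D') by (unfold D'; pose proof (pos_INR (k + n)); nra).
pose proof (weight_pos (S k) n) as HW.
apply Rle_trans with (p k * weighted a (S n) * (D * weight (S k) n)
  + rconv (rconv p p) p k * rconv (rconv (weighted a) (weighted a)) (weighted a) n / D'
     * (D * weight (S k) n)).
- apply Rplus_le_compat.
  + rewrite WL; apply (Rmult_le_compat_l (INR n + 1)) in IHk; [|lra].
    eapply Rle_trans; [exact IHk|right; ring].
  + rewrite WL, WR; eapply Rle_trans; [exact HT|right; field; lra].
- rewrite <- Rmult_plus_distr_r.
  replace (D * (e * a' ^ S k * weighted a n * weight (S k) n))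
   with (p (S k) * weighted a n * (D * weight (S k) n)) by (unfold p; ring).
  apply Rmult_le_compat_r; [nra|exact Hstep].
Qed.

(** The same estimate with the two indices exchanged, the equation being solved
    for the coefficient of next order in [t]. *)
Lemma array_bound_from_column (lam mu : C) (c : nat -> nat -> C) (e a a' : R) :
  Cmod lam = 1 -> Cmod mu = 1 -> array_equation lam mu c ->
  0 < a -> 0 <= e -> a + 64 * e ^ 2 <= a' ->
  (forall k, Cmod (c k 0%nat) <= e * weighted a k * weight k 0) ->
  forall n k, Cmod (c k n) <= weighted a k * (e * a' ^ n) * weight k n.
Proof.
intros Hlam Hmu Hc Ha He Haa H0 n.
induction n as [n IH] using lt_wf_ind; destruct n as [|n]; intros k.
{ eapply Rle_trans; [apply H0|]; right; simpl; ring. }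
pose proof (majorant_step e a a' n k Ha He Haa) as Hstep; cbv zeta in Hstep.
set (p := fun i => e * a' ^ i) in *.
assert (Hp : forall i, 0 <= p i).
{ intros; apply Rmult_le_pos; [exact He|]; apply pow_le; pose proof (pow2_ge_0 e); lra. }
assert (HT : Cmod (cubic c k n) <= rconv (rconv (weighted a) (weighted a)) (weighted a) k *
   rconv (rconv p p) p n * weight k n).
{ apply cubic_bound; auto using weighted_pos, Rlt_le.
  intros i q Hi Hq; apply IH; lia. }
pose proof (Hc k n) as E; apply (f_equal Cmod) in E.
rewrite Cmod_mult, Cmod_R in E.
pose proof (pos_INR k); pose proof (pos_INR n).
rewrite Rabs_pos_eq in E by lra.
apply Rmult_le_reg_l with (INR n + 1); [lra|]; rewrite E.
eapply Rle_trans; [apply Cmod_triangle|].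
rewrite !Cmod_mult, Hlam, Hmu, !Rmult_1_l, Cmod_R.
set (D := (2 * INR k + 1) * (2 * INR k + 2)) in *.
assert (HD : 0 < D) by (unfold D; nra).
rewrite (Rabs_pos_eq D) by lra.
pose proof (IH n ltac:(lia) (S k)) as IHn; fold (p n) in IHn.
pose proof (weight_S_l k n) as WL; fold D in WL.
pose proof (weight_S_r k n) as WR; rewrite (Nat.add_comm k n) in WR.
set (D' := (2 * INR (n + k) + 1) * (2 * INR (n + k) + 2)) in *.
assert (HD' : 0 < D') by (unfold D'; pose proof (pos_INR (n + k)); nra).
pose proof (weight_pos k (S n)) as HW.
apply Rle_trans with (p n * weighted a (S k) * ((INR n + 1) * weight k (S n))
  + rconv (rconv p p) p n * rconv (rconv (weighted a) (weighted a)) (weighted a) k / D'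
     * ((INR n + 1) * weight k (S n))).
- apply Rplus_le_compat.
  + rewrite <- WL; apply (Rmult_le_compat_l D) in IHn; [|lra].
    eapply Rle_trans; [exact IHn|right; ring].
  + rewrite WR; eapply Rle_trans; [exact HT|right; field; lra].
- rewrite <- Rmult_plus_distr_r.
  replace ((INR n + 1) * (weighted a k * (e * a' ^ S n) * weight k (S n)))
   with (p (S n) * weighted a k * ((INR n + 1) * weight k (S n))) by (unfold p; ring).
  apply Rmult_le_compat_r; [nra|exact Hstep].
Qed.

(** * Flat functions and Borel summation *)

(** The function [t^(-l) exp(-b/t)], extended by [0]. *)
Definition flat0 (b : R) (l : nat) (t : R) : R :=
  if Rlt_dec 0 t then (/ t) ^ l * exp (- b * / t) else 0.

(** The [n]-th derivative of [flat0 b l]. *)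
Fixpoint flat (b : R) (n l : nat) (t : R) : R :=
  match n with
  | O => flat0 b l t
  | S n' => - INR l * flat b n' (S l) t + b * flat b n' (S (S l)) t
  end.

(** [poisson_tail m x] is the probability that a Poisson variable of mean [x]
    exceeds [m]. *)
Fixpoint poisson_tail (m : nat) (x : R) : R :=
  match m with
  | O => 1 - exp (- x)
  | S m' => poisson_tail m' x - exp (- x) * x ^ m / INR (fact m)
  end.

Lemma is_derive_poisson_tail (m : nat) (x : R) :
  is_derive (poisson_tail m) x (exp (- x) * x ^ m / INR (fact m)).
Proof.
induction m as [|m IH].
- simpl; auto_derive; [exact I|]; field.
- apply is_derive_ext with
    (fun x => poisson_tail m x - exp (- x) * x ^ (S m) / INR (fact (S m))); [reflexivity|].
  replace (exp (- x) * x ^ S m / INR (fact (S m))) with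
   (exp (- x) * x ^ m / INR (fact m) -
    (exp (- x) * x ^ m / INR (fact m) - exp (- x) * x ^ S m / INR (fact (S m)))) by ring.
  apply (is_derive_minus (K:=R_AbsRing) (V:=R_NormedModule)); [exact IH|].
  auto_derive; [exact I|].
  pose proof (fact_pos m); pose proof (pos_INR m).
  change (match m with 0%nat => 1 | S _ => INR m + 1 end) with (INR (S m)).
  change (fact m + m * fact m)%nat with (fact (S m)).
  rewrite fact_S, S_INR; simpl (x ^ S m); field; lra.
Qed.

Lemma nondecreasing_from_0 (f f' : R -> R) :
  (forall x, is_derive f x (f' x)) -> (forall x, 0 <= x -> 0 <= f' x) ->
  forall x, 0 <= x -> f 0 <= f x.
Proof.
intros Hf Hf' x Hx.
destruct (MVT_gen f 0 x f') as (c & Hc & E).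
- intros; apply Hf.
- intros y _; apply derivable_continuous_pt; exists (f' y); apply is_derive_Reals, Hf.
- rewrite Rmin_left, Rmax_right in Hc by exact Hx.
  specialize (Hf' c ltac:(lra)); nra.
Qed.

Lemma poisson_tail_0 (m : nat) : poisson_tail m 0 = 0.
Proof.
induction m as [|m IH]; simpl poisson_tail.
- rewrite Ropp_0, exp_0; ring.
- rewrite IH; simpl (0 ^ S m); unfold Rdiv; ring.
Qed.

Lemma exp_neg_le_1 (x : R) : 0 <= x -> exp (- x) <= 1.
Proof.
intros Hx; rewrite <- exp_0; destruct (Req_dec x 0) as [->|Hx0]; [rewrite Ropp_0; lra|].
left; apply exp_increasing; lra.
Qed.

(** Both bounds compare derivatives, starting from equality at [0]; for [m = 0]
    the upper one is plain. *)
Lemma poisson_tail_bounds (m : nat) (x : R) :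
  0 <= x -> 0 <= poisson_tail m x <= x ^ m / INR (fact m).
Proof.
intros Hx; split.
- rewrite <- (poisson_tail_0 m); revert x Hx.
  apply (nondecreasing_from_0 _ (fun x => exp (- x) * x ^ m / INR (fact m))).
  + intros; apply is_derive_poisson_tail.
  + intros x Hx; pose proof (fact_pos m); pose proof (exp_pos (- x)).
    apply Rdiv_le_0_compat; [|assumption]; apply Rmult_le_pos; [lra|apply pow_le; exact Hx].
- destruct m as [|m].
  { simpl; pose proof (exp_pos (- x)); lra. }
  enough (H : 0 <= x ^ S m / INR (fact (S m)) - poisson_tail (S m) x) by lra.
  replace 0 with (0 ^ S m / INR (fact (S m)) - poisson_tail (S m) 0)
    by (rewrite poisson_tail_0; simpl; unfold Rdiv; ring).
  revert x Hx.
  apply (nondecreasing_from_0 (fun x => x ^ S m / INR (fact (S m)) - poisson_tail (S m) x)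
    (fun x => x ^ m / INR (fact m) - exp (- x) * x ^ (S m) / INR (fact (S m)))).
  + intros x; apply (is_derive_minus (K:=R_AbsRing) (V:=R_NormedModule));
     [|apply is_derive_poisson_tail].
    auto_derive; [exact I|]; pose proof (fact_pos m); pose proof (pos_INR m).
    change (match m with 0%nat => 1 | S _ => INR m + 1 end) with (INR (S m)).
    change (fact m + m * fact m)%nat with (fact (S m)).
    rewrite fact_S, S_INR; field; lra.
  + intros x Hx; pose proof (fact_pos m); pose proof (pos_INR m).
    (* The quotient of the two derivatives is [x exp(-x) / (m+1)]. *)
    assert (x * exp (- x) <= 1).
    { rewrite exp_Ropp; apply (Rmult_le_reg_r (exp x)); [apply exp_pos|].
      pose proof (exp_pos x); rewrite Rmult_assoc, Rinv_l by lra.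
      pose proof (exp_ineq1_le x); lra. }
    replace (x ^ m / INR (fact m) - exp (- x) * x ^ S m / INR (fact (S m)))
      with (x ^ m / INR (fact m) * (1 - x * exp (- x) / (INR m + 1)))
      by (rewrite fact_S; simpl (x ^ S m); field; lra).
    apply Rmult_le_pos; [apply Rdiv_le_0_compat; [apply pow_le; exact Hx|assumption]|].
    assert (x * exp (- x) / (INR m + 1) <= 1) by (apply Rle_div_l; lra); lra.
Qed.

Lemma exp_beats_power (l : nat) (x : R) : 0 <= x -> x ^ l * exp (- x) <= INR (fact l).
Proof.
intros Hx; destruct l as [|l].
- simpl; pose proof (exp_neg_le_1 x Hx); lra.
- pose proof (proj1 (poisson_tail_bounds (S l) x Hx)) as H1.
  assert (H2 : poisson_tail l x <= 1).
  { clear H1; induction l as [|l IH]; [simpl; pose proof (exp_pos (- x)); lra|].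
    eapply Rle_trans; [|exact IH].
    change (poisson_tail (S l) x) with
      (poisson_tail l x - exp (- x) * x ^ S l / INR (fact (S l))).
    assert (0 <= exp (- x) * x ^ S l / INR (fact (S l))); [|lra].
    apply Rdiv_le_0_compat; [|apply fact_pos].
    pose proof (exp_pos (- x)); pose proof (pow_le x (S l) Hx); nra. }
  change (poisson_tail (S l) x) with
    (poisson_tail l x - exp (- x) * x ^ S l / INR (fact (S l))) in H1.
  pose proof (fact_pos (S l)).
  assert (H3 : exp (- x) * x ^ S l / INR (fact (S l)) <= 1) by lra.
  apply Rle_div_l in H3; lra.
Qed.

Lemma flat0_bound (b : R) (l : nat) (t : R) :
  0 < b -> 0 <= flat0 b l t <= INR (fact l) / b ^ l.
Proof.
intros Hb; pose proof (pow_lt b l Hb); pose proof (fact_pos l).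
unfold flat0; destruct Rlt_dec as [Ht|]; [|split; [lra|apply Rdiv_le_0_compat; lra]].
assert (Hit : 0 < / t) by (apply Rinv_0_lt_compat; exact Ht).
split; [apply Rmult_le_pos; [apply pow_le; lra|left; apply exp_pos]|].
apply (proj1 (Rle_div_r _ _ (b ^ l) ltac:(lra))).
replace (- b * / t) with (- (b * / t)) by ring.
replace ((/ t) ^ l * exp (- (b * / t)) * b ^ l) with ((b * / t) ^ l * exp (- (b * / t)))
  by (rewrite Rpow_mult_distr; ring).
apply exp_beats_power; nra.
Qed.

(** Each [flat0 b l] is thus [O(t^2)], which gives its derivative at [0]. *)
Lemma flat0_shift (b : R) (l : nat) (t : R) : flat0 b l t = t ^ 2 * flat0 b (S (S l)) t.
Proof.
unfold flat0; destruct Rlt_dec; [|ring].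
simpl; field; lra.
Qed.

Lemma is_derive_flat0 (b : R) (l : nat) (t : R) : 0 < b ->
  is_derive (flat0 b l) t (- INR l * flat0 b (S l) t + b * flat0 b (S (S l)) t).
Proof.
intros Hb; destruct (Rtotal_order t 0) as [Ht|[->|Ht]].
- replace (_ + _) with 0 by (unfold flat0; destruct Rlt_dec; [lra|ring]).
  apply is_derive_ext_loc with (fun _ => 0); [|apply @is_derive_const].
  exists (mkposreal (- t) ltac:(lra)); intros s Hs.
  change (Rabs (s - t) < - t) in Hs.
  unfold flat0; destruct Rlt_dec; [|reflexivity].
  revert Hs; unfold Rabs; destruct Rcase_abs; lra.
- replace (_ + _) with 0 by (unfold flat0; destruct Rlt_dec; [lra|ring]).
  apply is_derive_Reals; intros eps Heps.
  set (K := INR (fact (S (S l))) / b ^ S (S l) + 1).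
  assert (HK : 0 < K).
  { unfold K; pose proof (flat0_bound b (S (S l)) 0 Hb); lra. }
  exists (mkposreal (eps / K) ltac:(apply Rdiv_lt_0_compat; assumption)).
  intros h Hh Hhd; simpl in Hhd.
  replace (flat0 b l 0) with 0 by (unfold flat0; destruct Rlt_dec; lra).
  rewrite Rplus_0_l, flat0_shift.
  replace ((h ^ 2 * flat0 b (S (S l)) h - 0) / h - 0) with (h * flat0 b (S (S l)) h) by (field; exact Hh).
  pose proof (flat0_bound b (S (S l)) h Hb) as HF.
  rewrite Rabs_mult, (Rabs_pos_eq (flat0 _ _ _)) by lra.
  apply Rlt_div_r in Hhd; [|exact HK].
  apply Rle_lt_trans with (2 := Hhd); apply Rmult_le_compat_l; [apply Rabs_pos|].
  unfold K; lra.
- apply is_derive_ext_loc with (fun s => (/ s) ^ l * exp (- b * / s)).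
  + exists (mkposreal t Ht); intros s Hs; change (Rabs (s - t) < t) in Hs.
    unfold flat0; destruct Rlt_dec as [|Hn]; [reflexivity|].
    exfalso; revert Hs; unfold Rabs; destruct Rcase_abs; lra.
  + unfold flat0; destruct Rlt_dec as [_|]; [|lra].
    destruct l as [|l]; auto_derive; try lra; simpl pow; rewrite ?S_INR; simpl pred.
    * simpl INR; field; lra.
    * change (match l with 0%nat => 1 | S _ => INR l + 1 end) with (INR (S l)).
      rewrite S_INR; set (z := (/ t) ^ l); field; lra.
Qed.

Lemma is_derive_flat (b : R) (n l : nat) (t : R) :
  0 < b -> is_derive (flat b n l) t (flat b (S n) l t).
Proof.
intros Hb; revert l; induction n as [|n IH]; intros l; [apply is_derive_flat0; exact Hb|].
apply (is_derive_plus (K:=R_AbsRing) (V:=R_NormedModule));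
 apply is_derive_scal; apply IH.
Qed.

(** The two terms of a derivative contribute [l (l+1+2n)!] and [(l+2+2n)!],
    together at most [2 (l+2+2n)!]: each derivative costs [2/b] and two orders of
    the factorial. *)
Lemma flat_bound (b : R) (n l : nat) (t : R) : 0 < b ->
  Rabs (flat b n l t) <= (2 / b) ^ n * INR (fact (l + 2 * n)) / b ^ l.
Proof.
intros Hb; revert l; induction n as [|n IH]; intros l.
- pose proof (flat0_bound b l t Hb); simpl flat.
  rewrite Nat.mul_0_r, Nat.add_0_r, Rabs_pos_eq by lra; simpl; lra.
- simpl flat; eapply Rle_trans; [apply Rabs_triang|].
  rewrite !Rabs_mult, Rabs_Ropp, (Rabs_pos_eq (INR l)), (Rabs_pos_eq b) by (auto using pos_INR; lra).
  pose proof (IH (S l)) as H1; pose proof (IH (S (S l))) as H2.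
  replace (S (S l) + 2 * n)%nat with (S (S l + 2 * n)) in H2 by lia.
  replace (l + 2 * S n)%nat with (S (S l + 2 * n)) by lia.
  rewrite fact_S in H2 |- *.
  set (f := INR (fact (S l + 2 * n))) in *.
  assert (Hf : 0 < f) by apply fact_pos.
  assert (Hi : INR l <= INR (S l + 2 * n)) by (apply le_INR; lia).
  pose proof (pos_INR l).
  set (i := INR (S l + 2 * n)) in *.
  pose proof (pow_lt (2 / b) n ltac:(apply Rdiv_lt_0_compat; lra)) as Hk.
  pose proof (pow_lt b l Hb) as Hbl.
  apply Rle_trans with (INR l * ((2 / b) ^ n * f / b ^ S l)
    + b * ((2 / b) ^ n * ((i + 1) * f) / b ^ S (S l))).
  + apply Rplus_le_compat; apply Rmult_le_compat_l; auto; lra.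
  + simpl pow.
    replace (INR l * ((2 / b) ^ n * f / (b * b ^ l)) +
      b * ((2 / b) ^ n * ((i + 1) * f) / (b * (b * b ^ l))))
     with ((INR l + (i + 1)) * ((2 / b) ^ n * f / b ^ l / b)) by (field; lra).
    replace (2 / b * (2 / b) ^ n * ((i + 1) * f) / b ^ l)
     with ((2 * (i + 1)) * ((2 / b) ^ n * f / b ^ l / b)) by (field; lra).
    apply Rmult_le_compat_r; [|lra].
    apply Rdiv_le_0_compat; [|exact Hb]; apply Rdiv_le_0_compat; [|exact Hbl]; nra.
Qed.

Lemma flat_at_0 (b : R) (n l : nat) : flat b n l 0 = 0.
Proof.
revert l; induction n as [|n IH]; intros l; simpl.
- unfold flat0; destruct Rlt_dec; lra.
- rewrite !IH; ring.
Qed.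

(** For [t > 0], [incomplete_gamma b m t] is the truncated Laplace integral of
    [s^m exp(-s/t)/t] over [0 <= s <= b], divided by [m!]: it has the Taylor
    expansion of [t^m] at the origin. *)
Fixpoint incomplete_gamma (b : R) (m : nat) (t : R) : R :=
  match m with
  | O => 1 - flat0 b 0 t
  | S m' => t * incomplete_gamma b m' t - b ^ m / INR (fact m) * flat0 b 0 t
  end.

Lemma incomplete_gamma_poisson (b : R) (m : nat) (t : R) :
  0 < t -> incomplete_gamma b m t = t ^ m * poisson_tail m (b / t).
Proof.
intros Ht; unfold Rdiv; induction m as [|m IH].
- simpl; unfold flat0; destruct Rlt_dec; [|lra].
  replace (- b * / t) with (- (b * / t)) by ring; simpl; ring.
- change (t * incomplete_gamma b m t - b ^ S m / INR (fact (S m)) * flat0 b 0 t =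
    t ^ S m * (poisson_tail m (b * / t)
               - exp (- (b * / t)) * (b * / t) ^ S m / INR (fact (S m)))).
  rewrite IH; unfold flat0; destruct Rlt_dec; [|lra].
  replace (- b * / t) with (- (b * / t)) by ring.
  rewrite Rpow_mult_distr, (pow_inv t (S m)), <- Rmult_assoc.
  change (t * t ^ m) with (t ^ S m); change ((/ t) ^ 0) with 1.
  pose proof (pow_lt t (S m) Ht); pose proof (fact_pos (S m)).
  set (x := t ^ S m) in *; set (f := INR (fact (S m))) in *; set (y := b ^ S m).
  set (E := exp (- (b * / t))).
  field; lra.
Qed.

Lemma incomplete_gamma_bound (b : R) (m : nat) (t : R) : 0 < b -> 0 <= t ->
  Rabs (incomplete_gamma b m t) <= b ^ m / INR (fact m).
Proof.
intros Hb Ht; pose proof (fact_pos m); pose proof (pow_lt b m Hb).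
destruct (Req_dec t 0) as [->|Ht0].
- assert (E : flat0 b 0 0 = 0) by apply (flat_at_0 b 0 0).
  destruct m as [|m]; simpl incomplete_gamma; rewrite E.
  + rewrite Rminus_0_r, Rabs_R1; simpl; lra.
  + rewrite Rmult_0_l, Rmult_0_r, Rminus_0_r, Rabs_R0; apply Rdiv_le_0_compat; lra.
- assert (Ht' : 0 < t) by lra.
  assert (Hx : 0 <= b / t) by (apply Rdiv_le_0_compat; lra).
  rewrite incomplete_gamma_poisson by exact Ht'.
  pose proof (poisson_tail_bounds m (b / t) Hx) as [H1 H2].
  pose proof (pow_lt t m Ht').
  rewrite Rabs_pos_eq by (apply Rmult_le_pos; lra).
  apply Rle_trans with (t ^ m * ((b / t) ^ m / INR (fact m))); [apply Rmult_le_compat_l; lra|].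
  right; unfold Rdiv; rewrite Rpow_mult_distr, pow_inv; field; lra.
Qed.

(** Differentiation shifts the index, as for [t^m], up to a flat boundary term
    from the truncation point [s = b]. *)
Lemma is_derive_incomplete_gamma (b : R) (m : nat) (t : R) : 0 < b ->
  is_derive (incomplete_gamma b m) t
   (match m with O => 0 | S m' => INR m * incomplete_gamma b m' t end
    - b ^ m / INR (fact m) * (INR m * flat0 b 1 t + b * flat0 b 2 t)).
Proof.
intros Hb; induction m as [|m IH].
- replace (0 - _) with (0 - (- INR 0 * flat0 b 1 t + b * flat0 b 2 t)) by (simpl; field).
  apply (is_derive_minus (K:=R_AbsRing) (V:=R_NormedModule));
   [apply @is_derive_const | apply is_derive_flat0; exact Hb].
- pose proof (is_derive_flat0 b 0 t Hb) as HF.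
  apply is_derive_ext with
   (fun t => t * incomplete_gamma b m t - b ^ S m / INR (fact (S m)) * flat0 b 0 t); [reflexivity|].
  set (g' := match m with O => 0 | S m' => INR m * incomplete_gamma b m' t end
    - b ^ m / INR (fact m) * (INR m * flat0 b 1 t + b * flat0 b 2 t)) in *.
  replace (INR (S m) * incomplete_gamma b m t
     - b ^ S m / INR (fact (S m)) * (INR (S m) * flat0 b 1 t + b * flat0 b 2 t)) with
   ((1 * incomplete_gamma b m t + t * g') -
     b ^ S m / INR (fact (S m)) * (- INR 0 * flat0 b 1 t + b * flat0 b 2 t)).
  + apply (is_derive_minus (K:=R_AbsRing) (V:=R_NormedModule)).
    * apply (is_derive_mult (fun t => t) (incomplete_gamma b m)); [apply @is_derive_id|exact IH|].
      intros; apply Rmult_comm.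
    * apply is_derive_scal; exact HF.
  + assert (F01 : flat0 b 0 t = t * flat0 b 1 t)
     by (unfold flat0; destruct Rlt_dec; [simpl; field; lra|ring]).
    assert (F12 : flat0 b 1 t = t * flat0 b 2 t)
     by (unfold flat0; destruct Rlt_dec; [simpl; field; lra|ring]).
    pose proof (fact_pos m); pose proof (pos_INR m).
    unfold g'; destruct m as [|m].
    * simpl incomplete_gamma; simpl fact; simpl INR; simpl pow; rewrite F01, F12; field.
    * change (incomplete_gamma b (S m) t) with
       (t * incomplete_gamma b m t - b ^ S m / INR (fact (S m)) * flat0 b 0 t).
      rewrite F01, F12, (fact_S (S m)), !(S_INR (S m)).
      change (b ^ S (S m)) with (b * b ^ S m); change (INR 0) with 0.
      set (B := b ^ S m).
      field; lra.
Qed.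

(** The [n]-th derivative of [incomplete_gamma b k / k!]. *)
Fixpoint borel (b : R) (n k : nat) (t : R) : R :=
  match n with
  | O => incomplete_gamma b k t / INR (fact k)
  | S n' =>
      match k with O => 0 | S k' => borel b n' k' t end
      - b ^ k / INR (fact k) ^ 2 * (INR k * flat b n' 1 t + b * flat b n' 2 t)
  end.

Lemma is_derive_borel (b : R) (n k : nat) (t : R) : 0 < b ->
  is_derive (borel b n k) t (borel b (S n) k t).
Proof.
intros Hb; revert k; induction n as [|n IH]; intros k.
- apply is_derive_ext with (fun t => / INR (fact k) * incomplete_gamma b k t);
   [intros; simpl; unfold Rdiv; ring|].
  replace (borel b 1 k t) with (/ INR (fact k) *
   (match k with O => 0 | S m' => INR k * incomplete_gamma b m' t end
    - b ^ k / INR (fact k) * (INR k * flat0 b 1 t + b * flat0 b 2 t))).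
  + apply is_derive_scal.
    apply is_derive_incomplete_gamma; exact Hb.
  + pose proof (fact_pos k).
    change (borel b 1 k t) with (match k with O => 0 | S k' => borel b 0 k' t end
      - b ^ k / INR (fact k) ^ 2 * (INR k * flat0 b 1 t + b * flat0 b 2 t)).
    destruct k as [|k]; [field; lra|].
    simpl (borel b 0 k t); rewrite fact_S, S_INR in *.
    pose proof (fact_pos k); pose proof (pos_INR k); field; lra.
- apply (is_derive_minus (K:=R_AbsRing) (V:=R_NormedModule)).
  + destruct k as [|k]; [apply @is_derive_const|apply IH].
  + apply is_derive_scal.
    apply (is_derive_plus (K:=R_AbsRing) (V:=R_NormedModule));
     apply is_derive_scal; apply is_derive_flat; exact Hb.
Qed.

Lemma borel_at_0 (b : R) (n k : nat) : borel b n k 0 = if Nat.eq_dec k n then 1 else 0.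
Proof.
revert k; induction n as [|n IH]; intros k; simpl borel.
- assert (E : flat0 b 0 0 = 0) by apply (flat_at_0 b 0 0).
  destruct k as [|k]; simpl incomplete_gamma; rewrite E; simpl fact; simpl INR;
   [destruct Nat.eq_dec; [field|lia]|].
  destruct Nat.eq_dec; [lia|]; rewrite Rmult_0_l, Rmult_0_r; unfold Rdiv; ring.
- rewrite !flat_at_0; destruct k as [|k]; [destruct Nat.eq_dec; [lia|ring]|].
  rewrite IH; repeat destruct Nat.eq_dec; try lia; ring.
Qed.

(** Size of the boundary term created by the [n]-th differentiation, and the
    sum of those that [n] differentiations accumulate. *)
Definition boundary_bound (b : R) (n k : nat) : R :=
  b ^ k / INR (fact k) ^ 2 * (INR k + 1) * ((2 / b) ^ n * INR (fact (2 * n))).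

Fixpoint borel_bound (b : R) (n k : nat) : R :=
  boundary_bound b n k +
  match n, k with S n', S k' => borel_bound b n' k' | _, _ => 0 end.

Lemma borel_le_bound (b : R) (n k : nat) (t : R) : 0 < b -> 0 <= t ->
  Rabs (borel b n k t) <= borel_bound b n k.
Proof.
intros Hb Ht; revert k; induction n as [|n IH]; intros k.
- simpl borel; simpl borel_bound; rewrite Rplus_0_r; unfold boundary_bound.
  pose proof (fact_pos k); pose proof (pos_INR k); pose proof (pow_lt b k Hb).
  pose proof (incomplete_gamma_bound b k t Hb Ht) as H2.
  unfold Rdiv at 1; rewrite Rabs_mult, Rabs_inv, (Rabs_pos_eq (INR (fact k))) by lra.
  apply Rle_trans with (b ^ k / INR (fact k) * / INR (fact k)).
  + apply Rmult_le_compat_r; [left; apply Rinv_0_lt_compat; lra|exact H2].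
  + simpl fact; simpl INR; simpl ((2 / b) ^ 0).
    replace (b ^ k / INR (fact k) * / INR (fact k)) with (b ^ k / INR (fact k) ^ 2 * 1) by (field; lra).
    rewrite !Rmult_1_r; rewrite <- (Rmult_1_r (b ^ k / INR (fact k) ^ 2)) at 1.
    apply Rmult_le_compat_l; [|lra]; apply Rdiv_le_0_compat; [lra|nra].
- change (Rabs (match k with O => 0 | S k' => borel b n k' t end
      - b ^ k / INR (fact k) ^ 2 * (INR k * flat b n 1 t + b * flat b n 2 t)) <=
    boundary_bound b (S n) k + match k with O => 0 | S k' => borel_bound b n k' end).
  unfold Rminus; eapply Rle_trans; [apply Rabs_triang|].
  rewrite Rabs_Ropp, Rplus_comm; apply Rplus_le_compat.
  + pose proof (fact_pos k); pose proof (pos_INR k); pose proof (pow_lt b k Hb).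
    assert (Hc : 0 < b ^ k / INR (fact k) ^ 2)
      by (apply Rdiv_lt_0_compat; [|apply pow_lt]; assumption).
    rewrite Rabs_mult, (Rabs_pos_eq (b ^ k / _)) by lra.
    unfold boundary_bound; rewrite Rmult_assoc; apply Rmult_le_compat_l; [lra|].
    eapply Rle_trans; [apply Rabs_triang|].
    rewrite !Rabs_mult, (Rabs_pos_eq (INR k)), (Rabs_pos_eq b) by lra.
    pose proof (flat_bound b n 1 t Hb) as H2; pose proof (flat_bound b n 2 t Hb) as H3.
    replace (2 * S n)%nat with (2 + 2 * n)%nat by lia.
    pose proof (fact_le_mono (1 + 2 * n) (2 + 2 * n) ltac:(lia)) as H4.
    set (F := INR (fact (2 + 2 * n))) in *.
    set (F1 := INR (fact (1 + 2 * n))) in *.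
    assert (HF1 : 0 < F1) by apply fact_pos.
    pose proof (pow_lt (2 / b) n ltac:(apply Rdiv_lt_0_compat; lra)) as HP.
    set (P := (2 / b) ^ n) in *.
    change ((2 / b) ^ S n) with (2 / b * P).
    assert (H5 : INR k * Rabs (flat b n 1 t) <= INR k * (P * F / b)).
    { apply Rmult_le_compat_l; [lra|]; eapply Rle_trans; [exact H2|].
      simpl pow; rewrite Rmult_1_r; apply Rmult_le_compat_r;
        [left; apply Rinv_0_lt_compat; exact Hb|]; apply Rmult_le_compat_l; lra. }
    assert (H6 : b * Rabs (flat b n 2 t) <= P * F / b).
    { replace (P * F / b) with (b * (P * F / b ^ 2)) by (field; lra).
      apply Rmult_le_compat_l; lra. }
    replace ((INR k + 1) * (2 / b * P * F)) with (2 * ((INR k + 1) * (P * F / b))) by (field; lra).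
    assert (0 <= P * F / b) by (apply Rdiv_le_0_compat; [nra|exact Hb]).
    nra.
  + destruct k as [|k]; [rewrite Rabs_R0; lra|apply IH].
Qed.

(** Two binomial coefficients are estimated by geometric growth: that of [2k]
    among [2k+2j] with ratio [2], which gives [9^(k+j) / 4^k], and the central
    one [(2k)!/(k!)^2 <= 4^k]. *)
Lemma fact_double_le (j k : nat) :
  INR (fact (2 * k + 2 * j)) <= 9 ^ (k + j) * (INR (fact (2 * j)) * INR (fact k) ^ 2).
Proof.
rewrite Nat.add_comm, fact_plus.
assert (E : INR (fact (2 * k)) = binomial k k * (INR (fact k) * INR (fact k)))
  by (replace (2 * k)%nat with (k + k)%nat by lia; apply fact_plus).
rewrite E.
pose proof (binomial_growth 2 (2 * j) (2 * k) ltac:(lra)) as H1.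
pose proof (binomial_growth 1 k k ltac:(lra)) as H2.
rewrite pow1, Rmult_1_r in H2.
replace (1 + 2) with 3 in H1 by ring; replace (1 + 1) with 2 in H2 by ring.
replace (k + k)%nat with (2 * k)%nat in H2 by lia.
replace (2 * j + 2 * k)%nat with (2 * (k + j))%nat in H1 by lia.
rewrite (pow_mult 3) in H1; replace (3 ^ 2) with 9 in H1 by ring.
pose proof (binomial_pos (2 * j) (2 * k)); pose proof (binomial_pos k k).
pose proof (fact_pos (2 * j)); pose proof (fact_pos k).
replace (binomial (2 * j) (2 * k) *
 (INR (fact (2 * j)) * (binomial k k * (INR (fact k) * INR (fact k)))))
 with ((binomial (2 * j) (2 * k) * binomial k k) * (INR (fact (2 * j)) * INR (fact k) ^ 2)) by ring.
apply Rmult_le_compat_r; [apply Rmult_le_pos; [lra|apply pow_le; lra]|].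
eapply Rle_trans; [|exact H1]; apply Rmult_le_compat_l; lra.
Qed.

(** Against data of size [rho^k (2k)!] the boundary term created after [j]
    index shifts is geometric in [k + j] with ratio [9 rho b]; the [j] derivatives
    spent on shifting cost [9 rho] each, less than [2/b] times that ratio. *)
Lemma boundary_bound_shift (b rho : R) (n k j : nat) : 0 < b -> 0 < rho ->
  rho ^ (k + j) * INR (fact (2 * (k + j))) * boundary_bound b n k
  <= (INR k + 1) * (9 * rho * b) ^ (k + j) * ((2 / b) ^ (n + j) * INR (fact (2 * (n + j)))).
Proof.
intros Hb Hr; unfold boundary_bound.
pose proof (fact_pos k) as Hfk; pose proof (pos_INR k); pose proof (pow_lt b k Hb).
pose proof (pow_lt rho (k + j) Hr).
assert (Hk : 0 < 2 / b) by (apply Rdiv_lt_0_compat; lra).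
pose proof (pow_lt (2 / b) n Hk).
pose proof (fact_double_le j k) as HD.
replace (2 * (k + j))%nat with (2 * k + 2 * j)%nat by lia.
pose proof (fact_mult_le (2 * j) (2 * n)) as HM.
replace (2 * j + 2 * n)%nat with (2 * (n + j))%nat in HM by lia.
set (c := rho ^ (k + j) * (b ^ k * (INR k + 1) * (2 / b) ^ n)).
assert (Hc : 0 <= c) by (unfold c; repeat apply Rmult_le_pos; lra).
pose proof (pow_lt 9 (k + j) ltac:(lra)) as H9.
apply Rle_trans with (c * 9 ^ (k + j) * INR (fact (2 * (n + j)))).
- apply Rle_trans with (c * 9 ^ (k + j) * (INR (fact (2 * j)) * INR (fact (2 * n)))).
  + replace (rho ^ (k + j) * INR (fact (2 * k + 2 * j)) *
     (b ^ k / INR (fact k) ^ 2 * (INR k + 1) * ((2 / b) ^ n * INR (fact (2 * n)))))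
    with (c * INR (fact (2 * n)) / INR (fact k) ^ 2 * INR (fact (2 * k + 2 * j)))
     by (unfold c; field; lra).
    replace (c * 9 ^ (k + j) * (INR (fact (2 * j)) * INR (fact (2 * n))))
     with (c * INR (fact (2 * n)) / INR (fact k) ^ 2 *
       (9 ^ (k + j) * (INR (fact (2 * j)) * INR (fact k) ^ 2))) by (field; lra).
    apply Rmult_le_compat_l; [|exact HD].
    pose proof (fact_pos (2 * n)); apply Rdiv_le_0_compat; nra.
  + apply Rmult_le_compat_l; [nra|exact HM].
- replace ((INR k + 1) * (9 * rho * b) ^ (k + j) * ((2 / b) ^ (n + j) * INR (fact (2 * (n + j)))))
   with (c * 9 ^ (k + j) * INR (fact (2 * (n + j))) * 2 ^ j).
  + pose proof (pow_R1_Rle 2 j ltac:(lra)); pose proof (fact_pos (2 * (n + j))).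
    rewrite <- (Rmult_1_r (c * 9 ^ (k + j) * _)) at 1.
    apply Rmult_le_compat_l; [|assumption]; apply Rmult_le_pos; nra.
  + unfold c; rewrite !Rpow_mult_distr, (pow_add (2 / b)), (pow_add b).
    unfold Rdiv; rewrite !Rpow_mult_distr, !pow_inv.
    pose proof (pow_lt b j Hb); pose proof (pow_lt b n Hb); field; lra.
Qed.

(** The sum over the shifts [j] has at most [k + 1] terms, since a boundary term
    disappears once its index is exhausted. *)
Lemma borel_bound_summable (b rho : R) (n k : nat) : 0 < b -> 0 < rho ->
  rho ^ k * INR (fact (2 * k)) * borel_bound b n k
  <= (INR k + 1) ^ 2 * (9 * rho * b) ^ k * ((2 / b) ^ n * INR (fact (2 * n))).
Proof.
intros Hb Hr.
assert (Hk : 0 < 2 / b) by (apply Rdiv_lt_0_compat; lra).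
assert (Hq : 0 < 9 * rho * b) by nra.
enough (H : forall j, rho ^ (k + j) * INR (fact (2 * (k + j))) * borel_bound b n k <=
  (INR k + 1) ^ 2 * (9 * rho * b) ^ (k + j) * ((2 / b) ^ (n + j) * INR (fact (2 * (n + j))))).
{ specialize (H 0%nat); rewrite !Nat.add_0_r in H; exact H. }
set (Z := fun n k => (9 * rho * b) ^ k * ((2 / b) ^ n * INR (fact (2 * n)))).
assert (HZ : forall n k, 0 < Z n k).
{ intros; unfold Z; apply Rmult_lt_0_compat; [|apply Rmult_lt_0_compat];
   try (apply pow_lt; assumption); apply fact_pos. }
assert (Hs : forall n k j, rho ^ (k + j) * INR (fact (2 * (k + j))) * boundary_bound b n k
   <= (INR k + 1) * Z (n + j)%nat (k + j)%nat).
{ intros; eapply Rle_trans; [apply boundary_bound_shift; assumption|right; unfold Z; ring]. }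
enough (H : forall k j, rho ^ (k + j) * INR (fact (2 * (k + j))) * borel_bound b n k <=
  (INR k + 1) ^ 2 * Z (n + j)%nat (k + j)%nat).
{ intros j; eapply Rle_trans; [apply H|right; unfold Z; ring]. }
clear k; induction n as [|n IH]; intros k j; pose proof (pos_INR k).
- simpl borel_bound; rewrite Rplus_0_r.
  eapply Rle_trans; [apply Hs|]; apply Rmult_le_compat_r; [left; apply HZ|nra].
- specialize (Hs (S n) k j); specialize (HZ (S n + j)%nat (k + j)%nat).
  destruct k as [|k].
  + simpl borel_bound; rewrite Rplus_0_r; eapply Rle_trans; [exact Hs|].
    apply Rmult_le_compat_r; [lra|nra].
  + change (borel_bound b (S n) (S k)) with (boundary_bound b (S n) (S k) + borel_bound b n k).
    specialize (IH k (S j)).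
    replace (k + S j)%nat with (S k + j)%nat in IH by lia.
    replace (n + S j)%nat with (S n + j)%nat in IH by lia.
    rewrite S_INR in *; rewrite Rmult_plus_distr_l.
    pose proof (pos_INR k); nra.
Qed.

Lemma ex_series_quadratic_geometric (q : R) :
  0 < q < 1 -> ex_series (fun k => (INR k + 1) ^ 2 * q ^ k).
Proof.
intros Hq; set (x := (1 - q) / 4).
assert (Hx : 0 < x <= 1) by (unfold x; lra).
set (p := (1 + x) ^ 2 * q).
assert (Hp : 0 <= p < 1) by (unfold p, x; nra).
apply ex_series_le_R with (fun k => (/ x) ^ 2 * p ^ k).
- intros k; pose proof (pow_lt q k (proj1 Hq)); pose proof (pos_INR k).
  rewrite Rabs_pos_eq by nra.
  unfold p; rewrite Rpow_mult_distr, <- pow_mult, Nat.mul_comm, pow_mult, <- Rmult_assoc, <- Rpow_mult_distr.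
  apply Rmult_le_compat_r; [lra|]; apply pow_incr; split; [lra|].
  apply linear_le_geometric; exact Hx.
- apply ex_series_scal_R, ex_series_geom; rewrite Rabs_pos_eq; lra.
Qed.

Lemma CSeries_0 (u : nat -> C) : (forall k, u k = RtoC 0) -> CSeries u = RtoC 0.
Proof.
intros H; rewrite (CSeries_ext _ (fun k => (0 * 0)%C)) by (intros; rewrite H; ring).
rewrite CSeries_scal; [ring|].
apply Csummable_dom with (fun k => 0 * (1 / 2) ^ k); [intros; rewrite Cmod_0; lra|].
apply ex_series_scal_R, ex_series_geom; rewrite Rabs_pos_eq; lra.
Qed.

Lemma Csummable_incr (u : nat -> C) : Csummable u -> Csummable (fun k => u (S k)).
Proof. apply (ex_series_incr_1 (K:=R_AbsRing) (V:=R_NormedModule)). Qed.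

Lemma CSeries_single (u : nat -> C) (n : nat) :
  Csummable u -> (forall k, k <> n -> u k = RtoC 0) -> CSeries u = u n.
Proof.
revert u; induction n as [|n IH]; intros u Hu H; rewrite CSeries_incr by exact Hu.
- rewrite CSeries_0; [ring|]; intros; apply H; lia.
- rewrite (H 0%nat) by lia; rewrite (IH (fun k => u (S k))); [ring| |].
  + apply Csummable_incr; exact Hu.
  + intros; apply H; lia.
Qed.

(** The function is [sum_k d_k incomplete_gamma b k].  Its terms are
    small because [incomplete_gamma b k] stays below [b^k / k!] for all [t >= 0],
    unlike [t^k], while having the same Taylor expansion at [0]. *)
Lemma borel_ritt (b rho T : R) : 0 < T -> 0 < b -> 0 < rho -> 9 * rho * b < 1 ->
  exists K, 0 < K /\ forall (d : nat -> C) (e : R),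
   (forall n, Cmod (d n) <= e * rho ^ n * weight 0 n) ->
   exists F, jet 0 T F /\ (forall n, F n 0 = d n) /\
    forall n t, 0 <= t <= T -> Cmod (F n t) <= K * e * (2 / b) ^ n * weight 0 n.
Proof.
intros HT Hb Hr Hbr.
assert (Hq : 0 < 9 * rho * b < 1) by nra.
pose proof (ex_series_quadratic_geometric _ Hq) as Hser.
set (q := 9 * rho * b) in *.
set (S0 := Series (fun k => (INR k + 1) ^ 2 * q ^ k)).
assert (HS0 : 0 <= S0).
{ pose proof (Series_le (fun k => 0 * ((INR k + 1) ^ 2 * q ^ k))
    (fun k => (INR k + 1) ^ 2 * q ^ k)) as H; rewrite Series_scal_l in H.
  rewrite <- (Rmult_0_l S0); apply H; [|exact Hser].
  intros k; pose proof (pow_lt q k (proj1 Hq)); pose proof (pow2_ge_0 (INR k + 1)); nra. }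
exists (2 * S0 + 1); split; [lra|]; intros d e Hd.
set (u := fun n k t => (RtoC (INR (fact k)) * d k * RtoC (borel b n k t))%C).
assert (He : 0 <= e).
{ pose proof (Hd 0%nat) as H; rewrite weight_0_r in H; pose proof (Cmod_ge_0 (d 0%nat)).
  simpl in H; lra. }
assert (Hu : forall n k t, 0 <= t <= T ->
  Cmod (u n k t) <= e * (2 / b) ^ n * INR (fact (2 * n)) * ((INR k + 1) ^ 2 * q ^ k)).
{ intros n k t Ht; unfold u; rewrite !Cmod_mult, !Cmod_R.
  pose proof (fact_pos k); rewrite (Rabs_pos_eq (INR _)) by lra.
  pose proof (borel_le_bound b n k t Hb (proj1 Ht)) as H1.
  pose proof (borel_bound_summable b rho n k Hb Hr) as H2; fold q in H2.
  specialize (Hd k); rewrite weight_0_l in Hd.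
  apply Rle_trans with (e * (rho ^ k * INR (fact (2 * k)) * borel_bound b n k)).
  - replace (e * (rho ^ k * INR (fact (2 * k)) * borel_bound b n k)) with
     (INR (fact k) * (e * rho ^ k * (INR (fact (2 * k)) / INR (fact k))) * borel_bound b n k)
     by (field; lra).
    apply Rmult_le_compat; auto using Rabs_pos.
    + apply Rmult_le_pos; [lra|apply Cmod_ge_0].
    + apply Rmult_le_compat_l; lra.
  - eapply Rle_trans; [apply Rmult_le_compat_l; [exact He|exact H2]|right; ring]. }
assert (HX : forall n, ex_series (fun k =>
  e * (2 / b) ^ n * INR (fact (2 * n)) * ((INR k + 1) ^ 2 * q ^ k)))
 by (intros; apply ex_series_scal_R; exact Hser).
exists (fun n t => (RtoC (/ INR (fact n)) * CSeries (fun k => u n k t))%C); split; [|split].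
- intros n t Ht; pose proof (fact_pos n); pose proof (pos_INR n).
  replace (RtoC (INR n + 1) * (RtoC (/ INR (fact (S n))) * CSeries (fun k => u (S n) k t)))%C
   with (RtoC (/ INR (fact n)) * CSeries (fun k => u (S n) k t))%C.
  + apply is_derive_in_scal; [exact Ht|].
    apply (is_derive_in_CSeries 0 T (u n) (u (S n)) (u (S (S n)))
     (fun k => e * (2 / b) ^ n * INR (fact (2 * n)) * ((INR k + 1) ^ 2 * q ^ k))
     (fun k => e * (2 / b) ^ (S n) * INR (fact (2 * S n)) * ((INR k + 1) ^ 2 * q ^ k))
     (fun k => e * (2 / b) ^ (S (S n)) * INR (fact (2 * S (S n))) * ((INR k + 1) ^ 2 * q ^ k)));
     auto; intros k x Hx; apply is_derive_in_scal; auto;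
     apply is_derive_in_real; auto; apply is_derive_borel; exact Hb.
  + rewrite Cmult_assoc, <- RtoC_mult; f_equal; f_equal; rewrite fact_S; field; lra.
- intros n; pose proof (fact_pos n).
  rewrite (CSeries_single _ n).
  + unfold u; rewrite borel_at_0; destruct Nat.eq_dec; [|lia].
      rewrite !Cmult_assoc, <- RtoC_mult, Rinv_l by lra; ring.
  + apply Csummable_dom with (2 := HX n); intros; apply Hu; lra.
  + intros k Hk; unfold u; rewrite borel_at_0; destruct Nat.eq_dec; [lia|ring].
- intros n t Ht; rewrite Cmod_mult, Cmod_R, weight_0_l.
  pose proof (fact_pos n); rewrite Rabs_pos_eq by (left; apply Rinv_0_lt_compat; lra).
  pose proof (Cmod_CSeries_le (fun k => u n k t) _ (fun k => Hu n k t Ht) (HX n)) as H1.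
  rewrite Series_scal_l in H1; fold S0 in H1.
  apply (Rmult_le_compat_l (/ INR (fact n))) in H1; [|left; apply Rinv_0_lt_compat; lra].
  eapply Rle_trans; [exact H1|].
  replace ((2 * S0 + 1) * e * (2 / b) ^ n * (INR (fact (2 * n)) / INR (fact n)))
   with ((2 * S0 + 1) * (e * (2 / b) ^ n * INR (fact (2 * n)) / INR (fact n))) by (field; lra).
  replace (/ INR (fact n) * (2 * (e * (2 / b) ^ n * INR (fact (2 * n)) * S0)))
   with (2 * S0 * (e * (2 / b) ^ n * INR (fact (2 * n)) / INR (fact n))) by (field; lra).
  apply Rmult_le_compat_r; [|lra].
  pose proof (fact_pos (2 * n)); pose proof (pow_lt (2 / b) n ltac:(apply Rdiv_lt_0_compat; lra)).
  apply Rdiv_le_0_compat; [|lra]; repeat apply Rmult_le_pos; lra.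
Qed.

(** * Interpolating Taylor coefficients at two points *)

Lemma conv_weight_bound (u v : nat -> C) (A B q : R) (n : nat) :
  0 <= q -> 0 <= A -> 0 <= B ->
  (forall p, Cmod (u p) <= A * q ^ p * weight 0 p) ->
  (forall p, Cmod (v p) <= B * q ^ p * weight 0 p) ->
  Cmod (conv u v n) <= (INR n + 1) * (A * B) * q ^ n * weight 0 n.
Proof.
intros Hq HA HB Hu Hv.
replace ((INR n + 1) * (A * B) * q ^ n * weight 0 n)
  with (A * B * q ^ n * weight 0 n * INR (S n)) by (rewrite S_INR; ring).
rewrite <- sum_cte; apply Cmod_sum; intros i Hi; rewrite Cmod_mult.
eapply Rle_trans; [apply Rmult_le_compat; [apply Cmod_ge_0|apply Cmod_ge_0|apply Hu|apply Hv]|].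
pose proof (weight_supermult 0 i 0 (n - i)) as W.
replace (0 + 0)%nat with 0%nat in W by lia; replace (i + (n - i))%nat with n in W by lia.
rewrite (pow_split q i n Hi).
replace (A * q ^ i * weight 0 i * (B * q ^ (n - i) * weight 0 (n - i)))
  with (A * B * (q ^ i * q ^ (n - i)) * (weight 0 i * weight 0 (n - i))) by ring.
apply Rmult_le_compat_l; [|exact W].
pose proof (pow_le q i Hq); pose proof (pow_le q (n - i) Hq).
apply Rmult_le_pos; apply Rmult_le_pos; assumption.
Qed.

Lemma pow_m1_sqr (n : nat) : (-1) ^ n * (-1) ^ n = 1.
Proof. rewrite <- Rpow_mult_distr; replace (-1 * -1) with 1 by ring; apply pow1. Qed.

Lemma continuous_flat0 (b t : R) : 0 < b -> continuous (flat0 b 0) t.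
Proof.
intros Hb; apply (ex_derive_continuous (K:=R_AbsRing) (V:=R_NormedModule)).
eexists; apply is_derive_flat0; exact Hb.
Qed.

(** One minus the normalized primitive of [exp(-b/s) exp(-b/(T-s))].  Its Taylor
    coefficients have the same rate as those of [exp(-b/s)]: the factor [n + 1]
    of Leibniz's rule is regained by the integration. *)
Lemma flat_cutoff (b T : R) : 0 < b -> 0 < T ->
  exists (K : R) (psi : nat -> R -> C), 0 < K /\ jet 0 T psi /\
    psi 0%nat 0 = 1 /\ (forall n, psi (S n) 0 = 0) /\ (forall n, psi n T = 0) /\
    forall n t, 0 <= t <= T -> Cmod (psi n t) <= K * (2 / b) ^ n * weight 0 n.
Proof.
intros Hb HT.
assert (Hk : 0 < 2 / b) by (apply Rdiv_lt_0_compat; lra).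
set (E := fun n t => RtoC (/ INR (fact n) * flat b n 0 t)).
assert (HE : jet 0 T E).
{ intros n t Ht; unfold E; rewrite <- RtoC_mult; apply is_derive_in_real; [exact Ht|].
  replace ((INR n + 1) * (/ INR (fact (S n)) * flat b (S n) 0 t))
    with (/ INR (fact n) * flat b (S n) 0 t).
  - apply is_derive_scal, is_derive_flat; exact Hb.
  - pose proof (fact_pos n); pose proof (pos_INR n); rewrite fact_S; field; lra. }
assert (BE : forall n t, Cmod (E n t) <= 1 * (2 / b) ^ n * weight 0 n).
{ intros n t; unfold E; rewrite Cmod_R, Rabs_mult, weight_0_l.
  pose proof (fact_pos n); assert (0 < / INR (fact n)) by (apply Rinv_0_lt_compat; assumption).
  rewrite Rabs_pos_eq by lra.
  pose proof (flat_bound b n 0 t Hb) as HF; rewrite Nat.add_0_l in HF; change (b ^ 0) with 1 in HF.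
  apply (Rmult_le_compat_l (/ INR (fact n))) in HF; [|lra].
  eapply Rle_trans; [exact HF|right; field; lra]. }
set (E' := fun n t => (RtoC ((-1) ^ n) * E n (0 + T - t)%R)%C).
assert (HE' : jet 0 T E') by (apply (jet_reflect 0 T E); exact HE).
assert (BE' : forall n t, Cmod (E' n t) <= 1 * (2 / b) ^ n * weight 0 n).
{ intros n t; unfold E'; rewrite Cmod_mult, Cmod_R, pow_1_abs, (Rmult_1_l (Cmod _)); apply BE. }
set (B := fun n t => conv (fun i => E i t) (fun i => E' i t) n).
assert (HB : jet 0 T B) by (apply jet_conv; assumption).
assert (BB : forall n t, Cmod (B n t) <= (INR n + 1) * ((2 / b) ^ n * weight 0 n)).
{ intros n t; eapply Rle_trans;
   [apply (conv_weight_bound _ _ 1 1 (2 / b)); auto; lra|right; ring]. }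
set (beta := fun s => flat0 b 0 s * flat0 b 0 (T - s)).
assert (B0 : forall t, B 0%nat t = RtoC (beta t)).
{ intros t; unfold B, conv; rewrite Csum_O; unfold E', E, beta; simpl.
  rewrite <- !RtoC_mult; f_equal; rewrite Rplus_0_l; field. }
assert (Cb : forall s, continuous beta s).
{ intros s; apply (continuous_mult (K:=R_AbsRing)); [apply continuous_flat0; exact Hb|].
  apply continuous_comp; [|apply continuous_flat0; exact Hb].
  apply (continuous_minus (K:=R_AbsRing) (V:=R_NormedModule));
   [apply continuous_const|apply continuous_id]. }
assert (Pb : forall s, 0 <= beta s).
{ intros s; apply Rmult_le_pos; apply flat0_bound; exact Hb. }
assert (Eb : forall u v, ex_RInt beta u v).
{ intros u v; apply (ex_RInt_continuous (V:=R_CompleteNormedModule)); intros; apply Cb. }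
set (I := RInt beta 0 T).
assert (HI : 0 < I).
{ apply RInt_gt_0; [exact HT| |intros; apply Cb].
  intros s Hs; unfold beta, flat0.
  destruct (Rlt_dec 0 s); [|lra]; destruct (Rlt_dec 0 (T - s)); [|lra].
  simpl; rewrite !Rmult_1_l; apply Rmult_lt_0_compat; apply exp_pos. }
set (P := fun t => 1 - / I * RInt beta 0 t).
assert (HP : forall t, is_derive P t (- / I * beta t)).
{ intros t; unfold P.
  replace (- / I * beta t) with (0 - / I * beta t) by ring.
  apply (is_derive_minus (K:=R_AbsRing) (V:=R_NormedModule)); [apply @is_derive_const|].
  apply is_derive_scal; apply (is_derive_RInt beta _ 0 t); [|apply Cb].
  exists (mkposreal 1 Rlt_0_1); intros s _; apply (RInt_correct (V:=R_CompleteNormedModule)), Eb. }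
assert (BP : forall t, 0 <= t <= T -> 0 <= P t <= 1).
{ intros t Ht; unfold P.
  assert (H1 : 0 <= RInt beta 0 t) by (apply RInt_ge_0; auto; lra).
  assert (H2 : 0 <= RInt beta t T) by (apply RInt_ge_0; auto; lra).
  pose proof (RInt_Chasles (V:=R_CompleteNormedModule) beta 0 t T (Eb _ _) (Eb _ _)) as H3.
  change (RInt beta 0 t + RInt beta t T = I) in H3.
  assert (0 < / I) by (apply Rinv_0_lt_compat; exact HI).
  split; [|nra].
  assert (/ I * RInt beta 0 t <= / I * I) by (apply Rmult_le_compat_l; lra).
  rewrite Rinv_l in H0 by lra; lra. }
set (psi := fun n t => match n with O => RtoC (P t)
  | S m => (RtoC (- / (I * (INR m + 1))) * B m t)%C end).
exists (1 + / (I * (2 / b))), psi.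
assert (HIb : 0 < / (I * (2 / b))) by (apply Rinv_0_lt_compat; nra).
split; [lra|]; split; [|split; [|split; [|split]]].
- intros [|n] t Ht.
  + change (is_derive_in 0 T (fun t => RtoC (P t)) t
      (RtoC (INR 0 + 1) * (RtoC (- / (I * (INR 0 + 1))) * B 0%nat t))%C).
    rewrite B0, <- !RtoC_mult; apply is_derive_in_real; [exact Ht|].
    replace ((INR 0 + 1) * (- / (I * (INR 0 + 1)) * beta t)) with (- / I * beta t)
      by (simpl; field; lra).
    apply HP.
  + change (is_derive_in 0 T (fun t => (RtoC (- / (I * (INR n + 1))) * B n t)%C) t
      (RtoC (INR (S n) + 1) * (RtoC (- / (I * (INR (S n) + 1))) * B (S n) t))%C).
    replace (RtoC (INR (S n) + 1) * (RtoC (- / (I * (INR (S n) + 1))) * B (S n) t))%C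
     with (RtoC (- / (I * (INR n + 1))) * (RtoC (INR n + 1) * B (S n) t))%C.
    * apply is_derive_in_scal; [exact Ht|]; apply HB; exact Ht.
    * rewrite !Cmult_assoc, <- !RtoC_mult; f_equal; f_equal; rewrite S_INR.
      pose proof (pos_INR n); field; lra.
- unfold psi, P; rewrite RInt_point; change (RtoC (1 - / I * 0) = 1); f_equal; ring.
- intros n; unfold psi.
  replace (B n 0) with (RtoC 0); [ring|]; symmetry.
  unfold B, conv; rewrite (Csum_ext _ (fun i => (0 * 0)%C)).
  + rewrite Csum_scal; ring.
  + intros i _; unfold E at 1; rewrite flat_at_0, Rmult_0_r; ring.
- intros [|n]; unfold psi.
  + unfold P; fold I; rewrite Rinv_l by lra; f_equal; ring.
  + replace (B n T) with (RtoC 0); [ring|]; symmetry.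
    unfold B, conv; rewrite (Csum_ext _ (fun i => (0 * 0)%C)).
    * rewrite Csum_scal; ring.
    * intros i _; unfold E', E; rewrite Rplus_0_l, Rminus_diag, flat_at_0, Rmult_0_r; ring.
- intros [|n] t Ht; unfold psi.
  + rewrite weight_0_r, Cmod_R; specialize (BP t Ht); rewrite Rabs_pos_eq by lra; simpl; lra.
  + pose proof (pos_INR n); pose proof (pow_lt _ n Hk); pose proof (weight_pos 0 n).
    assert (0 < I * (INR n + 1)) by nra.
    rewrite Cmod_mult, Cmod_R, Rabs_Ropp, Rabs_pos_eq
      by (left; apply Rinv_0_lt_compat; assumption).
    assert (W : weight 0 n <= weight 0 (S n)).
    { pose proof (weight_S_r 0 n) as W; simpl (0 + n)%nat in W.
      assert ((INR n + 1) * weight 0 n <= (INR n + 1) * weight 0 (S n)); [|nra].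
      rewrite W; apply Rmult_le_compat_r; nra. }
    apply Rle_trans with (/ I * ((2 / b) ^ n * weight 0 n)).
    * apply Rle_trans with (/ (I * (INR n + 1)) * ((INR n + 1) * ((2 / b) ^ n * weight 0 n))).
      { apply Rmult_le_compat_l; [left; apply Rinv_0_lt_compat; assumption|apply BB]. }
      right; field; lra.
    * apply Rle_trans with (/ (I * (2 / b)) * (2 / b) ^ S n * weight 0 (S n)).
      { replace (/ (I * (2 / b)) * (2 / b) ^ S n) with (/ I * (2 / b) ^ n)
          by (simpl; set (z := (2 / b) ^ n); field; lra).
        rewrite <- Rmult_assoc; apply Rmult_le_compat_l; [|exact W].
        apply Rmult_le_pos; [left; apply Rinv_0_lt_compat; exact HI|lra]. }
      { rewrite !Rmult_assoc; apply Rmult_le_compat_r; [|lra].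
        apply Rmult_le_pos; [apply pow_le; lra|left; apply weight_pos]. }
Qed.

(** The factor [n + 1] is the number of terms in Leibniz's rule. *)
Lemma borel_ritt_flat_end (b rho T : R) : 0 < T -> 0 < b -> 0 < rho -> 9 * rho * b < 1 ->
  exists K, 0 < K /\ forall (d : nat -> C) (e : R),
   (forall n, Cmod (d n) <= e * rho ^ n * weight 0 n) ->
   exists F, jet 0 T F /\ (forall n, F n 0 = d n) /\ (forall n, F n T = 0) /\
    forall n t, 0 <= t <= T -> Cmod (F n t) <= K * e * (INR n + 1) * (2 / b) ^ n * weight 0 n.
Proof.
intros HT Hb Hr Hbr.
destruct (borel_ritt b rho T HT Hb Hr Hbr) as (K1 & HK1 & H1).
destruct (flat_cutoff b T Hb HT) as (K2 & psi & HK2 & Hpsi & psi0 & psiS & psiT & Bpsi).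
exists (K1 * K2); split; [nra|]; intros d e Hd.
destruct (H1 d e Hd) as (G & HG & G0 & BG).
assert (Hk : 0 < 2 / b) by (apply Rdiv_lt_0_compat; lra).
assert (He : 0 <= e).
{ pose proof (Hd 0%nat) as H; rewrite weight_0_r in H; pose proof (Cmod_ge_0 (d 0%nat)).
  simpl in H; lra. }
exists (fun n t => conv (fun i => psi i t) (fun i => G i t) n); split; [|split; [|split]].
- apply jet_conv; assumption.
- intros n; rewrite <- (G0 n); unfold conv; destruct n as [|n].
  + rewrite Csum_O, psi0; simpl; ring.
  + rewrite Csum_S_l, psi0, Nat.sub_0_r.
    rewrite (Csum_ext _ (fun i => (0 * 0)%C)) by (intros; rewrite psiS; ring).
    rewrite Csum_scal; ring.
- intros n; unfold conv; rewrite (Csum_ext _ (fun i => (0 * 0)%C)) by (intros; rewrite psiT; ring).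
  rewrite Csum_scal; ring.
- intros n t Ht.
  eapply Rle_trans; [apply (conv_weight_bound _ _ K2 (K1 * e) (2 / b)); auto; nra|].
  right; ring.
Qed.

(** Reflecting time exchanges the two ends, and flatness makes the two pieces
    independent. *)
Lemma two_point_borel_ritt (b rho T : R) : 0 < T -> 0 < b -> 0 < rho -> 9 * rho * b < 1 ->
  exists K, 0 < K /\ forall (d d' : nat -> C) (e : R),
   (forall n, Cmod (d n) <= e * rho ^ n * weight 0 n) ->
   (forall n, Cmod (d' n) <= e * rho ^ n * weight 0 n) ->
   exists F, jet 0 T F /\ (forall n, F n 0 = d n) /\ (forall n, F n T = d' n) /\
    forall n t, 0 <= t <= T -> Cmod (F n t) <= K * e * (INR n + 1) * (2 / b) ^ n * weight 0 n.
Proof.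
intros HT Hb Hr Hbr.
destruct (borel_ritt_flat_end b rho T HT Hb Hr Hbr) as (K & HK & H).
exists (2 * K); split; [lra|]; intros d d' e Hd Hd'.
destruct (H d e Hd) as (F & HF & F0 & FT & BF).
destruct (H (fun n => (RtoC ((-1) ^ n) * d' n)%C) e) as (G & HG & G0 & GT & BG).
{ intros n; rewrite Cmod_mult, Cmod_R, pow_1_abs, Rmult_1_l; apply Hd'. }
exists (fun n t => (F n t + RtoC ((-1) ^ n) * G n (0 + T - t)%R)%C); split; [|split; [|split]].
- apply jet_plus; [exact HF|]; apply jet_reflect; exact HG.
- intros n; rewrite F0; replace (0 + T - 0) with T by ring; rewrite GT; ring.
- intros n; rewrite FT; replace (0 + T - T) with 0 by ring.
  rewrite G0, Cmult_assoc, <- RtoC_mult, pow_m1_sqr; ring.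
- intros n t Ht; eapply Rle_trans; [apply Cmod_triangle|].
  rewrite Cmod_mult, Cmod_R, pow_1_abs, Rmult_1_l.
  pose proof (BF n t Ht); pose proof (BG n (0 + T - t) ltac:(lra)); lra.
Qed.

(** * The controlled solution *)

(** The [p]-th derivative of [x^m / m!]. *)
Definition monomial_derive (p m : nat) (x : R) : R :=
  if Nat.leb p m then x ^ (m - p) / INR (fact (m - p)) else 0.

Lemma is_derive_monomial (p m : nat) (x : R) :
  is_derive (monomial_derive p m) x (monomial_derive (S p) m x).
Proof.
unfold monomial_derive.
destruct (Nat.leb_spec p m) as [H|H]; destruct (Nat.leb_spec (S p) m) as [H'|H']; try lia.
- replace (m - p)%nat with (S (m - S p)) by lia; set (j := (m - S p)%nat).
  auto_derive; [exact I|].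
  change (match j with 0%nat => 1 | S _ => INR j + 1 end) with (INR (S j)).
  change (fact j + j * fact j)%nat with (fact (S j)).
  rewrite fact_S, S_INR; pose proof (fact_pos j); pose proof (pos_INR j).
  field; lra.
- replace (m - p)%nat with 0%nat by lia.
  apply is_derive_ext with (fun _ => 1); [intros; simpl; field|apply @is_derive_const].
- apply @is_derive_const.
Qed.

(** The [k]-th term of the series of the derivative of order [p] in [x] and [n]
    in [t]. *)
Definition series_term (c : nat -> nat -> R -> C) (p n k : nat) (x t : R) : C :=
  (RtoC (INR (fact n) * INR (fact (2 * k)) * monomial_derive p (2 * k) x) * c k n t)%C.

Definition series_value (c : nat -> nat -> R -> C) (p n : nat) (x t : R) : C :=
  CSeries (fun k => series_term c p n k x t).

(** Growth of the mixed derivatives: [(p+2n)!] is of Gevrey order 1 in [x] and 2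
    in [t], see [derivative_size_gevrey]. *)
Definition derivative_size (a : R) (p n : nat) : R := 2 ^ p * (9 * a) ^ n * INR (fact (p + 2 * n)).

Lemma derivative_size_pos (a : R) (p n : nat) : 0 < a -> 0 < derivative_size a p n.
Proof.
intros Ha; unfold derivative_size.
pose proof (pow_lt 2 p ltac:(lra)); pose proof (pow_lt (9 * a) n ltac:(lra)).
apply Rmult_lt_0_compat; [apply Rmult_lt_0_compat; assumption|apply fact_pos].
Qed.

Lemma derivative_size_gevrey (a : R) (p n : nat) : 0 < a ->
  derivative_size a p n <= 4 ^ p * (144 * a) ^ n * (INR (fact p) * INR (fact n) ^ 2).
Proof.
intros Ha; unfold derivative_size.
pose proof (binomial_growth 1 p (2 * n) ltac:(lra)) as H1.
pose proof (binomial_growth 1 n n ltac:(lra)) as H2.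
rewrite pow1, Rmult_1_r in H1, H2; replace (1 + 1) with 2 in H1, H2 by ring.
replace (n + n)%nat with (2 * n)%nat in H2 by lia.
rewrite pow_add in H1; rewrite pow_mult in H1, H2; replace (2 ^ 2) with 4 in H1, H2 by ring.
assert (E : INR (fact (2 * n)) = binomial n n * (INR (fact n) * INR (fact n)))
  by (replace (2 * n)%nat with (n + n)%nat by lia; apply fact_plus).
rewrite fact_plus, E.
pose proof (binomial_pos p (2 * n)); pose proof (binomial_pos n n).
pose proof (fact_pos p); pose proof (fact_pos n).
pose proof (pow_lt 2 p ltac:(lra)); pose proof (pow_lt (9 * a) n ltac:(lra)).
pose proof (pow_lt 4 n ltac:(lra)).
replace (4 ^ p) with (2 ^ p * 2 ^ p) by (rewrite <- Rpow_mult_distr; f_equal; ring).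
replace ((144 * a) ^ n) with ((9 * a) ^ n * (4 ^ n * 4 ^ n))
  by (rewrite <- !Rpow_mult_distr; f_equal; ring).
replace (2 ^ p * (9 * a) ^ n * (binomial p (2 * n) * (INR (fact p) *
  (binomial n n * (INR (fact n) * INR (fact n)))))) with
 ((2 ^ p * (9 * a) ^ n * (INR (fact p) * INR (fact n) ^ 2)) * (binomial p (2 * n) * binomial n n))
 by ring.
replace (2 ^ p * 2 ^ p * ((9 * a) ^ n * (4 ^ n * 4 ^ n)) * (INR (fact p) * INR (fact n) ^ 2)) with
 ((2 ^ p * (9 * a) ^ n * (INR (fact p) * INR (fact n) ^ 2)) * (2 ^ p * 4 ^ n * 4 ^ n)) by ring.
apply Rmult_le_compat_l.
- assert (0 < INR (fact n) ^ 2) by (apply pow_lt; assumption).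
  apply Rmult_le_pos; apply Rmult_le_pos; lra.
- apply Rmult_le_compat; lra.
Qed.

(** With [m = 2k - p], the factorials left are [(m+p+2n)! / m!]; the binomial
    coefficient of [m + p + 2n] over [m] is at most [3^(2k+2n) / 2^m], whence the
    ratio [9/4]. *)
Lemma series_term_bound (c : nat -> nat -> R -> C) (e a a' : R) (p n k : nat) (x t : R) :
  0 < a -> 0 < a' -> 0 <= e -> 0 <= x <= 1 ->
  Cmod (c k n t) <= e * a' ^ k * weighted a n * weight k n ->
  Cmod (series_term c p n k x t) <= e * derivative_size a p n * (9 / 4 * a') ^ k.
Proof.
intros Ha Ha' He Hx Hc.
assert (Hq : 0 < (9 / 4 * a') ^ k) by (apply pow_lt; lra).
pose proof (derivative_size_pos a p n Ha).
unfold series_term, monomial_derive; destruct (Nat.leb_spec p (2 * k)) as [Hp|Hp].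
2: { rewrite Rmult_0_r, Cmult_0_l, Cmod_0; apply Rmult_le_pos; [nra|lra]. }
set (m := (2 * k - p)%nat).
pose proof (fact_pos n) as Fn; pose proof (fact_pos (2 * k)) as Fk; pose proof (fact_pos m) as Fm.
assert (Hxm : 0 <= x ^ m <= 1).
{ split; [apply pow_le; lra|]; rewrite <- (pow1 m); apply pow_incr; lra. }
assert (Hfac : INR (fact (2 * k + 2 * n)) / INR (fact m)
   <= (9 / 4) ^ k * 2 ^ p * 9 ^ n * INR (fact (p + 2 * n))).
{ pose proof (binomial_growth 2 (p + 2 * n) m ltac:(lra)) as HB.
  replace (p + 2 * n + m)%nat with (2 * (k + n))%nat in HB by (unfold m; lia).
  replace (2 * k + 2 * n)%nat with (p + 2 * n + m)%nat by (unfold m; lia).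
  rewrite fact_plus.
  replace (1 + 2) with 3 in HB by ring; rewrite (pow_mult 3) in HB; replace (3 ^ 2) with 9 in HB by ring.
  rewrite pow_add in HB.
  assert (E2 : 2 ^ m * 2 ^ p = 4 ^ k).
  { rewrite <- pow_add; replace (m + p)%nat with (2 * k)%nat by (unfold m; lia).
    rewrite pow_mult; f_equal; ring. }
  assert (E9 : (9 / 4) ^ k * 4 ^ k = 9 ^ k) by (rewrite <- Rpow_mult_distr; f_equal; field).
  pose proof (pow_lt 2 m ltac:(lra)); pose proof (pow_lt 2 p ltac:(lra)).
  pose proof (fact_pos (p + 2 * n)) as Fpn.
  replace (binomial (p + 2 * n) m * (INR (fact (p + 2 * n)) * INR (fact m)) / INR (fact m))
   with (binomial (p + 2 * n) m * INR (fact (p + 2 * n))) by (field; lra).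
  apply Rmult_le_compat_r; [lra|].
  apply Rmult_le_reg_r with (2 ^ m); [assumption|].
  eapply Rle_trans; [exact HB|]; right.
  rewrite <- E9, <- E2; ring. }
assert (HW : weighted a n <= a ^ n).
{ unfold weighted; pose proof (pow_lt a n Ha); pose proof (pos_INR n).
  apply Rle_div_l; nra. }
rewrite Cmod_mult, Cmod_R, Rabs_pos_eq.
2: { apply Rmult_le_pos; [apply Rmult_le_pos; lra|apply Rdiv_le_0_compat; lra]. }
pose proof (pow_lt a n Ha); pose proof (pow_lt a' k Ha').
apply Rle_trans with ((e * a' ^ k * a ^ n) * (INR (fact (2 * k + 2 * n)) / INR (fact m))).
- apply Rle_trans with (INR (fact n) * INR (fact (2 * k)) * (1 / INR (fact m)) *
    (e * a' ^ k * a ^ n * weight k n)).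
  + apply Rmult_le_compat; [|apply Cmod_ge_0| |].
    * apply Rmult_le_pos; [apply Rmult_le_pos; lra|apply Rdiv_le_0_compat; lra].
    * apply Rmult_le_compat_l; [apply Rmult_le_pos; lra|].
      apply Rmult_le_compat_r; [left; apply Rinv_0_lt_compat; lra|lra].
    * eapply Rle_trans; [exact Hc|].
      apply Rmult_le_compat_r; [left; apply weight_pos|].
      apply Rmult_le_compat_l; [nra|exact HW].
  + right; unfold weight; field; lra.
- eapply Rle_trans; [apply Rmult_le_compat_l; [|exact Hfac]|].
  + apply Rmult_le_pos; [apply Rmult_le_pos|]; lra.
  + right; unfold derivative_size; rewrite !Rpow_mult_distr; ring.
Qed.

Lemma conv_pow (z : C) (u v : nat -> C) (k : nat) :
  conv (fun i => (z ^ i * u i)%C) (fun i => (z ^ i * v i)%C) k = (z ^ k * conv u v k)%C.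
Proof.
unfold conv; rewrite <- Csum_scal; apply Csum_ext; intros i Hi.
replace (z ^ k)%C with (z ^ i * z ^ (k - i))%C; [ring|].
rewrite <- Cpow_add_r; f_equal; lia.
Qed.

Lemma cubic_0 (u : nat -> nat -> C) (k : nat) :
  cubic u k 0 = conv (conv (fun i => u i 0%nat) (fun i => u i 0%nat)) (fun i => Cconj (u i 0%nat)) k.
Proof.
assert (E : forall u v : nat -> nat -> C, forall k,
  conv2 u v k 0 = conv (fun i => u i 0%nat) (fun i => v i 0%nat) k).
{ intros; unfold conv2; apply Csum_ext; intros i Hi; unfold conv; rewrite Csum_O; reflexivity. }
unfold cubic; rewrite E; apply conv_ext; [intros; apply E|reflexivity].
Qed.

Lemma Cpow_conj_real (x : R) (k : nat) : Cconj (RtoC x ^ k)%C = (RtoC x ^ k)%C.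
Proof. rewrite Cpow_conj; f_equal; unfold Cconj, RtoC; simpl; f_equal; ring. Qed.

Section Solution.

Variables (lam mu : C) (T e a a' : R) (c : nat -> nat -> R -> C).
Hypotheses (HT : 0 < T) (He : 0 <= e) (Ha : 0 < a) (Ha' : 0 < a') (Haq : 9 / 4 * a' < 1).
Hypothesis c_jet : forall k, jet 0 T (c k).
Hypothesis c_bound : forall k n t, 0 <= t <= T ->
  Cmod (c k n t) <= e * a' ^ k * weighted a n * weight k n.
Hypothesis c_equation : forall t, array_equation lam mu (fun k n => c k n t).

Let term_bound (p n k : nat) : R := e * derivative_size a p n * (9 / 4 * a') ^ k.

Lemma term_le (p n k : nat) (x t : R) : 0 <= x <= 1 -> 0 <= t <= T ->
  Cmod (series_term c p n k x t) <= term_bound p n k.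
Proof. intros Hx Ht; apply series_term_bound; auto. Qed.

Lemma ex_series_term_bound (p n : nat) : ex_series (term_bound p n).
Proof.
apply ex_series_scal_R, ex_series_geom; rewrite Rabs_pos_eq; lra.
Qed.

Lemma term_summable (p n : nat) (x t : R) : 0 <= x <= 1 -> 0 <= t <= T ->
  Csummable (fun k => series_term c p n k x t).
Proof.
intros Hx Ht; apply Csummable_dom with (term_bound p n); [|apply ex_series_term_bound].
intros; apply term_le; assumption.
Qed.

Lemma series_value_bound (p n : nat) (x t : R) : 0 <= x <= 1 -> 0 <= t <= T ->
  Cmod (series_value c p n x t) <= 2 * e / (1 - 9 / 4 * a') * derivative_size a p n.
Proof.
intros Hx Ht.
eapply Rle_trans; [apply (Cmod_CSeries_le _ (term_bound p n));
  [intros; apply term_le; assumption|apply ex_series_term_bound]|].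
unfold term_bound; rewrite Series_scal_l, Series_geom by (rewrite Rabs_pos_eq; lra).
right; field; lra.
Qed.

Lemma series_value_derive_x (p n : nat) (x t : R) : 0 <= x <= 1 -> 0 <= t <= T ->
  is_derive_in 0 1 (fun x => series_value c p n x t) x (series_value c (S p) n x t).
Proof.
intros Hx Ht.
assert (D : forall p k x, 0 <= x <= 1 ->
  is_derive_in 0 1 (fun x => series_term c p n k x t) x (series_term c (S p) n k x t)).
{ clear -Ht; intros p k x Hx; unfold series_term.
  apply is_derive_in_ext with (fun x =>
    (c k n t * RtoC (INR (fact n) * INR (fact (2 * k)) * monomial_derive p (2 * k) x))%C);
   [exact Hx|intros; apply Cmult_comm|].
  rewrite Cmult_comm; apply is_derive_in_scal; [exact Hx|].
  apply is_derive_in_real; [exact Hx|].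
  apply is_derive_scal, is_derive_monomial. }
apply (is_derive_in_CSeries 0 1 (fun k x => series_term c p n k x t)
  (fun k x => series_term c (S p) n k x t) (fun k x => series_term c (S (S p)) n k x t)
  (term_bound p n) (term_bound (S p) n) (term_bound (S (S p)) n));
 auto using ex_series_term_bound; intros; apply term_le; assumption.
Qed.

Lemma series_value_derive_t (p n : nat) (x t : R) : 0 <= x <= 1 -> 0 <= t <= T ->
  is_derive_in 0 T (fun t => series_value c p n x t) t (series_value c p (S n) x t).
Proof.
intros Hx Ht.
assert (D : forall n k t, 0 <= t <= T ->
  is_derive_in 0 T (fun t => series_term c p n k x t) t (series_term c p (S n) k x t)).
{ intros n' k t' Ht'; unfold series_term.
  replace (RtoC (INR (fact (S n')) * INR (fact (2 * k)) * monomial_derive p (2 * k) x)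
     * c k (S n') t')%C
   with (RtoC (INR (fact n') * INR (fact (2 * k)) * monomial_derive p (2 * k) x)
     * (RtoC (INR n' + 1) * c k (S n') t'))%C.
  - apply is_derive_in_scal; [exact Ht'|]; apply c_jet; exact Ht'.
  - rewrite Cmult_assoc, <- RtoC_mult, fact_S; f_equal; f_equal; ring. }
apply (is_derive_in_CSeries 0 T (fun k t => series_term c p n k x t)
  (fun k t => series_term c p (S n) k x t) (fun k t => series_term c p (S (S n)) k x t)
  (term_bound p n) (term_bound p (S n)) (term_bound p (S (S n))));
 auto using ex_series_term_bound; intros; apply term_le; assumption.
Qed.

Definition agrees (p n : nat) (z : R -> R -> C) : Prop :=
  forall x t, 0 <= x <= 1 -> 0 <= t <= T -> z x t = series_value c p n x t.

Lemma agrees_x (p n : nat) (z : R -> R -> C) :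
  agrees p n z -> agrees (S p) n (partial_x 0 1 z).
Proof.
intros H x t Hx Ht.
apply (Derive_in_eq 0 1 _ (fun x => series_value c p n x t)
  (fun x => series_value c (S p) n x t)); [lra|exact Hx| |].
- intros; apply H; assumption.
- apply series_value_derive_x; assumption.
Qed.

Lemma agrees_t (p n : nat) (z : R -> R -> C) :
  agrees p n z -> agrees p (S n) (partial_t 0 T z).
Proof.
intros H x t Hx Ht.
apply (Derive_in_eq 0 T _ (fun t => series_value c p n x t)
  (fun t => series_value c p (S n) x t)); [exact HT|exact Ht| |].
- intros; apply H; assumption.
- apply series_value_derive_t; assumption.
Qed.

(** Bounded first derivatives make the sum Lipschitz in each variable. *)
Lemma agrees_continuous (p n : nat) (z : R -> R -> C) : agrees p n z ->
  continuous_on (fun q : R * R => 0 <= fst q <= 1 /\ 0 <= snd q <= T)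
    (fun q : R * R => z (fst q) (snd q)).
Proof.
intros H [x0 t0] [Hx0 Ht0]; simpl in Hx0, Ht0.
set (L1 := 2 * e / (1 - 9 / 4 * a') * derivative_size a (S p) n).
set (L2 := 2 * e / (1 - 9 / 4 * a') * derivative_size a p (S n)).
assert (HL : 0 <= L1 /\ 0 <= L2).
{ split; eapply Rle_trans; try apply Cmod_ge_0; apply (series_value_bound _ _ x0 t0); assumption. }
apply filterlim_locally; intros eps.
assert (Hd : 0 < eps / (L1 + L2 + 1)) by (apply Rdiv_lt_0_compat; [apply cond_pos|lra]).
exists (mkposreal _ Hd); intros [x t] [Bx Bt] [Hx Ht]; simpl in Hx, Ht.
change (Rabs (x - x0) < eps / (L1 + L2 + 1)) in Bx.
change (Rabs (t - t0) < eps / (L1 + L2 + 1)) in Bt.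
simpl fst; simpl snd; rewrite (H x t Hx Ht), (H x0 t0 Hx0 Ht0).
pose proof (mean_value_in 0 1 (fun x => series_value c p n x t)
  (fun x => series_value c (S p) n x t) L1
  (fun x Hx => series_value_derive_x p n x t Hx Ht)
  (fun x Hx => series_value_bound (S p) n x t Hx Ht) x0 x Hx0 Hx) as M1; simpl in M1.
pose proof (mean_value_in 0 T (fun t => series_value c p n x0 t)
  (fun t => series_value c p (S n) x0 t) L2
  (fun t Ht => series_value_derive_t p n x0 t Hx0 Ht)
  (fun t Ht => series_value_bound p (S n) x0 t Hx0 Ht) t0 t Ht0 Ht) as M2; simpl in M2.
assert (D : Cmod (series_value c p n x t - series_value c p n x0 t0) < eps).
{ replace (series_value c p n x t - series_value c p n x0 t0)%C with
   ((series_value c p n x t - series_value c p n x0 t) +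
    (series_value c p n x0 t - series_value c p n x0 t0))%C by ring.
  eapply Rle_lt_trans; [apply Cmod_triangle|].
  apply Rlt_div_r in Bx; [|lra]; apply Rlt_div_r in Bt; [|lra].
  apply Rle_lt_trans with ((L1 + L2) * Rmax (Rabs (x - x0)) (Rabs (t - t0))).
  - pose proof (Rmax_l (Rabs (x - x0)) (Rabs (t - t0))).
    pose proof (Rmax_r (Rabs (x - x0)) (Rabs (t - t0))). nra.
  - pose proof (Rabs_pos (x - x0)); pose proof (Rabs_pos (t - t0)).
    unfold Rmax; destruct Rle_dec; pose proof (cond_pos eps); nra. }
split.
- eapply Rle_lt_trans; [apply (re_le_Cmod (series_value c p n x t - series_value c p n x0 t0))|exact D].
- eapply Rle_lt_trans; [apply (im_le_Cmod (series_value c p n x t - series_value c p n x0 t0))|exact D].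
Qed.

Lemma agrees_Ck (k p n : nat) (z : R -> R -> C) : agrees p n z -> Ck_rect k 0 1 0 T z.
Proof.
revert p n z; induction k as [|k IH]; intros p n z H; simpl.
- split; [apply (agrees_continuous p n); exact H|exact I].
- split; [apply (agrees_continuous p n); exact H|split; [|split]].
  + intros x t Hx Ht; split.
    * exists (series_value c (S p) n x t).
      apply is_derive_in_ext with (fun x => series_value c p n x t); [exact Hx| |].
      { intros; symmetry; apply H; assumption. }
      { apply series_value_derive_x; assumption. }
    * exists (series_value c p (S n) x t).
      apply is_derive_in_ext with (fun t => series_value c p n x t); [exact Ht| |].
      { intros; symmetry; apply H; assumption. }
      { apply series_value_derive_t; assumption. }
  + apply (IH (S p) n), agrees_x, H.
  + apply (IH p (S n)), agrees_t, H.
Qed.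

Lemma agrees_iter (p n : nat) :
  agrees p n (Nat.iter p (partial_x 0 1) (Nat.iter n (partial_t 0 T) (series_value c 0 0))).
Proof.
induction p as [|p IH]; [|apply agrees_x; exact IH].
induction n as [|n IH]; [intros x t _ _; reflexivity|apply agrees_t; exact IH].
Qed.

Lemma series_value_gevrey_bound : exists M r1 r2, 0 < M /\ 0 < r1 /\ 0 < r2 /\
  forall p n x t, 0 <= x <= 1 -> 0 <= t <= T ->
   Cmod (series_value c p n x t) <=
     M * INR (fact p) * INR (fact n) ^ 2 / (r1 ^ p * r2 ^ n).
Proof.
set (K := 2 * e / (1 - 9 / 4 * a')).
assert (HK : 0 <= K) by (apply Rdiv_le_0_compat; lra).
exists (K + 1), (/ 4), (/ (144 * a)).
assert (0 < / (144 * a)) by (apply Rinv_0_lt_compat; lra).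
split; [lra|]; split; [lra|]; split; [assumption|].
intros p n x t Hx Ht; eapply Rle_trans; [apply series_value_bound; assumption|]; fold K.
pose proof (derivative_size_gevrey a p n Ha) as H1; pose proof (derivative_size_pos a p n Ha).
pose proof (pow_lt 4 p ltac:(lra)); pose proof (pow_lt (144 * a) n ltac:(lra)).
rewrite !pow_inv.
replace ((K + 1) * INR (fact p) * INR (fact n) ^ 2 / (/ 4 ^ p * / (144 * a) ^ n))
 with ((K + 1) * (4 ^ p * (144 * a) ^ n * (INR (fact p) * INR (fact n) ^ 2))) by (field; lra).
apply Rmult_le_compat; lra.
Qed.

Lemma series_value_gevrey2 : Gevrey2 1 2 0 1 0 T (series_value c 0 0).
Proof.
split.
- intros k; apply (agrees_Ck k 0 0); intros x t _ _; reflexivity.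
- destruct series_value_gevrey_bound as (M & r1 & r2 & HM & H1 & H2 & H).
  exists M, r1, r2; split; [exact HM|]; split; [exact H1|]; split; [exact H2|].
  intros p n x t Hx Ht; rewrite (agrees_iter p n x t Hx Ht).
  rewrite Rpower_1 by apply fact_pos.
  replace 2 with (INR 2) by reflexivity; rewrite Rpower_pow by apply fact_pos.
  apply H; assumption.
Qed.

Lemma flux_gevrey : Gevrey 2 0 T (series_value c 1 0 1).
Proof.
set (F := fun n t => (RtoC (/ INR (fact n)) * series_value c 1 n 1 t)%C).
assert (HF : jet 0 T F).
{ intros n t Ht; unfold F.
  replace (RtoC (INR n + 1) * (RtoC (/ INR (fact (S n))) * series_value c 1 (S n) 1 t))%C
   with (RtoC (/ INR (fact n)) * series_value c 1 (S n) 1 t)%C.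
  - apply is_derive_in_scal; [exact Ht|]; apply series_value_derive_t; [lra|exact Ht].
  - rewrite Cmult_assoc, <- RtoC_mult; f_equal; f_equal.
    pose proof (fact_pos n); pose proof (pos_INR n); rewrite fact_S; field; lra. }
assert (E : forall t, 0 <= t <= T -> series_value c 1 0 1 t = F 0%nat t).
{ intros; unfold F; simpl; rewrite Rinv_1; ring. }
split; [apply (smooth_in_jet 0 T _ F); assumption|].
destruct series_value_gevrey_bound as (M & r1 & r2 & HM & H1 & H2 & H).
exists (M / r1), r2; split; [apply Rdiv_lt_0_compat; assumption|]; split; [exact H2|].
intros n t Ht; rewrite (Derive_n_in_jet 0 T _ F HT HF E n t Ht).
unfold F; pose proof (fact_pos n).
rewrite Cmult_assoc, <- RtoC_mult, Rinv_r, Cmult_1_l by lra.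
replace 2 with (INR 2) by reflexivity; rewrite Rpower_pow by apply fact_pos.
specialize (H 1%nat n 1 t ltac:(lra) Ht); eapply Rle_trans; [exact H|].
pose proof (pow_lt r2 n H2); right; simpl; field; lra.
Qed.

Lemma series_term_00 (k : nat) (x t : R) :
  series_term c 0 0 k x t = (RtoC (x ^ 2) ^ k * c k 0%nat t)%C.
Proof.
unfold series_term, monomial_derive; simpl (Nat.leb 0 _); cbv iota; rewrite Nat.sub_0_r.
rewrite <- RtoC_pow, <- pow_mult; pose proof (fact_pos (2 * k)); f_equal; f_equal.
change (INR (fact 0)) with 1; field; lra.
Qed.

Lemma series_value_equation (x t : R) : 0 <= x <= 1 -> 0 <= t <= T ->
  series_value c 0 1 x t = (lam * series_value c 2 0 x t +
    mu * (RtoC (Cmod (series_value c 0 0 x t) ^ 2) * series_value c 0 0 x t))%C.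
Proof.
intros Hx Ht; set (z := RtoC (x ^ 2)).
assert (S0 : Csummable (fun k => (z ^ k * c k 0%nat t)%C)).
{ eapply ex_series_ext; [|exact (term_summable 0 0 x t Hx Ht)].
  intros k; simpl; rewrite series_term_00; reflexivity. }
assert (E0 : series_value c 0 0 x t = CSeries (fun k => (z ^ k * c k 0%nat t)%C))
  by (apply CSeries_ext; intros; apply series_term_00).
assert (S2 : Csummable (fun k => series_term c 2 0 (S k) x t))
  by (apply (Csummable_incr (fun k => series_term c 2 0 k x t)), term_summable; assumption).
assert (T2 : forall k, series_term c 2 0 (S k) x t =
  (z ^ k * (RtoC ((2 * INR k + 1) * (2 * INR k + 2)) * c (S k) 0%nat t))%C).
{ intros k; unfold series_term, monomial_derive.
  replace (2 * S k)%nat with (S (S (2 * k))) by lia; simpl (Nat.leb 2 _); cbv iota.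
  replace (S (S (2 * k)) - 2)%nat with (2 * k)%nat by lia.
  unfold z; rewrite <- RtoC_pow, <- pow_mult, Cmult_assoc, <- RtoC_mult; f_equal; f_equal.
  rewrite !fact_S, S_INR, mult_INR; change (INR (fact 0)) with 1; simpl (INR 2).
  pose proof (fact_pos (2 * k)); field; lra. }
assert (E2 : series_value c 2 0 x t = CSeries (fun k => series_term c 2 0 (S k) x t)).
{ unfold series_value; rewrite CSeries_incr by (apply term_summable; assumption).
  unfold series_term at 1, monomial_derive; simpl (Nat.leb 2 _); cbv iota; rewrite Rmult_0_r; ring. }
assert (Sc : Csummable (fun k => Cconj (z ^ k * c k 0%nat t))).
{ eapply ex_series_ext; [|exact S0]; intros; rewrite Cmod_conj; reflexivity. }
set (v := fun k => (z ^ k * c k 0%nat t)%C) in *.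
assert (Svv : Csummable (conv (conv v v) (fun k => Cconj (v k))))
  by (apply Csummable_conv; [apply Csummable_conv|]; assumption).
assert (E3 : forall k, conv (conv v v) (fun k => Cconj (v k)) k =
  (z ^ k * cubic (fun k n => c k n t) k 0)%C).
{ intros k; rewrite cubic_0, <- conv_pow; apply conv_ext; intros i _.
  - unfold v; apply conv_pow.
  - unfold v, z; rewrite Cmult_conj, Cpow_conj_real; reflexivity. }
rewrite Cmod2_conj, E2, E0; fold v.
replace (CSeries v * Cconj (CSeries v) * CSeries v)%C
  with (CSeries v * CSeries v * Cconj (CSeries v))%C by ring.
rewrite <- CSeries_conj, <- !CSeries_conv, <- !CSeries_scal, <- CSeries_plus
  by auto using Csummable_scal, Csummable_conv.
apply CSeries_ext; intros k; rewrite E3, T2.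
pose proof (c_equation t k 0%nat) as Heq; simpl (INR 0) in Heq.
rewrite Rplus_0_l, Cmult_1_l in Heq.
replace (series_term c 0 1 k x t) with (z ^ k * c k 1%nat t)%C.
- rewrite Heq; ring.
- unfold series_term, monomial_derive; simpl (Nat.leb 0 _); cbv iota; rewrite Nat.sub_0_r.
  unfold z; rewrite <- RtoC_pow, <- pow_mult; pose proof (fact_pos (2 * k)); f_equal; f_equal.
  change (INR (fact 1)) with 1; field; lra.
Qed.

Lemma series_value_neumann (t : R) : series_value c 1 0 0 t = 0.
Proof.
apply CSeries_0; intros k; unfold series_term, monomial_derive.
destruct (Nat.leb_spec 1 (2 * k)) as [Hk|Hk]; [|rewrite Rmult_0_r; ring].
rewrite pow_i by lia; unfold Rdiv; rewrite Rmult_0_l, Rmult_0_r; ring.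
Qed.

End Solution.

Lemma CSeries_even_terms (w : nat -> C) : Csummable w -> (forall k, w (S (2 * k)) = RtoC 0) ->
  CSeries w = CSeries (fun k => w (2 * k)%nat).
Proof.
assert (main : forall u : nat -> R, ex_series u -> (forall k, u (S (2 * k)) = 0) ->
  Series u = Series (fun k => u (2 * k)%nat)).
{ intros u Hu H; symmetry; apply is_series_unique.
  change (is_lim_seq (sum_n (fun k => u (2 * k)%nat)) (Series u)).
  apply is_lim_seq_ext with (fun n => sum_n u (2 * n)).
  - intros n; rewrite !sum_n_Reals; induction n as [|n IH]; [reflexivity|].
    replace (2 * S n)%nat with (S (S (2 * n))) by lia.
    rewrite !tech5, H, IH; replace (2 * S n)%nat with (S (S (2 * n))) by lia; ring.
  - apply (is_lim_seq_subseq (sum_n u) (Series u) (fun n => (2 * n)%nat)).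
    + apply eventually_subseq; intros; lia.
    + exact (Series_correct u Hu). }
intros Hw H; unfold CSeries; f_equal; apply main;
 auto using ex_series_Rabs, Csummable_fst, Csummable_snd; intros k; rewrite H; reflexivity.
Qed.

(** Averaging the series at [x] and [-x] removes the odd terms without an appeal
    to uniqueness of power series. *)
Lemma class_R_even (r M : R) (z : R -> C) : 1 < r -> class_R r M z -> even_on_unit z ->
  exists b : nat -> C, (forall k, Cmod (b k) <= M * (/ r ^ 2) ^ k) /\
    forall x, 0 <= x <= 1 -> z x = CSeries (fun k => (RtoC (x ^ 2) ^ k * b k)%C).
Proof.
intros Hr (alpha & Hal & Hz) Hev.
assert (HM : 0 <= M).
{ pose proof (Hal 0%nat) as H; simpl in H; pose proof (Cmod_ge_0 (alpha 0%nat)); lra. }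
exists (fun k => (RtoC (/ INR (fact (2 * k))) * alpha (2 * k)%nat)%C); split.
- intros k; rewrite Cmod_mult, Cmod_R; pose proof (fact_pos (2 * k)).
  rewrite Rabs_pos_eq by (left; apply Rinv_0_lt_compat; assumption).
  pose proof (pow_lt r (2 * k) ltac:(lra)); pose proof (Hal (2 * k)%nat) as H1.
  apply (Rmult_le_compat_l (/ INR (fact (2 * k)))) in H1;
   [|left; apply Rinv_0_lt_compat; assumption].
  eapply Rle_trans; [exact H1|]; right.
  rewrite pow_inv, <- pow_mult; field; lra.
- intros x Hx.
  set (w := fun x n => (alpha n * RtoC (x ^ n / INR (fact n)))%C).
  assert (Sw : forall x, -1 <= x <= 1 -> Csummable (w x)).
  { intros s Hs; apply Csummable_dom with (fun n => M * (/ r) ^ n).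
    - intros n; unfold w; rewrite Cmod_mult, Cmod_R.
      pose proof (fact_pos n); pose proof (pow_lt r n ltac:(lra)).
      unfold Rdiv; rewrite Rabs_mult, Rabs_inv, (Rabs_pos_eq (INR _)), <- RPow_abs by lra.
      assert (Rabs s ^ n <= 1).
      { rewrite <- (pow1 n); apply pow_incr; split; [apply Rabs_pos|apply Rabs_le; lra]. }
      apply Rle_trans with (M * INR (fact n) / r ^ n * (1 * / INR (fact n))).
      + apply Rmult_le_compat; [apply Cmod_ge_0| |apply Hal|].
        * apply Rmult_le_pos; [apply pow_le, Rabs_pos|left; apply Rinv_0_lt_compat; assumption].
        * apply Rmult_le_compat_r; [left; apply Rinv_0_lt_compat; assumption|assumption].
      + right; rewrite pow_inv; field; lra.
    - apply ex_series_scal_R, ex_series_geom.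
      rewrite Rabs_pos_eq by (left; apply Rinv_0_lt_compat; lra).
      rewrite <- Rinv_1; apply Rinv_lt_contravar; lra. }
  assert (Ez : forall x, -1 <= x <= 1 -> CSeries (w x) = z x)
    by (intros; apply is_series_CSeries, Hz; assumption).
  assert (E : z x = CSeries (fun n => (RtoC (/ 2) * (w x n + w (- x)%R n))%C)).
  { rewrite CSeries_scal, CSeries_plus, !Ez, Hev by (try apply Csummable_plus; try apply Sw; lra).
    replace (z x + z x)%C with (RtoC 2 * z x)%C by ring.
    rewrite Cmult_assoc, <- RtoC_mult, Rinv_l by lra; ring. }
  rewrite E, CSeries_even_terms.
  + apply CSeries_ext; intros k; unfold w.
    replace ((- x) ^ (2 * k)) with (x ^ (2 * k)) by (rewrite !pow_mult; f_equal; ring).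
    pose proof (fact_pos (2 * k)).
    replace (x ^ (2 * k) / INR (fact (2 * k))) with ((x ^ 2) ^ k * / INR (fact (2 * k)))
      by (rewrite <- pow_mult; reflexivity).
    rewrite RtoC_mult, RtoC_pow.
    replace (RtoC (/ 2) * (alpha (2 * k)%nat * (RtoC (x ^ 2) ^ k * RtoC (/ INR (fact (2 * k)))) +
      alpha (2 * k)%nat * (RtoC (x ^ 2) ^ k * RtoC (/ INR (fact (2 * k))))))%C with
     ((RtoC (/ 2) * RtoC 2) * (RtoC (x ^ 2) ^ k * (RtoC (/ INR (fact (2 * k))) * alpha (2 * k)%nat)))%C
     by ring.
    rewrite <- RtoC_mult, Rinv_l by lra; ring.
  + apply Csummable_scal, Csummable_plus; apply Sw; lra.
  + intros k; unfold w.
    replace ((- x) ^ S (2 * k)) with (- x ^ S (2 * k)).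
    * unfold Rdiv; rewrite Ropp_mult_distr_l_reverse, RtoC_opp; ring.
    * rewrite <- !tech_pow_Rmult, !pow_mult; replace ((- x) ^ 2) with (x ^ 2) by ring; ring.
Qed.

Lemma Cmod_Cexpi (s : R) : Cmod (Cexpi s) = 1.
Proof.
unfold Cmod, Cexpi; simpl fst; simpl snd.
replace (cos s ^ 2 + sin s ^ 2) with 1; [apply sqrt_1|].
pose proof (sin2_cos2 s) as H; unfold Rsqr in H; simpl; lra.
Qed.

(** [exp(1/e) >= 1 + 1/e >= 4/3], and [64 * 4/3 > 85]. *)
Lemma radius_bound (r : R) : 8 * exp (/ (2 * exp 1)) < r -> 1 < r /\ / r ^ 2 < / 85.
Proof.
intros Hr.
assert (He : 0 < exp 1) by apply exp_pos.
assert (H1 : 1 + / exp 1 <= exp (/ exp 1)) by apply exp_ineq1_le.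
assert (H2 : exp (/ exp 1) = exp (/ (2 * exp 1)) ^ 2).
{ simpl; rewrite Rmult_1_r, <- exp_plus; f_equal; field; lra. }
assert (H3 : / 3 <= / exp 1) by (apply Rinv_le_contravar; [exact He|apply exp_le_3]).
assert (H4 : 0 < exp (/ (2 * exp 1))) by apply exp_pos.
assert (H5 : 1 < exp (/ (2 * exp 1))) by nra.
split; [lra|]; apply Rinv_lt_contravar; [|nra].
apply Rmult_lt_0_compat; [lra|apply pow_lt; lra].
Qed.

Theorem theorem2p6 (theta phi r T : R)
  (hr : 8 * exp (/ (2 * exp 1)) < r) (hT : 0 < T) :
  exists M : R, 0 < M /\
    forall y0 yT : R -> C,
      class_R r M y0 -> even_on_unit y0 ->
      class_R r M yT -> even_on_unit yT ->
      exists (y : R -> R -> C) (v : R -> C),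
        Gevrey2 1 2 0 1 0 T y /\
        Gevrey 2 0 T v /\
        (forall x t : R, 0 <= x <= 1 -> 0 <= t <= T ->
           partial_t 0 T y x t =
             (Cexpi theta * partial_x 0 1 (partial_x 0 1 y) x t
              + Cexpi phi * (RtoC (Cmod (y x t) ^ 2) * y x t))%C) /\
        (forall t : R, 0 <= t <= T -> partial_x 0 1 y 0 t = RtoC 0) /\
        (forall t : R, 0 <= t <= T -> partial_x 0 1 y 1 t = v t) /\
        (forall x : R, 0 <= x <= 1 -> y x 0 = y0 x) /\
        (forall x : R, 0 <= x <= 1 -> y x T = yT x).
Proof.
destruct (radius_bound r hr) as [Hr1 Hr2].
(* The chain of rates: the states have rate [1/r^2 < 1/85], which becomes [1/80]
   with the weights [1/(k+1)^2] and [1/75] for the row [k = 0].  The cut [b = 8]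
   satisfies [9 * 8 / 75 < 1] and gives the rate [2/8]; absorbing the factors
   [n + 1] turns it into [3/8], and solving in [x] turns that into [2/5], still
   below [4/9]. *)
destruct (two_point_borel_ritt 8 (/ 75) T hT ltac:(lra) ltac:(lra) ltac:(lra)) as (K & HK & Hborel).
set (lam := Cexpi theta); set (mu := Cexpi phi).
assert (Hlam : Cmod lam = 1) by apply Cmod_Cexpi.
assert (Hmu : Cmod mu = 1) by apply Cmod_Cexpi.
assert (Hlam0 : lam <> 0) by (apply Cmod_gt_0; lra).
set (e := Rmin (/ 300) (/ (60 * 343 * K))).
assert (He1 : 0 < e) by (apply Rmin_pos; apply Rinv_0_lt_compat; nra).
assert (He2 : e <= / 300) by apply Rmin_l.
(* The two bounds on [e] are what the steps [1/80] to [1/75] and [3/8] to [2/5]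
   require in [majorant_step]. *)
assert (He3 : 343 * K * e <= / 60).
{ apply Rle_trans with (343 * K * / (60 * 343 * K)); [|right; field; lra].
  apply Rmult_le_compat_l; [nra|apply Rmin_r]. }
assert (Hdata : forall z, class_R r (e / 1600) z -> even_on_unit z ->
  exists A : nat -> nat -> C, array_equation lam mu A /\
   (forall n, Cmod (A 0%nat n) <= e * (/ 75) ^ n * weight 0 n) /\
   forall x, 0 <= x <= 1 -> z x = CSeries (fun k => (RtoC (x ^ 2) ^ k * A k 0%nat)%C)).
{ intros z Hz Hev.
  destruct (class_R_even r (e / 1600) z Hr1 Hz Hev) as (b & Hb & Ez).
  destruct (array_from_column lam mu b) as (A & A0 & HA).
  exists A; split; [exact HA|split].
  - intros n.
    pose proof (array_bound_from_column lam mu A e (/ 80) (/ 75) Hlam Hmu HA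
      ltac:(lra) ltac:(lra) ltac:(nra)) as HAb.
    eapply Rle_trans; [apply HAb|].
    + intros k; rewrite A0, weight_0_r, Rmult_1_r; eapply Rle_trans; [apply Hb|].
      unfold weighted.
      pose proof (linear_le_geometric (/ 40) k ltac:(lra)) as HL; rewrite Rinv_inv in HL.
      pose proof (pos_INR k).
      assert (H1 : (/ r ^ 2) ^ k <= (/ 85) ^ k).
      { apply pow_incr; split; [left; apply Rinv_0_lt_compat, pow_lt; lra|lra]. }
      assert (H2 : (INR k + 1) ^ 2 <= 1600 * ((1 + / 40) ^ 2) ^ k).
      { rewrite <- pow_mult, Nat.mul_comm, pow_mult.
        replace (1600 * ((1 + / 40) ^ k) ^ 2) with ((40 * (1 + / 40) ^ k) ^ 2) by ring.
        apply pow_incr; lra. }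
      assert (H3 : ((1 + / 40) ^ 2) ^ k * (/ 85) ^ k <= (/ 80) ^ k).
      { rewrite <- Rpow_mult_distr; apply pow_incr; lra. }
      pose proof (pow_lt (/ 85) k ltac:(lra)).
      apply Rle_trans with (e / 1600 * (/ 85) ^ k); [apply Rmult_le_compat_l; lra|].
      replace (e * ((/ 80) ^ k / (INR k + 1) ^ 2)) with (e * (/ 80) ^ k / (INR k + 1) ^ 2)
        by (field; lra).
      assert (Hsq : 0 < (INR k + 1) ^ 2) by nra.
      apply (proj1 (Rle_div_r _ _ _ Hsq)).
      replace (e / 1600 * (/ 85) ^ k * (INR k + 1) ^ 2)
        with (e * ((/ 85) ^ k * (/ 1600 * (INR k + 1) ^ 2))) by field.
      apply Rmult_le_compat_l; [lra|]; eapply Rle_trans; [|exact H3].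
      rewrite Rmult_comm; apply Rmult_le_compat_r; lra.
    + right; unfold weighted; simpl; field.
  - intros x Hx; rewrite (Ez x Hx); apply CSeries_ext; intros k; rewrite A0; reflexivity. }
exists (e / 1600); split; [lra|]; intros y0 yT C0 V0 CT VT.
destruct (Hdata y0 C0 V0) as (A & HA & BA & EA).
destruct (Hdata yT CT VT) as (A' & HA' & BA' & EA').
destruct (Hborel (A 0%nat) (A' 0%nat) e BA BA') as (F & HF & F0 & FT & BF).
destruct (array_from_row lam mu 0 T F Hlam0 HF) as (c & c0 & c_jet & c_eq).
set (e' := 343 * K * e).
assert (c_bound : forall k n t, 0 <= t <= T ->
  Cmod (c k n t) <= e' * (2 / 5) ^ k * weighted (3 / 8) n * weight k n).
{ intros k n t Ht.
  assert (He' : 0 <= e' <= / 60) by (unfold e'; split; [|exact He3]; nra).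
  apply (array_bound_from_row lam mu (fun k n => c k n t)); auto; try lra.
  - nra.
  - clear k n; intros n; rewrite c0; eapply Rle_trans; [apply BF; exact Ht|].
    apply Rmult_le_compat_r; [left; apply weight_pos|].
    replace (2 / 8) with (/ 4) by field; unfold weighted, e'.
    pose proof (linear_le_geometric (/ 7) n ltac:(lra)) as HL; rewrite Rinv_inv in HL.
    pose proof (pos_INR n).
    assert (H1 : (INR n + 1) ^ 3 <= 343 * ((1 + / 7) ^ 3) ^ n).
    { rewrite <- pow_mult, Nat.mul_comm, pow_mult.
      replace (343 * ((1 + / 7) ^ n) ^ 3) with ((7 * (1 + / 7) ^ n) ^ 3) by ring.
      apply pow_incr; lra. }
    assert (H2 : ((1 + / 7) ^ 3) ^ n * (/ 4) ^ n <= (3 / 8) ^ n).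
    { rewrite <- Rpow_mult_distr; apply pow_incr; lra. }
    pose proof (pow_lt (/ 4) n ltac:(lra)).
    replace (343 * K * e * ((3 / 8) ^ n / (INR n + 1) ^ 2))
      with (343 * K * e * (3 / 8) ^ n / (INR n + 1) ^ 2) by (field; lra).
    assert (Hsq : 0 < (INR n + 1) ^ 2) by nra.
    apply (proj1 (Rle_div_r _ _ _ Hsq)).
    replace (K * e * (INR n + 1) * (/ 4) ^ n * (INR n + 1) ^ 2)
      with (K * e * ((/ 4) ^ n * (INR n + 1) ^ 3)) by ring.
    replace (343 * K * e * (3 / 8) ^ n) with (K * e * (343 * (3 / 8) ^ n)) by ring.
    apply Rmult_le_compat_l; [nra|].
    apply Rle_trans with ((/ 4) ^ n * (343 * ((1 + / 7) ^ 3) ^ n)); [apply Rmult_le_compat_l; lra|].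
    nra. }
assert (He' : 0 <= e') by (unfold e'; nra).
assert (Hag : agrees T c 0 0 (series_value c 0 0)) by (intros x t _ _; reflexivity).
assert (Hval : forall A z s, array_equation lam mu A -> (forall n, F n s = A 0%nat n) ->
  (forall x, 0 <= x <= 1 -> z x = CSeries (fun k => (RtoC (x ^ 2) ^ k * A k 0%nat)%C)) ->
  forall x, 0 <= x <= 1 -> series_value c 0 0 x s = z x).
{ intros B z s HB FB Ez x Hx; rewrite (Ez x Hx); apply CSeries_ext; intros k.
  rewrite series_term_00; f_equal.
  apply (array_unique lam mu (fun k n => c k n s) B Hlam0 (c_eq s) HB).
  intros n; rewrite c0; apply FB. }
assert (Ha : 0 < 3 / 8) by lra; assert (Ha' : 0 < 2 / 5) by lra.
assert (Haq : 9 / 4 * (2 / 5) < 1) by lra.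
pose proof (agrees_x T e' (3/8) (2/5) c He' Ha Ha' Haq c_bound) as AX.
pose proof (agrees_t T e' (3/8) (2/5) c hT He' Ha Ha' Haq c_jet c_bound) as AT.
exists (series_value c 0 0), (series_value c 1 0 1).
split; [|split; [|split; [|split; [|split; [|split]]]]].
- apply (series_value_gevrey2 T e' (3/8) (2/5)); assumption.
- apply (flux_gevrey T e' (3/8) (2/5)); assumption.
- intros x t Hx Ht.
  rewrite (AT _ _ _ Hag x t Hx Ht), (AX _ _ _ (AX _ _ _ Hag) x t Hx Ht).
  apply (series_value_equation lam mu T e' (3/8) (2/5)); assumption.
- intros t Ht; rewrite (AX _ _ _ Hag 0 t) by (auto; lra); apply series_value_neumann.
- intros t Ht; apply (AX _ _ _ Hag 1 t); [lra|exact Ht].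
- apply (Hval A y0 0 HA F0 EA).
- apply (Hval A' yT T HA' FT EA').
Qed.
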